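(* Let $A$ be a trace-class operator on $L^2(\mathbb{R}_+)$. Then $A$ is a positive operator if and only if the function $$\mathcal{F}_W(A\mathcal{D}^{-1})(x,a)=\mathrm{tr}(AU(x,a))$$ is of positive type on $\mathrm{Aff}$.
   Context: $\mathrm{Aff}=\mathbb{R}\times\mathbb{R}_+$, $\mathbb{R}_+=(0,\infty)$, is the affine group with $(x,a)\cdot(y,b)=(ay+x,ab)$. $L^2(\mathbb{R}_+)=L^2(\mathbb{R}_+,r^{-1}dr)$, with unitary representation $U(x,a)\psi(r)=e^{2\pi i xr}\psi(ar)$. The left-hand symbol $\mathcal{F}_W(A\mathcal{D}^{-1})$ is simply notation for the function $(x,a)\mapsto\mathrm{tr}(AU(x,a))$ (where $\mathcal{D}^{-1}$ is multiplication by $r^{-1/2}$). ''Positive operator'' means positive semi-definite. A function $f:\mathrm{Aff}\to\mathbb{C}$ is of positive type if for any finite set of points $(x_1,a_1),\dots,(x_n,a_n)\in\mathrm{Aff}$ the matrix with entries $f((x_i,a_i)^{-1}(x_j,a_j))$ is positive semi-definite. *)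

(* Defs.v *)
From HB Require Import structures.
From mathcomp Require Import all_boot all_order all_algebra.
From mathcomp Require Import generic_quotient ring_quotient.
From mathcomp Require Import all_classical all_reals all_analysis measurable_realfun.
From mathcomp Require Import complex ring.

Set Implicit Arguments.
Unset Strict Implicit.
Unset Printing Implicit Defensive.

Import Order.TTheory GRing.Theory Num.Theory.
Import numFieldNormedType.Exports.

Local Open Scope classical_set_scope.
Local Open Scope ring_scope.

Local Notation Re := (@complex.Re _).
Local Notation Im := (@complex.Im _).

Section Aff.
Variable R : realType.

Definition Aff : Type := {p : R * R | 0 < p.2}.
HB.instance Definition _ := Choice.on Aff.

Implicit Types g h : Aff.

Definition aff_mk (x a : R) (a0 : 0 < a) : Aff :=
  exist (fun p : R * R => is_true (0 < p.2)) (x, a) a0.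

Lemma aff_gt0 g : 0 < (val g).2. Proof. exact: (valP g). Qed.

Definition aff_one : Aff := aff_mk 0 ltr01.

Definition aff_mul g h : Aff :=
  aff_mk ((val g).2 * (val h).1 + (val g).1) (mulr_gt0 (aff_gt0 g) (aff_gt0 h)).

Lemma aff_inv_gt0 g : 0 < (val g).2^-1.
Proof. by rewrite invr_gt0 aff_gt0. Qed.

Definition aff_inv g : Aff := aff_mk (- (val g).1 / (val g).2) (aff_inv_gt0 g).

Lemma aff_mulA : associative aff_mul.
Proof.
move=> g h k; apply: val_inj => /=.
by rewrite mulrDr !mulrA addrA.
Qed.

Lemma aff_mul1 : left_id aff_one aff_mul.
Proof.
by case=> [[x a] a0]; apply: val_inj; rewrite /= !mul1r addr0.
Qed.

Lemma aff_mulr1 : right_id aff_one aff_mul.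
Proof.
by case=> [[x a] a0]; apply: val_inj; rewrite /= mulr0 add0r mulr1.
Qed.

Lemma aff_mulV : left_inverse aff_one aff_inv aff_mul.
Proof.
case=> [[x a] /= a0]; apply: val_inj; rewrite /= mulVf ?gt_eqF//.
by rewrite mulNr mulrC subrr.
Qed.

Lemma aff_mulrV : right_inverse aff_one aff_inv aff_mul.
Proof.
case=> [[x a] /= a0]; apply: val_inj; rewrite /= mulfV ?gt_eqF//.
by rewrite mulrCA mulfV ?gt_eqF// mulr1 addNr.
Qed.

HB.instance Definition _ := isGroup.Build Aff
  aff_mulA aff_mul1 aff_mulr1 aff_mulV aff_mulrV.

End Aff.

Section SquareIntegrable.
Variable R : realType.
Local Notation C := R[i].
Local Notation mu := (@lebesgue_measure R).

Definition posR : set R := `]0, +oo[%classic.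

Lemma posRE (r : R) : posR r = (0 < r).
Proof. by rewrite /posR /= in_itv /= andbT. Qed.

Lemma measurable_posR : measurable posR. Proof. exact: measurable_itv. Qed.

Definition cnorm2 (z : C) : R := Re z ^+ 2 + Im z ^+ 2.

Lemma cnorm2_ge0 z : 0 <= cnorm2 z.
Proof. by rewrite addr_ge0 ?sqr_ge0. Qed.

Lemma cnorm2D z w : cnorm2 (z + w) <= 2 * cnorm2 z + 2 * cnorm2 w.
Proof.
case: z => a b; case: w => c d; rewrite /cnorm2 /= -subr_ge0.
have -> : 2 * (a ^+ 2 + b ^+ 2) + 2 * (c ^+ 2 + d ^+ 2) -
    ((a + c) ^+ 2 + (b + d) ^+ 2) = (a - c) ^+ 2 + (b - d) ^+ 2 by ring.
by rewrite addr_ge0 ?sqr_ge0.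
Qed.

Lemma cnorm2M z w : cnorm2 (z * w) = cnorm2 z * cnorm2 w.
Proof. by case: z => a b; case: w => c d; rewrite /cnorm2 /=; ring. Qed.

Definition cmeas (f : R -> C) : Prop :=
  measurable_fun posR (Re \o f) /\
  measurable_fun posR (Im \o f).

(* Values of the functions outside (0, +oo) are irrelevant junk. *)
Definition sq_integrable (f : R -> C) : Prop :=
  cmeas f /\ (\int[mu]_(r in posR) (cnorm2 (f r) / r)%:E < +oo)%E.

Definition L2pred : {pred R -> C} := fun f => `[< sq_integrable f >].

Lemma measurable_inv_pos : measurable_fun posR (fun r : R => r^-1).
Proof.
apply: open_continuous_measurable_fun; first exact: interval_open.
move=> r; rewrite inE posRE => r0.
by apply: inv_continuous; rewrite gt_eqF.
Qed.

Lemma cmeas_norm2 f : cmeas f ->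
  measurable_fun posR (fun r => (cnorm2 (f r) / r)%:E).
Proof.
case=> mr mi; apply/measurable_EFinP; apply: measurable_funM.
  by apply: measurable_funD; apply: measurable_funX.
exact: measurable_inv_pos.
Qed.

Lemma cnorm2_weight_ge0 z r : posR r -> (0 <= (cnorm2 z / r)%:E)%E.
Proof.
rewrite posRE => r0.
by rewrite lee_fin mulr_ge0 ?cnorm2_ge0// invr_ge0 ltW.
Qed.

Lemma cmeasD f g : cmeas f -> cmeas g -> cmeas (f + g).
Proof.
move=> [fr fi] [gr gi]; split.
  apply: eq_measurable_fun (measurable_funD fr gr) => r _ /=.
  by rewrite fctE; case: (f r) => ? ?; case: (g r).
apply: eq_measurable_fun (measurable_funD fi gi) => r _ /=.
by rewrite fctE; case: (f r) => ? ?; case: (g r).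
Qed.

Lemma cmeasM f g : cmeas f -> cmeas g -> cmeas (fun r => f r * g r).
Proof.
move=> [fr fi] [gr gi]; split.
  apply: eq_measurable_fun
    (measurable_funB (measurable_funM fr gr) (measurable_funM fi gi)) => r _ /=.
  by case: (f r) => ? ?; case: (g r).
apply: eq_measurable_fun
  (measurable_funD (measurable_funM fr gi) (measurable_funM fi gr)) => r _ /=.
by case: (f r) => ? ?; case: (g r).
Qed.

Lemma L2pred_submod_closed : submod_closed L2pred.
Proof.
split.
  apply/asboolP; split; first by split; exact: measurable_cst.
  under eq_integral do rewrite /cnorm2 /= expr0n /= addr0 mul0r.
  by rewrite integral0.
move=> a f g /asboolP[mf If] /asboolP[mg Ig]; apply/asboolP.
have maf : cmeas (a *: f).
  by apply: (@cmeasM (cst a) f) => //; split; exact: measurable_cst.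
have mafg : cmeas (a *: f + g) by exact: cmeasD.
split=> //.
pose F r := ((2 * cnorm2 a)%:E * (cnorm2 (f r) / r)%:E)%E.
pose G r := (2%:E * (cnorm2 (g r) / r)%:E)%E.
apply: (@le_lt_trans _ _ (\int[mu]_(r in posR) (F r + G r))%E).
  apply: ge0_le_integral => //.
  - exact: measurable_posR.
  - by move=> r r0; exact: cnorm2_weight_ge0.
  - exact: cmeas_norm2.
  - apply: emeasurable_funD;
      by apply: emeasurable_funM; [exact: measurable_cst|exact: cmeas_norm2].
  - move=> r; rewrite posRE => r0.
    rewrite /F /G -!EFinM -EFinD lee_fin !mulrA -mulrDl ler_pM2r ?invr_gt0//.
    by rewrite -mulrA -cnorm2M; exact: cnorm2D.
rewrite ge0_integralD//; last 5 first.
- exact: measurable_posR.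
- move=> r r0; rewrite /F mule_ge0 ?cnorm2_weight_ge0//.
  by rewrite lee_fin mulr_ge0 ?cnorm2_ge0.
- by apply: emeasurable_funM; [exact: measurable_cst|exact: cmeas_norm2].
- by move=> r r0; rewrite /G mule_ge0 ?cnorm2_weight_ge0.
- by apply: emeasurable_funM; [exact: measurable_cst|exact: cmeas_norm2].
have I2 h : (0 <= \int[mu]_(r in posR) (cnorm2 (h r) / r)%:E)%E.
  by apply: integral_ge0 => r; exact: cnorm2_weight_ge0.
rewrite /F /G ge0_integralZl_EFin ?ge0_integralZl_EFin//.
- apply: lte_add_pinfty; apply: lte_mul_pinfty => //.
  by rewrite lee_fin mulr_ge0 ?cnorm2_ge0.
- exact: measurable_posR.
- by move=> r r0; exact: cnorm2_weight_ge0.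
- exact: cmeas_norm2.
- exact: measurable_posR.
- by move=> r r0; exact: cnorm2_weight_ge0.
- exact: cmeas_norm2.
- by rewrite mulr_ge0 ?cnorm2_ge0.
Qed.

HB.instance Definition _ := GRing.isSubmodClosed.Build C (R -> C) L2pred
  L2pred_submod_closed.

Record L2fun : Type := MkL2fun { L2val :> R -> C; _ : L2val \in L2pred }.
HB.instance Definition _ := [isSub for L2val].
HB.instance Definition _ := [Choice of L2fun by <:].
HB.instance Definition _ := [SubChoice_isSubLmodule of L2fun by <:].

Lemma L2funP (f : L2fun) : sq_integrable f.
Proof. by apply/asboolP; exact: (valP f). Qed.

Definition mkL2 (f : R -> C) (hf : sq_integrable f) : L2fun :=
  @MkL2fun f (asboolT hf).

Definition L2null : {pred L2fun} :=
  fun f => `[< (f : R -> C) = cst 0 %[ae mu in posR] >].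

Lemma L2nullZ (a : C) f : f \in L2null -> a *: f \in L2null.
Proof.
move=> /asboolP hf; apply/asboolP.
apply: (@filterS _ _ (ae_filter_ringOfSetsType mu)) hf => r hr /hr hfr /=.
by rewrite -[LHS]/(a * f r) hfr mulr0.
Qed.

Lemma L2null_zmod_closed : zmod_closed L2null.
Proof.
split; first by apply/asboolP/aeW.
move=> f g /asboolP hf /asboolP hg; apply/asboolP.
by apply: (@filterS2 _ _ (ae_filter_ringOfSetsType mu)) hf hg => r hf hg r0; rewrite /= !fctE hf// hg// subr0.
Qed.

HB.instance Definition _ := GRing.isZmodClosed.Build L2fun L2null
  L2null_zmod_closed.

End SquareIntegrable.

Section L2.
Variable R : realType.
Local Notation C := R[i].
Local Notation mu := (@lebesgue_measure R).
Local Open Scope quotient_scope.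

Definition L2 : Type := Quotient.quot (@L2null R).
HB.instance Definition _ := GRing.Zmodule.on L2.
HB.instance Definition _ := EqQuotient.on L2.
HB.instance Definition _ := @ZmodQuotient.on L2.

Lemma L2_eqP (f g : L2fun R) :
  (\pi_L2 f = \pi_L2 g) <-> ((f : R -> C) = (g : R -> C) %[ae mu in @posR R]).
Proof.
split=> [/eqP|h].
  rewrite -[_ == _]Quotient.idealrBE => /asboolP.
  apply: (@filterS _ _ (ae_filter_ringOfSetsType mu)) => r h /h /=.
  by rewrite !fctE => /eqP; rewrite subr_eq0 => /eqP.
apply/eqP; rewrite -[_ == _]Quotient.idealrBE; apply/asboolP.
by apply: (@filterS _ _ (ae_filter_ringOfSetsType mu)) h => r h /h /=; rewrite !fctE => ->; rewrite subrr.
Qed.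

Lemma pi_L2D (f g : L2fun R) : \pi_L2 (f + g) = \pi_L2 f + \pi_L2 g.
Proof. exact: (Quotient.pi_add (@L2null R)). Qed.

Definition L2scale (a : C) : L2 -> L2 := lift_op1 L2 (fun f : L2fun R => a *: f).

Lemma pi_L2scale (a : C) (f : L2fun R) : \pi_L2 (a *: f) = L2scale a (\pi_L2 f).
Proof.
rewrite /L2scale; unlock; apply/eqP.
rewrite -[_ == _]Quotient.idealrBE -scalerBr L2nullZ//.
by rewrite Quotient.idealrBE reprK.
Qed.

Lemma L2scaleA a b v : L2scale a (L2scale b v) = L2scale (a * b) v.
Proof. by rewrite -[v]reprK -!pi_L2scale scalerA. Qed.

Lemma L2scale1 : left_id 1 L2scale.
Proof. by move=> v; rewrite -[v]reprK -pi_L2scale scale1r. Qed.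

Lemma L2scaleDr : right_distributive L2scale +%R.
Proof.
move=> a u v; rewrite -[u]reprK -[v]reprK.
by rewrite -pi_L2D -pi_L2scale scalerDr pi_L2D !pi_L2scale.
Qed.

Lemma L2scaleDl v : {morph L2scale^~ v : a b / a + b}.
Proof.
by move=> a b /=; rewrite -[v]reprK -!pi_L2scale -pi_L2D scalerDl.
Qed.

HB.instance Definition _ := GRing.Zmodule_isLmodule.Build C L2
  L2scaleA L2scale1 L2scaleDr L2scaleDl.

(* inner product of L2(R_+, dr/r), linear in the first argument *)
Definition L2finner (f g : R -> C) : C :=
  Complex (\int[mu]_(r in @posR R) (Re (f r * (g r)^*%C) / r))
          (\int[mu]_(r in @posR R) (Im (f r * (g r)^*%C) / r)).

Definition L2inner (u v : L2) : C := L2finner (repr u) (repr v).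

Definition L2norm (u : L2) : R := Num.sqrt (Re (L2inner u u)).

Lemma L2innerE (f g : L2fun R) : L2inner (\pi_L2 f) (\pi_L2 g) = L2finner f g.
Proof.
have ff : (repr (\pi_L2 f) : R -> C) = f %[ae mu in @posR R].
  by apply/L2_eqP; rewrite reprK.
have gg : (repr (\pi_L2 g) : R -> C) = g %[ae mu in @posR R].
  by apply/L2_eqP; rewrite reprK.
have meas (h k : L2fun R) : cmeas (fun r => h r * (k r)^*%C).
  have [mh _] := L2funP h; have [[kr ki] _] := L2funP k.
  apply: (@cmeasM R h (fun r => (k r)^*%C)) => //; split.
    by apply: eq_measurable_fun kr => r _ /=; case: (k r).
  apply: eq_measurable_fun (measurableT_comp (@oppr_measurable R setT) ki).
  by move=> r _ /=; case: (k r).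
have mw (h : R -> R) : measurable_fun (@posR R) h ->
    measurable_fun (@posR R) (fun r => (h r / r)%:E).
  move=> mh; apply/measurable_EFinP/measurable_funM => //.
  exact: measurable_inv_pos.
by rewrite /L2inner /L2finner; congr Complex; congr fine;
  (apply: ae_eq_integral;
   [exact: measurable_posR|apply: mw; exact: (meas _ _).1 || exact: (meas _ _).2
   |apply: mw; exact: (meas _ _).1 || exact: (meas _ _).2|];
   apply: (@filterS2 _ _ (ae_filter_ringOfSetsType mu)) ff gg => r hf hg r0;
   rewrite hf// hg).
Qed.

End L2.

Section Representation.
Variable R : realType.
Local Notation C := R[i].
Local Notation mu := (@lebesgue_measure R).
Local Open Scope quotient_scope.

Definition dil (a r : measurableTypeR R) : measurableTypeR R := a * r.

Lemma measurable_dil (a : R) : measurable_fun setT (dil a).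
Proof. exact: measurable_funM. Qed.

Lemma lebesgue_dil (a : R) (X : set (measurableTypeR R)) : 0 < a ->
  measurable X -> mu X = (a%:E * mu (dil a @^-1` X))%E.
Proof.
move=> a0 mX.
pose nu := mscale (NngNum (ltW a0))
  (measure_function_pushforward__canonical__measure_function_Measure mu
    (measurable_dil a)).
rewrite (@lebesgue_measure_unique R nu)// => {mX} {X} _ [[x y] _ <-] /=.
rewrite /nu /mscale /= /pushforward.
have -> : dil a @^-1` `]x, y]%classic = `]x / a, y / a]%classic.
  apply/seteqP; split=> r /=; rewrite /dil !in_itv /=;
    by rewrite ltr_pdivrMr// ler_pdivlMr// mulrC.
rewrite !lebesgue_measure_itv /= !lte_fin ltr_pM2r ?invr_gt0//.
case: ifP => _; last by rewrite mule0.
rewrite -!EFinD -EFinM; congr (_%:E).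
by rewrite -mulrBl mulrCA mulfV ?gt_eqF// mulr1.
Qed.

Lemma dil_posR (a : R) : 0 < a -> dil a @^-1` @posR R = @posR R.
Proof.
move=> a0; apply/seteqP.
by split=> r; rewrite /preimage /= !posRE /dil pmulr_rgt0.
Qed.

Lemma integral_dil (a : R) (h : R -> \bar R) : 0 < a ->
  measurable_fun (@posR R) h -> (forall r, posR r -> 0 <= h r)%E ->
  (\int[mu]_(r in @posR R) h r =
   a%:E * \int[mu]_(r in @posR R) h (dil a r))%E.
Proof.
move=> a0 mh h0.
pose nu := mscale (NngNum (ltW a0))
  (measure_function_pushforward__canonical__measure_function_Measure mu
    (measurable_dil a)).
rewrite (@eq_measure_integral _ _ _ _ nu); last first.
  by move=> A mA _; exact: lebesgue_dil.
rewrite /nu ge0_integral_mscale//; last exact: measurable_posR.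
congr (_ * _)%E.
rewrite (@ge0_integral_pushforward _ _ _ _ _ _ (measurable_dil a))//.
- by rewrite dil_posR.
- exact: measurable_posR.
- by move=> r; rewrite inE; exact: h0.
Qed.

Definition expi (t : R) : C := Complex (cos t) (sin t).

Lemma cnorm2_expi t : cnorm2 (expi t) = 1.
Proof. exact: cos2Dsin2. Qed.

Definition Ufun (g : Aff R) (f : R -> C) : R -> C :=
  fun r => expi (2 * pi * (val g).1 * r) * f ((val g).2 * r).

Lemma measurable_fun_dil (a : R) (h : R -> R) : 0 < a ->
  measurable_fun (@posR R) h -> measurable_fun (@posR R) (fun r => h (a * r)).
Proof.
move=> a0 mh; apply: (@measurable_comp _ _ _ _ _ _ (@posR R) h _ (dil a)) => //.
- exact: measurable_posR.
- by move=> _ [r r0 <-]; move: r0; rewrite !posRE /dil pmulr_rgt0.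
- exact: measurable_funTS (measurable_dil a).
Qed.

Lemma cmeas_expi (x : R) : cmeas (fun r : R => expi (x * r)).
Proof.
split; apply: measurable_funTS.
  apply: (@measurableT_comp _ _ _ _ _ _ (@cos R)).
    exact: continuous_measurable_fun (@continuous_cos R).
  exact: measurable_funM.
apply: (@measurableT_comp _ _ _ _ _ _ (@sin R)).
  exact: continuous_measurable_fun (@continuous_sin R).
exact: measurable_funM.
Qed.

Lemma Ufun_sq_integrable (g : Aff R) f :
  sq_integrable f -> sq_integrable (Ufun g f).
Proof.
move=> [[fr fi] If]; have a0 := aff_gt0 g.
have mU : cmeas (Ufun g f).
  apply: cmeasM; first exact: cmeas_expi.
  by split; [exact: measurable_fun_dil fr|exact: measurable_fun_dil fi].
split=> //.
set I := (\int[_]_(_ in _) _)%E.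
have : (0 <= I)%E by apply: integral_ge0 => r; exact: cnorm2_weight_ge0.
suff <- : (\int[mu]_(r in @posR R) (cnorm2 (f r) / r)%:E = I)%E by [].
rewrite (integral_dil a0)//.
- rewrite -ge0_integralZl_EFin//.
  + apply: eq_integral => r; rewrite inE posRE => r0.
    rewrite -EFinM; congr (_%:E).
    rewrite /Ufun cnorm2M cnorm2_expi mul1r /dil invfM.
    by rewrite mulrCA mulVKf ?gt_eqF.
  + exact: measurable_posR.
  + by move=> r; rewrite -{1}(dil_posR a0); exact: cnorm2_weight_ge0.
  + apply: (@measurable_comp _ _ _ _ _ _ (@posR R)
      (fun r => (cnorm2 (f r) / r)%:E) _ (dil (val g).2)).
    * exact: measurable_posR.
    * by move=> _ [r r0 <-]; move: r0; rewrite -{1}(dil_posR a0).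
    * exact: cmeas_norm2.
    * exact: measurable_funTS (measurable_dil _).
  + exact: ltW.
- exact: cmeas_norm2.
- by move=> r; exact: cnorm2_weight_ge0.
Qed.

(* U(x,a) psi (r) = e^{2 pi i x r} psi (a r) *)
Definition U (g : Aff R) (psi : L2 R) : L2 R :=
  \pi_(L2 R) (mkL2 (Ufun_sq_integrable g (L2funP (repr psi)))).

Lemma UE (g : Aff R) (f : L2fun R) :
  U g (\pi_(L2 R) f) = \pi_(L2 R) (mkL2 (Ufun_sq_integrable g (L2funP f))).
Proof.
apply/L2_eqP.
have [N [mN N0 sN]] : (repr (\pi_(L2 R) f) : R -> C) = f %[ae mu in @posR R].
  by apply/L2_eqP; rewrite reprK.
have a0 := aff_gt0 g.
exists (dil (val g).2 @^-1` N); split.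
- by rewrite -[X in measurable X]setTI; exact: measurable_dil.
- have := lebesgue_dil a0 mN; rewrite N0 => /esym/eqP.
  by rewrite mule_eq0 eqe gt_eqF//= => /eqP.
- move=> r /= hr; apply: sN => /= hN; apply: hr => r0.
  rewrite /Ufun; congr (_ * _); apply: hN.
  by move: r0; rewrite -{1}(dil_posR a0).
Qed.

End Representation.

Section Operators.
Variable R : realType.
Local Notation C := R[i].
Implicit Types (T : L2 R -> L2 R) (e : nat -> L2 R).

(* convergence of a complex series *)
Definition csum_to (z : nat -> C) (t : C) : Prop :=
  (fun n => Re (\sum_(k < n) z k)) @ \oo --> Re t /\
  (fun n => Im (\sum_(k < n) z k)) @ \oo --> Im t.

(* L2 R is separable and infinite dimensional, so that its orthonormal bases
   can be indexed by nat *)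
Definition orthonormal_basis e : Prop :=
  (forall m n, L2inner (e m) (e n) = (m == n)%:R) /\
  (forall f : L2 R,
    (fun n => L2norm (f - \sum_(k < n) L2inner f (e k) *: e k)) @ \oo --> 0).

Definition bounded_op T : Prop :=
  exists M : R, forall f, L2norm (T f) <= M * L2norm f.

(* in the order of R[i], 0 <= z means that z is real and nonnegative *)
Definition positive_op T : Prop := forall f, 0 <= L2inner (T f) f.

(* B is |A|, the positive square root of A^* A *)
Definition is_absop (A B : {linear L2 R -> L2 R}) : Prop :=
  [/\ bounded_op B, positive_op B &
      forall f g, L2inner (B (B f)) g = L2inner (A f) (A g)].

Definition trace_class (A : {linear L2 R -> L2 R}) : Prop :=
  bounded_op A /\
  exists (B : {linear L2 R -> L2 R}) e,
    [/\ is_absop A B, orthonormal_basis e &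
        (\sum_(n <oo) (Re (L2inner (B (e n)) (e n)))%:E < +oo)%E].

Definition has_trace T (t : C) : Prop :=
  forall e, orthonormal_basis e -> csum_to (fun n => L2inner (T (e n)) (e n)) t.

(* the common value of sum_n <T e_n, e_n> over all orthonormal bases, and 0 if
   there is no such value *)
Definition trace T : C := xget 0 [set t | has_trace T t].

Definition psd_mx n (M : 'M[C]_n) : Prop :=
  forall v : 'cV[C]_n, 0 <= \sum_i \sum_j (v i 0)^*%C * M i j * v j 0.

Definition positive_type (G : groupType) (f : G -> C) : Prop :=
  forall n (g : 'I_n -> G), psd_mx (\matrix_(i, j) f ((g i)^-1 * g j)%g).

End Operators.

(* Main.v *)
Require Import Defs.
From HB Require Import structures.
From mathcomp Require Import all_boot all_order all_algebra generic_quotient.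
From mathcomp Require Import all_classical all_reals all_analysis.
From mathcomp Require Import measurable_realfun complex ring lra.

(** Write f(g) = tr (A U(g)) and, for a finite family of points g_j with weights v_j,
    T = sum_j v_j U(g_j). As U is a unitary representation, the quadratic form that
    defines positive type is

      sum_(i, j) conj v_i f(g_i^-1 g_j) v_j = tr (T A T^* ).

    If A is positive, so is T A T^*, and its trace is nonnegative.

    Conversely, assume that tr (T A T^* ) >= 0 for all such T. If T could be the rank-one
    operator chi (x) psi : h -> <h, psi> chi, then tr (T A T^* ) = |chi|^2 <A psi, psi>,
    and A would be positive. Rank-one operators are reached in two steps.

    First, U(x, 1) multiplies by exp (2 i pi x r), and U(0, a) is the
    dilation D_a. So M_q (sum_j D_(a_j)) M_phi is a combination of the U(g) when the
    multipliers q and phi are trigonometric polynomials. The trace passes to bounded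
    pointwise limits of q and phi, and every bounded Borel function is obtained from
    trigonometric polynomials by iterating such limits ([bounded_borel_trig_closure]).
    Hence positivity holds for all bounded Borel multipliers ([mult_dil_pos_bounded]).

    Second, take q = chi the indicator function of [1, 2] and phi = conj psi, with psi
    bounded and supported in a compact subset of (0, oo), and put
    T_a = M_chi D_a M_(conj psi). As da / a is invariant under dilations, the
    integral of T_a with respect to da / a is h -> <h, psi> chi. Instead of approximating this
    integral by Riemann sums, which would require continuity, points a_1, ..., a_n are
    sampled: the trace for T = sum_j T_(a_j) is a double sum whose n (n - 1)
    off-diagonal terms have, for independent points, the mean
    c <A psi, psi> with c > 0, while the diagonal terms are bounded. Some choice
    of points exceeds the mean by at most n ([greedy], [greedy_window]); as the
    double sum is nonnegative, dividing by n^2 gives <A psi, psi> >= 0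
    ([compact_support_ge0]). Such psi are dense and A is bounded.

    All traces are computed from one expansion A = sum_k <., c k> a k with
    sum_k |a k| |c k| finite ([trace_class_rank_one]): the trace of T A T^* is
    sum_k <T a k, T c k> in every orthonormal basis ([trace_rank_one]), and limits are
    exchanged with this sum by Tannery's theorem ([csum_tannery]). *)

Set Implicit Arguments.
Unset Strict Implicit.
Unset Printing Implicit Defensive.

Import Order.TTheory GRing.Theory Num.Theory.
Import numFieldNormedType.Exports.

Local Open Scope classical_set_scope.
Local Open Scope ring_scope.

Local Notation Re := (@complex.Re _).
Local Notation Im := (@complex.Im _).

(** * Dominated convergence for real and complex series *)

Section Tannery.
Variable R : realType.
Implicit Types (u v M : nat -> R).

Lemma series_ord u : series u = (fun n => \sum_(k < n) u k).
Proof. by apply/funext => n; rewrite /series /= big_mkord. Qed.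

Lemma cvg_sum_ord (F : nat -> nat -> R) (l : nat -> R) K :
  (forall k, F k n @[n --> \oo] --> l k) ->
  (\sum_(k < K) F k n) @[n --> \oo] --> \sum_(k < K) l k.
Proof.
move=> Fl; elim: K => [|K IH].
  under eq_fun do rewrite big_ord0.
  by rewrite big_ord0; exact: cvg_cst.
under eq_fun do rewrite big_ord_recr.
by rewrite big_ord_recr; apply: cvgD.
Qed.

Lemma dominated_series_cvg u M : (forall k, `|u k| <= M k) ->
  cvgn (series M) -> cvgn (series u).
Proof.
move=> uM cM; apply: normed_cvg; apply: series_le_cvg cM => // n.
  exact: normr_ge0.
exact: le_trans (normr_ge0 _) (uM n).
Qed.

(** The estimate that makes dominated convergence uniform: the part of the sum
    beyond K is controlled by the tail of the dominating series alone. *)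
Lemma dominated_series_tail u M (s m : R) K : (forall k, `|u k| <= M k) ->
  series M @ \oo --> m -> series u @ \oo --> s ->
  `|s - \sum_(k < K) u k| <= m - \sum_(k < K) M k.
Proof.
move=> uM cM cu.
have h1 : (`|series u n - \sum_(k < K) u k|) @[n --> \oo]
    --> `|s - \sum_(k < K) u k|.
  by apply: cvg_norm; apply: cvgB => //; exact: cvg_cst.
have h2 : (series M n - \sum_(k < K) M k) @[n --> \oo]
    --> m - \sum_(k < K) M k.
  by apply: cvgB => //; exact: cvg_cst.
apply: ler_cvg_to h1 h2 _; near=> n.
have Kn : (K <= n)%N by near: n; exact: nbhs_infty_ge.
rewrite -!(big_mkord xpredT) /series /=.
rewrite !(big_cat_nat (leq0n K) Kn)/= ![_ + _ - _]addrAC !subrr !add0r.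
by apply: le_trans (ler_norm_sum _ _ _) _; exact: ler_sum.
Unshelve. all: by end_near. Qed.

(** Tannery's theorem: cut all series at a common K where the tail of M is small,
    and pass to the limit in the finite sums that remain. *)
Lemma tannery (u : nat -> nat -> R) v M (s : nat -> R) (t : R) :
  (forall N k, `|u N k| <= M k) -> cvgn (series M) ->
  (forall k, u N k @[N --> \oo] --> v k) ->
  (forall N, series (u N) @ \oo --> s N) -> series v @ \oo --> t ->
  s @ \oo --> t.
Proof.
move=> uM cM uv us vt.
have vM k : `|v k| <= M k.
  have h : `|u N k| @[N --> \oo] --> `|v k| by apply: cvg_norm.
  by apply: ler_cvg_to h (cvg_cst (M k)) _; exact: nearW.
apply/cvgrPdist_le => e e0.
have e3 : 0 < e / 3 by rewrite divr_gt0.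
(* a common cut-off for all the series at once *)
have [K hK] : exists K, lim (series M @ \oo) - \sum_(k < K) M k <= e / 3.
  have /cvgrPdist_le /(_ _ e3) [K _ hK] := cM.
  exists K; rewrite (le_trans (ler_norm _))//.
  by have := hK K (leqnn _); rewrite series_ord.
have hc : (\sum_(k < K) u N k) @[N --> \oo] --> \sum_(k < K) v k.
  exact: (@cvg_sum_ord (fun k N => u N k)).
have /cvgrPdist_le /(_ _ e3) hN := hc.
near=> N.
have h1 := dominated_series_tail K (uM N) cM (us N).
have h2 := dominated_series_tail K vM cM vt.
have h3 : `|\sum_(k < K) v k - \sum_(k < K) u N k| <= e / 3 by near: N.
have -> : t - s N = (t - \sum_(k < K) v k)
   + (\sum_(k < K) v k - \sum_(k < K) u N k) - (s N - \sum_(k < K) u N k) by ring.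
apply: le_trans (ler_normB _ _) _.
apply: le_trans (lerD (ler_normD _ _) (lexx _)) _.
rewrite -[leRHS](_ : e / 3 + e / 3 + e / 3 = e); last by field.
by rewrite !lerD// (le_trans h1, le_trans h2).
Unshelve. all: by end_near. Qed.

End Tannery.

Section ComplexConvergence.
Variable R : realType.
Local Notation C := R[i].
Implicit Types (z w : nat -> C) (t : C).

Definition cabs (x : C) : R := Num.sqrt (cnorm2 x).

Lemma cabs_ge0 x : 0 <= cabs x. Proof. exact: sqrtr_ge0. Qed.

Lemma cabs_sqr x : cabs x ^+ 2 = cnorm2 x.
Proof. by rewrite sqr_sqrtr// cnorm2_ge0. Qed.

Lemma cabsM x y : cabs (x * y) = cabs x * cabs y.
Proof. by rewrite /cabs cnorm2M sqrtrM// cnorm2_ge0. Qed.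

Lemma cnorm2J (x : C) : cnorm2 x^*%C = cnorm2 x.
Proof. by case: x => a b; rewrite /cnorm2 /= sqrrN. Qed.

Lemma cabsJ (x : C) : cabs x^*%C = cabs x.
Proof. by rewrite /cabs cnorm2J. Qed.

Lemma Re_le_cabs (x : C) : `|Re x| <= cabs x.
Proof. by rewrite -sqrtr_sqr ler_wsqrtr// lerDl sqr_ge0. Qed.

Lemma Im_le_cabs (x : C) : `|Im x| <= cabs x.
Proof. by rewrite -sqrtr_sqr ler_wsqrtr// lerDr sqr_ge0. Qed.

Lemma cabs0 : cabs 0 = 0.
Proof. by rewrite /cabs /cnorm2 /= expr0n /= addr0 sqrtr0. Qed.

Lemma cabs_eq0 (x : C) : cabs x = 0 -> x = 0.
Proof.
move=> h; have := Re_le_cabs x; have := Im_le_cabs x; rewrite h !normr_le0.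
by case: x {h} => a b /= /eqP -> /eqP ->.
Qed.

Lemma cReD (x y : C) : Re (x + y) = Re x + Re y.
Proof. by case: x; case: y. Qed.
Lemma cImD (x y : C) : Im (x + y) = Im x + Im y.
Proof. by case: x; case: y. Qed.
Lemma cReM (x y : C) : Re (x * y) = Re x * Re y - Im x * Im y.
Proof. by case: x; case: y. Qed.
Lemma cImM (x y : C) : Im (x * y) = Re x * Im y + Im x * Re y.
Proof. by case: x; case: y. Qed.
Lemma cReJ (x : C) : Re x^*%C = Re x. Proof. by case: x. Qed.
Lemma cImJ (x : C) : Im x^*%C = - Im x. Proof. by case: x. Qed.
Lemma cReB (x y : C) : Re (x - y) = Re x - Re y.
Proof. by case: x; case: y. Qed.
Lemma cImB (x y : C) : Im (x - y) = Im x - Im y.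
Proof. by case: x; case: y. Qed.

Lemma cRe_sum I (r : seq I) (P : pred I) (F : I -> C) :
  Re (\sum_(i <- r | P i) F i) = \sum_(i <- r | P i) Re (F i).
Proof. by apply: (big_morph Re cReD). Qed.

Lemma cIm_sum I (r : seq I) (P : pred I) (F : I -> C) :
  Im (\sum_(i <- r | P i) F i) = \sum_(i <- r | P i) Im (F i).
Proof. by apply: (big_morph Im cImD). Qed.

Lemma complexP (x y : C) : Re x = Re y -> Im x = Im y -> x = y.
Proof. by case: x; case: y => ? ? ? ? /= -> ->. Qed.

Lemma cabs_sum I (r : seq I) (F : I -> C) :
  cabs (\sum_(i <- r) F i) <= \sum_(i <- r) cabs (F i).
Proof.
have cabsD (x y : C) : cabs (x + y) <= cabs x + cabs y.
  by have := @le_normcD R x y; rewrite /Normc.normc; case: x y => [? ?] [? ?].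
elim: r => [|i r IH]; first by rewrite !big_nil cabs0.
by rewrite !big_cons (le_trans (cabsD _ _))// lerD2l.
Qed.

(** Convergence by real and imaginary parts, which is how [csum_to] is phrased. *)
Definition cvgC z t : Prop :=
  (fun n => Re (z n)) @ \oo --> Re t /\ (fun n => Im (z n)) @ \oo --> Im t.

(** Applies the calculus of [cvgC] to series. *)
Lemma csum_toE z t : csum_to z t = cvgC (fun n => \sum_(k < n) z k) t.
Proof. by []. Qed.

Lemma cvgC_unique z t t' : cvgC z t -> cvgC z t' -> t = t'.
Proof.
move=> [h1 h2] [h3 h4]; apply: complexP.
  exact: cvg_unique h1 h3.
exact: cvg_unique h2 h4.
Qed.

Lemma cvgC_cst t : cvgC (fun=> t) t.
Proof. by split; exact: cvg_cst. Qed.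

Lemma cvgCD z w t t' : cvgC z t -> cvgC w t' -> cvgC (fun n => z n + w n) (t + t').
Proof.
move=> [a b] [c d]; split.
  by under eq_fun do rewrite cReD; rewrite cReD; exact: cvgD.
by under eq_fun do rewrite cImD; rewrite cImD; exact: cvgD.
Qed.

Lemma cvgCM z w t t' : cvgC z t -> cvgC w t' -> cvgC (fun n => z n * w n) (t * t').
Proof.
move=> [a b] [c d]; split.
  by under eq_fun do rewrite cReM; rewrite cReM; apply: cvgB; exact: cvgM.
by under eq_fun do rewrite cImM; rewrite cImM; apply: cvgD; exact: cvgM.
Qed.

Lemma cvgCJ z t : cvgC z t -> cvgC (fun n => (z n)^*%C) t^*%C.
Proof.
move=> [a b]; split.
  by under eq_fun do rewrite cReJ; rewrite cReJ.
by under eq_fun do rewrite cImJ; rewrite cImJ; exact: cvgN.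
Qed.

Lemma cvgC_sum K (F : nat -> nat -> C) (l : nat -> C) :
  (forall k, cvgC (F k) (l k)) ->
  cvgC (fun n => \sum_(k < K) F k n) (\sum_(k < K) l k).
Proof.
move=> h; elim: K => [|K IH].
  by under eq_fun do rewrite big_ord0; rewrite big_ord0; exact: cvgC_cst.
under eq_fun do rewrite big_ord_recr.
by rewrite big_ord_recr; apply: cvgCD.
Qed.

Lemma cvgC_seq (I : Type) (r : seq I) (F : I -> nat -> C) (l : I -> C) :
  (forall k, cvgC (F k) (l k)) ->
  cvgC (fun n => \sum_(k <- r) F k n) (\sum_(k <- r) l k).
Proof.
move=> h; elim: r => [|k r IH].
  by under eq_fun do rewrite big_nil; rewrite big_nil; exact: cvgC_cst.
under eq_fun do rewrite big_cons.
by rewrite big_cons; apply: cvgCD.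
Qed.

Lemma cvgC_cabs z t (e : nat -> R) : (forall n, cabs (z n - t) <= e n) ->
  e @ \oo --> 0 -> cvgC z t.
Proof.
move=> h e0; split; apply/cvgrPdist_le => d d0;
  have /cvgrPdist_le /(_ _ d0) hd := e0; near=> n;
  have : `|0 - e n| <= d by near: n.
  rewrite sub0r normrN => he; rewrite distrC -cReB.
  apply: le_trans (Re_le_cabs _) _; apply: le_trans (h n) _.
  exact: le_trans (ler_norm _) he.
rewrite sub0r normrN => he; rewrite distrC -cImB.
apply: le_trans (Im_le_cabs _) _; apply: le_trans (h n) _.
exact: le_trans (ler_norm _) he.
Unshelve. all: by end_near. Qed.

Lemma csum_dominated z (M : nat -> R) : (forall k, cabs (z k) <= M k) ->
  cvgn (series M) -> exists t, csum_to z t.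
Proof.
move=> zM cM.
have hR : cvgn (series (fun k => Re (z k))).
  by apply: dominated_series_cvg cM => k; exact: le_trans (Re_le_cabs _) (zM k).
have hI : cvgn (series (fun k => Im (z k))).
  by apply: dominated_series_cvg cM => k; exact: le_trans (Im_le_cabs _) (zM k).
exists (Complex (lim (series (fun k => Re (z k)) @ \oo))
                (lim (series (fun k => Im (z k)) @ \oo))); split => /=.
  by under eq_fun do rewrite cRe_sum; move: hR; rewrite series_ord.
by under eq_fun do rewrite cIm_sum; move: hI; rewrite series_ord.
Qed.

(** The form of Tannery's theorem in which all limits below are exchanged. *)
Lemma csum_tannery (u : nat -> nat -> C) (v : nat -> C) (M : nat -> R)
    (s : nat -> C) (t : C) :
  (forall N k, cabs (u N k) <= M k) -> cvgn (series M) ->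
  (forall k, cvgC (u ^~ k) (v k)) ->
  (forall N, csum_to (u N) (s N)) -> csum_to v t -> cvgC s t.
Proof.
move=> uM cM uv us [vR vI]; split.
  apply: (@tannery R (fun N k => Re (u N k)) (fun k => Re (v k)) M).
  - by move=> N k; exact: le_trans (Re_le_cabs _) (uM N k).
  - by [].
  - by move=> k; have [] := uv k.
  - move=> N; have [] := us N; rewrite series_ord.
    by under eq_fun do rewrite cRe_sum.
  - by rewrite series_ord; under eq_fun do rewrite -cRe_sum.
apply: (@tannery R (fun N k => Im (u N k)) (fun k => Im (v k)) M).
- by move=> N k; exact: le_trans (Im_le_cabs _) (uM N k).
- by [].
- by move=> k; have [] := uv k.
- move=> N; have [_] := us N; rewrite series_ord.
  by under eq_fun do rewrite cIm_sum.
- by rewrite series_ord; under eq_fun do rewrite -cIm_sum.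
Qed.

(** One-sided, because a truncated sum is only ever needed to be almost
    nonnegative. *)
Lemma csum_tail z t (M : nat -> R) (m : R) K :
  (forall k, cabs (z k) <= M k) -> series M @ \oo --> m -> csum_to z t ->
  Re t - Re (\sum_(k < K) z k) <= m - \sum_(k < K) M k.
Proof.
move=> zM cM [zR _]; apply: le_trans (ler_norm _) _; rewrite cRe_sum.
apply: (@dominated_series_tail R (fun k => Re (z k))) cM _.
  by move=> k; exact: le_trans (Re_le_cabs _) (zM k).
by rewrite series_ord; under eq_fun do rewrite -cRe_sum.
Qed.

End ComplexConvergence.

(** * Points at which a double sum is at most its mean *)

Section Greedy.
Variables (R : realType) (T : eqType) (D : pred T) (F : (T -> R) -> Prop)
  (avg : (T -> R) -> R) (k : T -> T -> R) (m : R).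

(** The off-diagonal part of the double sum of k over t, symmetrized so that it can
    be built up one point at a time. *)
Fixpoint pairsum (t : seq T) : R :=
  if t is b :: t' then \sum_(a <- t') (k a b + k b a) + pairsum t' else 0.

Lemma pairsumE (t : seq T) :
  \sum_(a <- t) \sum_(b <- t) k a b = pairsum t + \sum_(a <- t) k a a.
Proof.
elim: t => [|b t IH] /=; first by rewrite !big_nil addr0.
rewrite !big_cons.
under [X in _ + X = _]eq_bigr do rewrite big_cons.
by rewrite !big_split /= IH; ring.
Qed.

Hypothesis FD : forall f g, F f -> F g ->
  F (f \+ g) /\ avg (f \+ g) = avg f + avg g.
Hypothesis FZ : forall c f, F f -> F (c \*o f) /\ avg (c \*o f) = c * avg f.
Hypothesis Fpt : forall f, F f -> exists2 b, D b & f b <= avg f + 1.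
Hypothesis Fk : forall b, D b -> F (fun a => k a b + k b a).
Hypothesis Favg : F (fun b => avg (fun a => k a b + k b a)).
Hypothesis avgE : avg (fun b => avg (fun a => k a b + k b a)) = m.

(** A deterministic form of sampling n independent points: if the off-diagonal double
    sum were random, its mean would be n (n - 1) / 2 times the double mean m. The
    points are chosen one after the other, each one not exceeding (up to 1) the mean
    of what it contributes, given that the remaining points will be averaged; the
    function L carries the influence of the points already chosen. Only iterated means of k
    occur. *)
Lemma greedy n (L : T -> R) : F L -> exists t : seq T,
  [/\ size t = n, all D t &
    pairsum t + \sum_(a <- t) L a <= 'C(n, 2)%:R * m + n%:R * avg L + n%:R].
Proof.
elim: n L => [|n IH] L FL.
  by exists [::]; split=> //=; rewrite big_nil !mul0r !addr0.
have [F1 avg1] := FZ n%:R Favg.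
have [F2 avg2] := FD F1 FL.
(* F2 is the contribution of a new point when n further points are averaged *)
have [b Db /= hb] := Fpt F2.
have [F3 avg3] := FD FL (Fk Db).
have [t [st Dt ht]] := IH _ F3.
exists (b :: t); split; [by rewrite /= st|by rewrite /= Db|].
move: ht; rewrite avg3 big_split /= big_cons binS bin1 natrD -natr1 => ht.
move: hb; rewrite avg2 avg1 avgE => hb; lra.
Qed.

End Greedy.

(** * Integration with respect to dr / r *)

Section HaarIntegral.
Variable R : realType.
Local Notation C := R[i].
Local Notation mu := (@lebesgue_measure R).
Implicit Types (f g : R -> R) (h k : R -> C).

(** Integrability and integral with respect to dr / r, the Haar measure of the
    multiplicative group (0, oo). *)
Definition haarI f : Prop := mu.-integrable (@posR R) (fun r => (f r / r)%:E).
Definition haar f : R := \int[mu]_(r in @posR R) (f r / r).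

Lemma measurable_divr f : measurable_fun (@posR R) f ->
  measurable_fun (@posR R) (fun r => (f r / r)%:E).
Proof.
by move=> mf; apply/measurable_EFinP/measurable_funM => //; exact: measurable_inv_pos.
Qed.

Lemma eq_haar f g : (forall r, 0 < r -> f r = g r) -> haar f = haar g.
Proof. by move=> fg; apply: eq_Rintegral => r; rewrite inE posRE => /fg ->. Qed.

Lemma eq_haarI f g : (forall r, 0 < r -> f r = g r) -> haarI f -> haarI g.
Proof.
move=> fg; apply: eq_integrable; first exact: measurable_posR.
by move=> r; rewrite inE posRE => /fg ->.
Qed.

Lemma haarI_dom f g : measurable_fun (@posR R) f ->
  (forall r, 0 < r -> `|f r| <= g r) -> haarI g -> haarI f.
Proof.
move=> mf fg; apply: le_integrable; first exact: measurable_posR.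
  exact: measurable_divr.
move=> r; rewrite posRE => r0; rewrite !abse_EFin lee_fin !normrM ler_wpM2r//.
exact: le_trans (fg r r0) (ler_norm _).
Qed.

Lemma haarI_ge0 f : measurable_fun (@posR R) f -> (forall r, 0 < r -> 0 <= f r) ->
  (\int[mu]_(r in @posR R) (f r / r)%:E < +oo)%E -> haarI f.
Proof.
move=> mf f0 If; apply/integrableP; split; first exact: measurable_divr.
have -> // : (\int[mu]_(x in @posR R) `|(f x / x)%:E| =
  \int[mu]_(x in @posR R) (f x / x)%:E)%E.
apply: eq_integral => r; rewrite inE posRE => r0.
by rewrite abse_EFin ger0_norm// divr_ge0 ?f0// ltW.
Qed.

Lemma haarID f g : haarI f -> haarI g -> haarI (fun r => f r + g r).
Proof.
move=> If Ig; have := @integrableD _ _ _ mu _ (@measurable_posR R) _ _ If Ig.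
apply: eq_integrable; first exact: measurable_posR.
by move=> r _ /=; rewrite mulrDl.
Qed.

Lemma haarIZ a f : haarI f -> haarI (fun r => a * f r).
Proof.
move=> If; have := @integrableZl _ _ _ mu _ (@measurable_posR R) a _ If.
apply: eq_integrable; first exact: measurable_posR.
by move=> r _ /=; rewrite -EFinM mulrA.
Qed.

Lemma haarD f g : haarI f -> haarI g -> haar (fun r => f r + g r) = haar f + haar g.
Proof.
move=> If Ig; rewrite /haar -RintegralD//; last exact: measurable_posR.
by apply: eq_Rintegral => r _; rewrite mulrDl.
Qed.

Lemma haarZ a f : haarI f -> haar (fun r => a * f r) = a * haar f.
Proof.
move=> If; rewrite /haar -RintegralZl//; last exact: measurable_posR.
by apply: eq_Rintegral => r _; rewrite mulrA.
Qed.

Lemma haar_ge0 f : (forall r, 0 < r -> 0 <= f r) -> 0 <= haar f.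
Proof.
move=> f0; apply: Rintegral_ge0 => r; rewrite posRE => r0.
by rewrite divr_ge0 ?f0// ltW.
Qed.

Lemma le_haar f g : haarI f -> haarI g -> (forall r, 0 < r -> f r <= g r) ->
  haar f <= haar g.
Proof.
move=> If Ig fg; apply: le_Rintegral => //; first exact: measurable_posR.
by move=> r; rewrite posRE => r0; rewrite ler_pM2r ?invr_gt0// fg.
Qed.

Lemma haarI0 : haarI (fun=> 0).
Proof.
apply: haarI_ge0 => //.
by under eq_integral do rewrite mul0r; rewrite integral0.
Qed.

Definition chaarI h : Prop := haarI (fun r => Re (h r)) /\ haarI (fun r => Im (h r)).
Definition chaar h : C := Complex (haar (fun r => Re (h r))) (haar (fun r => Im (h r))).

Lemma eq_chaar h k : (forall r, 0 < r -> h r = k r) -> chaar h = chaar k.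
Proof. by move=> hk; congr Complex; apply: eq_haar => r /hk ->. Qed.

Lemma eq_chaarI h k : (forall r, 0 < r -> h r = k r) -> chaarI h -> chaarI k.
Proof. by move=> hk [a b]; split; [apply: eq_haarI a|apply: eq_haarI b] => r /hk ->. Qed.

Lemma chaarID h k : chaarI h -> chaarI k -> chaarI (fun r => h r + k r).
Proof.
move=> [a b] [c d]; split; first by apply: eq_haarI (haarID a c) => r _; rewrite cReD.
by apply: eq_haarI (haarID b d) => r _; rewrite cImD.
Qed.

Lemma chaarD h k : chaarI h -> chaarI k ->
  chaar (fun r => h r + k r) = chaar h + chaar k.
Proof.
move=> [a b] [c d]; apply: complexP; rewrite ?cReD ?cImD /= -haarD//;
  by apply: eq_haar => r _; rewrite ?cReD ?cImD.
Qed.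

Lemma chaarIZ x h : chaarI h -> chaarI (fun r => x * h r).
Proof.
move=> [a b]; split.
  apply: eq_haarI (haarID (haarIZ (Re x) a) (haarIZ (- Im x) b)) => r _.
  by rewrite cReM mulNr.
by apply: eq_haarI (haarID (haarIZ (Re x) b) (haarIZ (Im x) a)) => r _; rewrite cImM.
Qed.

Lemma chaarZ x h : chaarI h -> chaar (fun r => x * h r) = x * chaar h.
Proof.
move=> [a b]; apply: complexP; rewrite ?cReM ?cImM /=.
  rewrite (@eq_haar _ (fun r => Re x * Re (h r) + (- Im x) * Im (h r))).
    by rewrite haarD ?haarZ ?mulNr//; exact: haarIZ.
  by move=> r _; rewrite cReM mulNr.
rewrite (@eq_haar _ (fun r => Re x * Im (h r) + Im x * Re (h r))).
  by rewrite haarD ?haarZ//; exact: haarIZ.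
by move=> r _; rewrite cImM.
Qed.

Lemma chaarJ h : chaarI h -> chaar (fun r => (h r)^*%C) = (chaar h)^*%C.
Proof.
move=> [a b]; apply: complexP => /=; first by apply: eq_haar => r _; rewrite cReJ.
rewrite (@eq_haar _ (fun r => (-1) * Im (h r))) ?haarZ ?mulN1r//.
by move=> r _; rewrite cImJ mulN1r.
Qed.

Lemma chaarIJ h : chaarI h -> chaarI (fun r => (h r)^*%C).
Proof.
move=> [a b]; split; first by apply: eq_haarI a => r _; rewrite cReJ.
by apply: eq_haarI (haarIZ (-1) b) => r _; rewrite cImJ mulN1r.
Qed.

Lemma chaarI0 : chaarI (fun=> 0).
Proof. by split; exact: haarI0. Qed.

Lemma chaar0 : chaar (fun=> 0) = 0.
Proof.
by apply: complexP => /=; rewrite (@eq_haar _ (fun=> 0 * 0)) ?haarZ ?mul0r//;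
  exact: haarI0.
Qed.

Lemma chaarI_sum I (r : seq I) (F : I -> R -> C) : (forall i, chaarI (F i)) ->
  chaarI (fun x => \sum_(i <- r) F i x).
Proof.
move=> h; elim: r => [|i r IH].
  by apply: eq_chaarI chaarI0 => x _; rewrite big_nil.
by apply: eq_chaarI (chaarID (h i) IH) => x _; rewrite big_cons.
Qed.

Lemma chaar_sum I (r : seq I) (F : I -> R -> C) : (forall i, chaarI (F i)) ->
  chaar (fun x => \sum_(i <- r) F i x) = \sum_(i <- r) chaar (F i).
Proof.
move=> h; elim: r => [|i r IH].
  by rewrite (@eq_chaar _ (fun=> 0)) ?chaar0 ?big_nil// => x _; rewrite big_nil.
rewrite big_cons -IH -chaarD//; last exact: chaarI_sum.
by apply: eq_chaar => x _; rewrite big_cons.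
Qed.

Lemma L2finnerE h k : L2finner h k = chaar (fun r => h r * (k r)^*%C).
Proof. by []. Qed.

Lemma cmeasJ h : cmeas h -> cmeas (fun r => (h r)^*%C).
Proof.
move=> [a b]; split; first by apply: eq_measurable_fun a => r _ /=; rewrite cReJ.
by apply: eq_measurable_fun (measurable_funN b) => r _ /=; rewrite cImJ.
Qed.

Lemma sq_integrable_haarI h : sq_integrable h -> haarI (fun r => cnorm2 (h r)).
Proof.
move=> [[a b] I]; apply: haarI_ge0 => //.
  by apply: measurable_funD; exact: measurable_funX.
by move=> r _; exact: cnorm2_ge0.
Qed.

Lemma sq_integrableP h : cmeas h -> haarI (fun r => cnorm2 (h r)) -> sq_integrable h.
Proof.
by move=> mh I; split=> //; apply: integrable_lty => //; exact: measurable_posR.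
Qed.

Lemma sq_integrable_dom h k c : cmeas h -> sq_integrable k ->
  (forall r, 0 < r -> cnorm2 (h r) <= c * cnorm2 (k r)) -> sq_integrable h.
Proof.
move=> mh sk hk; apply: sq_integrableP => //.
apply: haarI_dom (haarIZ c (sq_integrable_haarI sk)).
  by case: mh => a b; apply: measurable_funD; exact: measurable_funX.
by move=> r r0; rewrite ger0_norm ?cnorm2_ge0 ?hk.
Qed.

(** Young's inequality |h k| <= |h|^2 + |k|^2. *)
Lemma sq_integrable_chaarI h k : sq_integrable h -> sq_integrable k ->
  chaarI (fun r => h r * (k r)^*%C).
Proof.
move=> sh sk; have [mh _] := sh; have [mk _] := sk.
have [a b] := cmeasM mh (cmeasJ mk).
have I := haarID (sq_integrable_haarI sh) (sq_integrable_haarI sk).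
have D r : cnorm2 (h r * (k r)^*%C) <= (cnorm2 (h r) + cnorm2 (k r)) ^+ 2.
  rewrite cnorm2M cnorm2J sqrrD; have := cnorm2_ge0 (h r); have := cnorm2_ge0 (k r).
  by move: (cnorm2 _) (cnorm2 _) => x y x0 y0; nra.
have D' r : cabs (h r * (k r)^*%C) <= cnorm2 (h r) + cnorm2 (k r).
  rewrite -(ger0_norm (addr_ge0 (cnorm2_ge0 (h r)) (cnorm2_ge0 (k r)))).
  by rewrite -sqrtr_sqr ler_wsqrtr.
split; [apply: haarI_dom a _ I|apply: haarI_dom b _ I] => r _.
  exact: le_trans (Re_le_cabs _) (D' r).
exact: le_trans (Im_le_cabs _) (D' r).
Qed.

End HaarIntegral.

(** * Positive semi-definite forms and the inner product *)

Section PsdForm.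
Variables (R : realType) (V : lmodType R[i]) (b : V -> V -> R[i]).
Hypothesis bDl : forall u v w, b (u + v) w = b u w + b v w.
Hypothesis bZl : forall a u w, b (a *: u) w = a * b u w.
Hypothesis bDr : forall u v w, b w (u + v) = b w u + b w v.
Hypothesis bZr : forall a u w, b w (a *: u) = a^*%C * b w u.
Hypothesis b_ge0 : forall u, 0 <= b u u.

Lemma psd_form_Im u : Im (b u u) = 0.
Proof. by have := b_ge0 u; rewrite lecE /= => /andP[/eqP]. Qed.

Lemma psd_form_Re u : 0 <= Re (b u u).
Proof. by have := b_ge0 u; rewrite lecE /= => /andP[]. Qed.

(** Polarization: the imaginary parts of b (u + v) (u + v) and of
    b (u + i v) (u + i v) vanish. *)
Lemma psd_form_herm u v : b v u = (b u v)^*%C.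
Proof.
have h1 := psd_form_Im (u + v).
have h2 := psd_form_Im (u + 'i%C *: v).
move: h1 h2; rewrite !(bDl, bDr, bZl, bZr) !cImD !psd_form_Im.
rewrite !(cImM, cReM) !psd_form_Im /=.
by case: (b u v) (b v u) => x y [z t] /= h1 h2; apply: complexP => /=; lra.
Qed.

(** Besides the inner product, this is applied to the form <B f, g> of a positive
    operator, where b u u = 0 does not force u = 0. *)
Lemma psd_form_CS u v : cnorm2 (b u v) <= Re (b u u) * Re (b v v).
Proof.
set p := Re (b u u); set q := Re (b v v); set x := b u v.
have E (s : R) (t : R) :
    0 <= s ^+ 2 * p - 2 * s * t * cnorm2 x + t ^+ 2 * cnorm2 x * q.
  have := psd_form_Re (s%:C%C *: u + (- (t%:C%C * x)) *: v).
  rewrite !(bDl, bDr, bZl, bZr) (psd_form_herm u v) -/x.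
  rewrite !cReD !(cReM, cImM) !psd_form_Im -/p -/q.
  by congr (0 <= _); case: x => x1 x2; rewrite /cnorm2 /=; ring.
have p0 : 0 <= p by exact: psd_form_Re.
have q0 : 0 <= q by exact: psd_form_Re.
have x0 := cnorm2_ge0 x.
move: q0; rewrite le_eqVlt => /predU1P[q0|q0]; last first.
  have := E q 1; nra.
rewrite -q0 mulr0 leNgt; apply/negP => xp.
(* q = 0: with this coefficient the nonnegative expression E would be -1 *)
have := E 1 ((p + 1) / (2 * cnorm2 x)); rewrite -q0 mulr0 addr0.
rewrite (_ : 1 ^+ 2 * p - _ = -1); first by lra.
by field; rewrite gt_eqF.
Qed.

End PsdForm.

Section Conjugation.
Variable R : realType.
Implicit Types x y : R[i].
Lemma cJD x y : (x + y)^*%C = x^*%C + y^*%C. Proof. by rewrite rmorphD. Qed.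
Lemma cJM x y : (x * y)^*%C = x^*%C * y^*%C. Proof. by rewrite rmorphM. Qed.
Lemma cJN x : (- x)^*%C = - x^*%C. Proof. by rewrite rmorphN. Qed.
Lemma cJ0 : (0 : R[i])^*%C = 0. Proof. by rewrite rmorph0. Qed.
End Conjugation.

Section InnerProduct.
Variable R : realType.
Local Notation C := R[i].
Local Open Scope quotient_scope.
Implicit Types (u v w : L2 R).

Lemma ipDl u v w : L2inner (u + v) w = L2inner u w + L2inner v w.
Proof.
rewrite -[u]reprK -[v]reprK -[w]reprK -pi_L2D !L2innerE !L2finnerE.
have I (f g : L2fun R) := sq_integrable_chaarI (L2funP f) (L2funP g).
rewrite -chaarD; [|exact: I..].
by apply: eq_chaar => r _; rewrite -mulrDl.
Qed.

Lemma ipZl a u w : L2inner (a *: u) w = a * L2inner u w.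
Proof.
rewrite -[u]reprK -[w]reprK -[_ *: _]/(L2scale _ _) -pi_L2scale.
rewrite !L2innerE !L2finnerE.
have I (f g : L2fun R) := sq_integrable_chaarI (L2funP f) (L2funP g).
rewrite -chaarZ; [|exact: I..].
by apply: eq_chaar => r _; rewrite mulrA.
Qed.

Lemma ipC u v : L2inner v u = (L2inner u v)^*%C.
Proof.
rewrite -[u]reprK -[v]reprK !L2innerE !L2finnerE.
have I (f g : L2fun R) := sq_integrable_chaarI (L2funP f) (L2funP g).
rewrite -chaarJ; [|exact: I..].
by apply: eq_chaar => r _; rewrite cJM conjcK mulrC.
Qed.

Lemma ipDr u v w : L2inner w (u + v) = L2inner w u + L2inner w v.
Proof. by rewrite ipC ipDl cJD -!ipC. Qed.

Lemma ipZr a u w : L2inner w (a *: u) = a^*%C * L2inner w u.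
Proof. by rewrite ipC ipZl cJM -ipC. Qed.

Lemma finner_self (f : R -> C) :
  L2finner f f = (haar (fun r => cnorm2 (f r)))%:C%C.
Proof.
rewrite L2finnerE; apply: complexP => /=.
  by apply: eq_haar => r _; case: (f r) => x y; rewrite /cnorm2 /=; ring.
rewrite (@eq_haar _ _ (fun=> 0)); first by have := @chaar0 R; case.
by move=> r _; case: (f r) => x y /=; ring.
Qed.

Lemma ip_ge0 u : 0 <= L2inner u u.
Proof.
rewrite -[u]reprK L2innerE finner_self ler0c; apply: haar_ge0 => r _.
exact: cnorm2_ge0.
Qed.

Lemma ipNl u w : L2inner (- u) w = - L2inner u w.
Proof. by rewrite -scaleN1r ipZl mulN1r. Qed.

Lemma ipNr u w : L2inner w (- u) = - L2inner w u.
Proof. by rewrite ipC ipNl cJN -ipC. Qed.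

Lemma ipBl u v w : L2inner (u - v) w = L2inner u w - L2inner v w.
Proof. by rewrite ipDl ipNl. Qed.

Lemma ipBr u v w : L2inner w (u - v) = L2inner w u - L2inner w v.
Proof. by rewrite ipDr ipNr. Qed.

Lemma ip0l w : L2inner 0 w = 0.
Proof. by rewrite -(scale0r (0 : L2 R)) ipZl mul0r. Qed.

Lemma ip0r w : L2inner w 0 = 0.
Proof. by rewrite ipC ip0l cJ0. Qed.

Lemma ip_suml I (r : seq I) (F : I -> L2 R) w :
  L2inner (\sum_(i <- r) F i) w = \sum_(i <- r) L2inner (F i) w.
Proof.
elim: r => [|i r IH]; first by rewrite !big_nil ip0l.
by rewrite !big_cons ipDl IH.
Qed.

Lemma ip_sumr I (r : seq I) (F : I -> L2 R) w :
  L2inner w (\sum_(i <- r) F i) = \sum_(i <- r) L2inner w (F i).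
Proof.
elim: r => [|i r IH]; first by rewrite !big_nil ip0r.
by rewrite !big_cons ipDr IH.
Qed.

Lemma ip_CS u v : cabs (L2inner u v) <= L2norm u * L2norm v.
Proof.
rewrite -sqrtrM; last by have := ip_ge0 u; rewrite lecE /= => /andP[].
rewrite ler_wsqrtr//; apply: psd_form_CS.
- exact: ipDl.
- exact: ipZl.
- exact: ipDr.
- exact: ipZr.
- exact: ip_ge0.
Qed.

Lemma L2norm_ge0 u : 0 <= L2norm u. Proof. exact: sqrtr_ge0. Qed.

Lemma L2norm_sqr u : L2norm u ^+ 2 = Re (L2inner u u).
Proof. by rewrite sqr_sqrtr//; have := ip_ge0 u; rewrite lecE /= => /andP[]. Qed.

Lemma ip_self u : L2inner u u = (L2norm u ^+ 2)%:C%C.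
Proof.
rewrite L2norm_sqr; apply: complexP => //=.
by have := ip_ge0 u; rewrite lecE /= => /andP[/eqP].
Qed.

Lemma L2norm_eq u v : L2inner u u = L2inner v v -> L2norm u = L2norm v.
Proof. by rewrite /L2norm => ->. Qed.

End InnerProduct.

(** * Fourier sums and Parseval *)

Section OrthonormalBasis.
Variables (R : realType) (e : nat -> L2 R).
Local Notation C := R[i].
Implicit Types (u v w : L2 R).

Definition fourier_sum n u : L2 R := \sum_(k < n) L2inner u (e k) *: e k.

Lemma ip_fourier_sum n u v :
  L2inner (fourier_sum n u) v = \sum_(k < n) L2inner u (e k) * L2inner (e k) v.
Proof. by rewrite ip_suml; apply: eq_bigr => k _; rewrite ipZl. Qed.

Hypothesis eB : orthonormal_basis e.

(** Pythagoras: f minus its Fourier sum is orthogonal to the Fourier sum. *)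
Lemma fourier_sum_ortho n u :
  L2inner u u = L2inner (fourier_sum n u) (fourier_sum n u) +
    L2inner (u - fourier_sum n u) (u - fourier_sum n u).
Proof.
have [eo _] := eB.
have h v : L2inner (fourier_sum n u) v = \sum_(k < n) L2inner u (e k) * L2inner (e k) v.
  exact: ip_fourier_sum.
have h2 k : (k < n)%N -> L2inner (e k) (fourier_sum n u) = (L2inner u (e k))^*%C.
  move=> kn; rewrite ipC h; congr (_^*)%C.
  rewrite (bigD1 (Ordinal kn))//= eo eqxx mulr1 big1 ?addr0// => i ik.
  rewrite eo (_ : (i == k :> nat) = false) ?mulr0//.
  by apply/negbTE; apply: contra ik => /eqP ik; apply/eqP/val_inj.
have E : L2inner (fourier_sum n u) (u - fourier_sum n u) = 0.
  rewrite h big1// => k _; rewrite ipBr h2// -ipC subrr mulr0//.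
rewrite !ipBl E subr0 ipBr.
have -> : L2inner (fourier_sum n u) (fourier_sum n u) = L2inner u (fourier_sum n u).
  by apply/eqP; rewrite -subr_eq0 -ipBl -opprB ipNl ipC E cJ0 oppr0.
by rewrite addrC subrK.
Qed.

Lemma fourier_sum_le n u : L2norm (fourier_sum n u) <= L2norm u.
Proof.
rewrite /L2norm ler_wsqrtr// [in leRHS](fourier_sum_ortho n u) cReD lerDl.
by have := ip_ge0 (u - fourier_sum n u); rewrite lecE /= => /andP[].
Qed.

Lemma fourier_sum_cvg u v :
  cvgC (fun n => L2inner (fourier_sum n u) v) (L2inner u v).
Proof.
have [_ eb] := eB.
apply: (@cvgC_cabs _ _ _ (fun n => L2norm (u - fourier_sum n u) * L2norm v)).
  by move=> n; rewrite -ipBl -opprB ipNl -mulN1r cabsM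
    (_ : cabs (-1) = 1) ?mul1r ?ip_CS//
    /cabs /cnorm2 /= oppr0 expr0n addr0 sqrrN expr1n sqrtr1.
rewrite -[X in _ --> X](mul0r (L2norm v)); apply: cvgM; last exact: cvg_cst.
exact: eb.
Qed.

Lemma parseval u v :
  csum_to (fun n => L2inner u (e n) * L2inner (e n) v) (L2inner u v).
Proof.
rewrite csum_toE; have := fourier_sum_cvg u v.
by under eq_fun do rewrite ip_fourier_sum.
Qed.

End OrthonormalBasis.

(** * Gram-Schmidt for a positive semi-definite form *)

Section GramSchmidt.
Variables (R : realType) (V : lmodType R[i]) (b : V -> V -> R[i]).
Hypothesis bDl : forall u v w, b (u + v) w = b u w + b v w.
Hypothesis bZl : forall a u w, b (a *: u) w = a * b u w.
Hypothesis bDr : forall u v w, b w (u + v) = b w u + b w v.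
Hypothesis bZr : forall a u w, b w (a *: u) = a^*%C * b w u.
Hypothesis b_ge0 : forall u, 0 <= b u u.
Variable e : nat -> V.

Let herm := psd_form_herm bDl bZl bDr bZr b_ge0.

Let bNl u w : b (- u) w = - b u w.
Proof. by rewrite -scaleN1r bZl mulN1r. Qed.

Let b0l w : b 0 w = 0.
Proof. by rewrite -(scale0r 0) bZl mul0r. Qed.

Let bsuml I (r : seq I) (F : I -> V) w :
  b (\sum_(i <- r) F i) w = \sum_(i <- r) b (F i) w.
Proof.
elim: r => [|i r IH]; first by rewrite !big_nil b0l.
by rewrite !big_cons bDl IH.
Qed.

(** A null vector of the form is normalized to 0, so that the construction never
    stops, even when the form is degenerate on the span of the sequence. *)
Definition psd_normalize (y : V) : V :=
  if Re (b y y) == 0 then 0 else ((Num.sqrt (Re (b y y)))^-1)%:C%C *: y.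

Fixpoint gs_seq n : seq V := if n is m.+1 then
  rcons (gs_seq m) (psd_normalize (e m - \sum_(d <- gs_seq m) b (e m) d *: d))
  else [::].

Definition gs n := psd_normalize (e n - \sum_(d <- gs_seq n) b (e n) d *: d).

Lemma gs_seqE n : gs_seq n = [seq gs k | k <- iota 0 n].
Proof.
elim: n => [|n IH] //.
by rewrite -(addn1 n) iotaD map_cat -IH add0n cats1 addn1.
Qed.

Definition gs_rest n := e n - \sum_(k < n) b (e n) (gs k) *: gs k.

Lemma gsE n : gs n = psd_normalize (gs_rest n).
Proof.
rewrite /gs /gs_rest gs_seqE big_map.
by rewrite -(big_mkord xpredT (fun k => b (e n) (gs k) *: gs k)) /index_iota subn0.
Qed.

(** Null vectors are orthogonal to everything, by Cauchy-Schwarz. *)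
Lemma psd_null u v : Re (b u u) = 0 -> b u v = 0.
Proof.
move=> u0; have := psd_form_CS bDl bZl bDr bZr b_ge0 u v.
rewrite u0 mul0r => h; apply: cabs_eq0.
by rewrite /cabs (_ : cnorm2 _ = 0) ?sqrtr0//; apply/le_anti; rewrite h cnorm2_ge0.
Qed.

(** Unit vectors and the vector 0 alike behave as projections. *)
Lemma psd_normalize_proj y x :
  b x (psd_normalize y) * b (psd_normalize y) (psd_normalize y) =
  b x (psd_normalize y).
Proof.
rewrite /psd_normalize; case: ifPn => [_|y0]; first by rewrite b0l mulr0 (herm _ x) b0l cJ0.
have yp : 0 < Re (b y y) by rewrite lt_neqAle eq_sym y0 (psd_form_Re b_ge0).
set s := _^-1; have -> : b (s%:C%C *: y) (s%:C%C *: y) = 1; last by rewrite mulr1.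
rewrite bZl bZr; apply: complexP; rewrite !(cReM, cImM) (psd_form_Im b_ge0) /=.
  rewrite !(mulr0, mul0r, subr0, oppr0, addr0) mulrA /s -invfM -expr2.
  by rewrite sqr_sqrtr ?ltW// mulVf.
by rewrite !(mulr0, mul0r, subr0, oppr0, addr0).
Qed.

Lemma gs_ortho j k : (j < k)%N -> b (gs k) (gs j) = 0 /\ b (gs j) (gs k) = 0.
Proof.
suff h n : forall k, (k < n)%N -> forall j, (j < k)%N -> b (gs k) (gs j) = 0.
  by move=> jk; rewrite (herm (gs k)) (h k.+1 k _ j)// cJ0.
elim: n => // n IH k'; rewrite ltnS leq_eqVlt => /predU1P[->|]; last exact: IH.
move=> j' jn; rewrite gsE /psd_normalize; case: ifP => [_|_]; first by rewrite b0l.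
rewrite bZl; move: (_^-1)%:C%C => s; rewrite /gs_rest.
rewrite bDl bNl bsuml (bigD1 (Ordinal jn))//= bZl.
rewrite big1 ?addr0.
  by rewrite (gsE j') psd_normalize_proj subrr mulr0.
move=> i ij; rewrite bZl.
have : (i : nat) != j' by apply: contra ij => /eqP ij; apply/eqP/val_inj.
rewrite neq_ltn => /orP[ij'|ij'].
  by rewrite (herm (gs j')) (IH _ jn)// cJ0 mulr0.
by rewrite (IH i (ltn_ord i) _ ij') mulr0.
Qed.

(** What is left of [e n] after subtracting its components is null for the form,
    whether or not the last normalization was degenerate. *)
Lemma gs_rest_null n :
  Re (b (e n - \sum_(k < n.+1) b (e n) (gs k) *: gs k)
        (e n - \sum_(k < n.+1) b (e n) (gs k) *: gs k)) = 0.
Proof.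
rewrite big_ord_recr /= opprD addrA -/(gs_rest n).
have -> : b (e n) (gs n) = b (gs_rest n) (gs n).
  rewrite /gs_rest bDl bNl bsuml big1 ?subr0// => i _.
  by rewrite bZl (gs_ortho (ltn_ord i)).2 mulr0.
rewrite !gsE /psd_normalize; case: ifP => [/eqP y0|/negbT y0].
  by rewrite scaler0 subr0.
have yp : 0 < Re (b (gs_rest n) (gs_rest n)).
  by rewrite lt_neqAle eq_sym y0 (psd_form_Re b_ge0).
set y := gs_rest n in y0 yp *; set s := _^-1.
rewrite bZr scalerA (_ : _ * _ = 1) ?scale1r ?subrr ?b0l//.
apply: complexP; rewrite !(cReM, cImM) (psd_form_Im b_ge0) /=.
  rewrite !(mulr0, mul0r, subr0, oppr0, addr0) mulrAC /s -invfM -expr2.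
  by rewrite sqr_sqrtr ?ltW// mulVf.
by rewrite !(mulr0, mul0r, subr0, oppr0, addr0).
Qed.

Lemma gs_expand n w : b (e n) w = \sum_(k < n.+1) b (e n) (gs k) * b (gs k) w.
Proof.
apply/eqP; rewrite -subr_eq0 -[X in _ == X](psd_null w (gs_rest_null n)).
rewrite bDl bNl bsuml; apply/eqP; congr (_ - _).
by apply: eq_bigr => k _; rewrite bZl.
Qed.

(** Triangularity: in the basis [e] the form is factored as in the Cholesky
    decomposition of a matrix. *)
Lemma gs_trig n k : (n < k)%N -> b (e n) (gs k) = 0.
Proof.
move=> nk; rewrite gs_expand big1// => i _.
by rewrite (gs_ortho (leq_trans (ltn_ord i) nk)).2 mulr0.
Qed.

Lemma gs_bessel n K : \sum_(k < K) cnorm2 (b (e n) (gs k)) <= Re (b (e n) (e n)).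
Proof.
rewrite gs_expand cRe_sum.
under [in leRHS]eq_bigr => i _.
  rewrite (herm (e n)) (_ : Re _ = cnorm2 (b (e n) (gs i))); last first.
    by case: (b _ _) => x y; rewrite /cnorm2 /=; ring.
  over.
have [Kn|nK] := leqP K n.+1.
  rewrite -!(big_mkord xpredT (fun k => cnorm2 (b (e n) (gs k)))).
  rewrite [leRHS](big_cat_nat (leq0n K) Kn)/= lerDl sumr_ge0// => i _.
  exact: cnorm2_ge0.
rewrite -!(big_mkord xpredT (fun k => cnorm2 (b (e n) (gs k)))).
rewrite [leLHS](big_cat_nat (leq0n n.+1) (ltnW nK))/= gerDl.
rewrite big_nat big1// => i /andP[ni _].
by rewrite gs_trig// /cnorm2 /= expr0n addr0.
Qed.

End GramSchmidt.

(** * Trace-class operators as series of rank-one operators *)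

Section TraceClass.
Variable R : realType.
Local Notation C := R[i].

(** For an operator sum_k <., c k> a k this is absolute convergence in trace
    norm. *)
Definition nsummable (a c : nat -> L2 R) : Prop :=
  cvgn (series (fun k => L2norm (a k) * L2norm (c k))).

Definition rank_one_series (A : L2 R -> L2 R) (a c : nat -> L2 R) : Prop :=
  forall f g, csum_to (fun k => L2inner f (c k) * L2inner (a k) g)
                      (L2inner (A f) g).

Lemma rank_one_dom (f g x y : L2 R) :
  cabs (L2inner f y * L2inner x g) <=
  (L2norm f * L2norm g) * (L2norm x * L2norm y).
Proof.
rewrite cabsM [leRHS](_ : _ = (L2norm f * L2norm y) * (L2norm x * L2norm g)); last by ring.
by rewrite ler_pM ?cabs_ge0 ?ip_CS.
Qed.

Lemma nsummableZ (a c : nat -> L2 R) x : nsummable a c ->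
  cvgn (series (fun k => x * (L2norm (a k) * L2norm (c k)))).
Proof. by move=> h; apply: is_cvg_seriesZ. Qed.

Lemma nsummable_csum (a c : nat -> L2 R) : nsummable a c ->
  exists t, csum_to (fun k => L2inner (a k) (c k)) t.
Proof. by apply: csum_dominated => k; exact: ip_CS. Qed.

Lemma nsummable_rank_one (a c : nat -> L2 R) f g : nsummable a c ->
  exists t, csum_to (fun k => L2inner f (c k) * L2inner (a k) g) t.
Proof.
move=> /(@nsummableZ _ _ (L2norm f * L2norm g)).
by apply: csum_dominated => k; exact: rank_one_dom.
Qed.

(** The trace of sum_k <., y k> x k is sum_k <x k, y k> in every orthonormal basis e.
    Partial traces are sums over k of the inner product of the Fourier sum of [x k]
    with [y k]; these converge for each k and are dominated by |x k| |y k|. *)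
Lemma trace_rank_one (e x y : nat -> L2 R) (z : nat -> C) t :
  orthonormal_basis e -> nsummable x y ->
  (forall n, csum_to (fun k => L2inner (e n) (y k) * L2inner (x k) (e n)) (z n)) ->
  csum_to (fun k => L2inner (x k) (y k)) t -> csum_to z t.
Proof.
move=> eB S hz ht.
apply: (@csum_tannery _ (fun N k => L2inner (fourier_sum e N (x k)) (y k))
  (fun k => L2inner (x k) (y k)) (fun k => L2norm (x k) * L2norm (y k))) => //.
- move=> N k; apply: le_trans (ip_CS _ _) _.
  by rewrite ler_wpM2r ?L2norm_ge0// fourier_sum_le.
- by move=> k; exact: fourier_sum_cvg.
- move=> N; rewrite csum_toE.
  under eq_fun do under eq_bigr do rewrite ip_fourier_sum.
  under eq_fun do rewrite exchange_big /=.
  apply: (@cvgC_sum _ N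
    (fun n K => \sum_(k < K) L2inner (x k) (e n) * L2inner (e n) (y k))).
  by move=> n; under eq_fun do under eq_bigr do rewrite mulrC; exact: hz.
Qed.

(** Let B be the absolute value of A. Gram-Schmidt for the form <B f, g> along the basis
    of the hypothesis produces vectors d k with B = sum_k <., B d k> B d k, a Cholesky
    decomposition that replaces the square root of B. By Tonelli and Parseval the
    squared norms of c k = B d k add up to at most the trace of B. As |A f| = |B f| for
    all f, applying A instead of B to the expansion of f gives A = sum_k <., c k> A d k,
    with |A d k| = |c k|. *)
Lemma trace_class_rank_one (A : {linear L2 R -> L2 R}) : trace_class A ->
  exists a c, nsummable a c /\ rank_one_series A a c.
Proof.
move=> [[M AM] [B [e [[Bb Bpos BA] eB trB]]]].
pose b (f g : L2 R) := L2inner (B f) g.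
have bDl u v w : b (u + v) w = b u w + b v w by rewrite /b linearD ipDl.
have bZl a u w : b (a *: u) w = a * b u w by rewrite /b linearZ ipZl.
have bDr u v w : b w (u + v) = b w u + b w v by rewrite /b ipDr.
have bZr a u w : b w (a *: u) = a^*%C * b w u by rewrite /b ipZr.
have b_ge0 u : 0 <= b u u by exact: Bpos.
have herm u v : L2inner (B u) v = L2inner u (B v).
  by rewrite -[LHS]/(b u v) (psd_form_herm bDl bZl bDr bZr b_ge0) [RHS]ipC.
pose d := gs b e; pose c k := B (d k); pose a k := A (d k).
have ac k : L2norm (a k) = L2norm (c k).
  by apply: L2norm_eq; rewrite -BA herm.
have ec n k : L2inner (e n) (c k) = b (e n) (d k) by rewrite /b herm.
have c2 K : \sum_(k < K) L2norm (c k) ^+ 2 <=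
    fine (\sum_(n <oo) (Re (L2inner (B (e n)) (e n)))%:E)%E.
  have pR n : 0 <= Re (L2inner (B (e n)) (e n)) by exact: psd_form_Re b_ge0 (e n).
  have [h _] : cvgC (fun N => \sum_(k < K) \sum_(n < N)
      L2inner (c k) (e n) * L2inner (e n) (c k)) (\sum_(k < K) L2inner (c k) (c k)).
    by apply: (@cvgC_sum _ K (fun k N => \sum_(n < N) L2inner (c k) (e n) * L2inner (e n) (c k))
      (fun k => L2inner (c k) (c k))) => k; exact: parseval.
  rewrite cRe_sum in h; under eq_bigr do rewrite L2norm_sqr.
  apply: ler_cvg_to h (cvg_cst _) _; apply: nearW => N.
  rewrite exchange_big cRe_sum /=.
  apply: (@le_trans _ _ (\sum_(n < N) Re (L2inner (B (e n)) (e n)))).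
    apply: ler_sum => n _; rewrite cRe_sum.
    apply: le_trans (gs_bessel bDl bZl bDr bZr b_ge0 e n K).
    apply: ler_sum => k _; rewrite ipC ec.
    by case: (b _ _) => x y; rewrite /cnorm2 /= le_eqVlt; apply/orP; left; apply/eqP; ring.
  rewrite -lee_fin fineK.
    rewrite -sumEFin -(big_mkord xpredT (fun n => (Re (L2inner (B (e n)) (e n)))%:E)).
    by apply: nneseries_lim_ge => n _ _; rewrite lee_fin.
  rewrite ge0_fin_numE//; apply: nneseries_ge0 => n _ _; rewrite lee_fin; exact: pR.
have S : nsummable a c.
  rewrite /nsummable (_ : (fun k => _) = (fun k => L2norm (c k) ^+ 2)); last first.
    by apply/funext => k; rewrite ac expr2.
  apply: nondecreasing_is_cvgn.
    by apply: nondecreasing_series => n _ _; exact: sqr_ge0.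
  exists (fine (\sum_(n <oo) (Re (L2inner (B (e n)) (e n)))%:E)%E).
  by move=> _ [n _ <-]; rewrite series_ord.
exists a, c; split=> // f g.
have he n : csum_to (fun k => L2inner (e n) (c k) * L2inner (a k) g) (L2inner (A (e n)) g).
  have -> : L2inner (A (e n)) g = \sum_(k < n.+1) L2inner (e n) (c k) * L2inner (a k) g.
    (* z is null for the form of B, hence B z and then A z have norm 0 *)
    pose z := e n - \sum_(k < n.+1) b (e n) (d k) *: d k.
    have z0 : Re (b z z) = 0 by exact: gs_rest_null.
    have Bz : L2inner (B z) (B z) = 0 by exact: (psd_null bDl bZl bDr bZr b_ge0).
    have Az : L2inner (A z) g = 0.
      apply: cabs_eq0; apply/le_anti; rewrite cabs_ge0 andbT.
      apply: le_trans (ip_CS _ _) _.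
      by rewrite /L2norm -BA herm Bz sqrtr0 mul0r.
    apply/eqP; rewrite -subr_eq0 -[X in _ == X]Az /z linearB ipBl (linear_sum A) ip_suml.
    by apply/eqP; congr (_ - _); apply: eq_bigr => k _; rewrite linearZ ipZl ec.
  rewrite csum_toE; split;
    (apply: cvg_near_cst; near=> N; congr (_ _);
     have nN : (n.+1 <= N)%N by [near: N; exact: nbhs_infty_ge];
     rewrite -!(big_mkord xpredT (fun k => L2inner (e n) (c k) * L2inner (a k) g));
     rewrite (big_cat_nat (leq0n n.+1) nN)/= [X in _ + X]big_nat;
     rewrite [X in _ + X]big1 ?addr0// => k /andP[nk _];
     by rewrite ec (gs_trig bDl bZl bDr bZr b_ge0)// mul0r).
have [t ht] := nsummable_rank_one f g S.
suff -> : L2inner (A f) g = t by [].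
have hN N : csum_to (fun k => L2inner (fourier_sum e N f) (c k) * L2inner (a k) g)
    (L2inner (A (fourier_sum e N f)) g).
  rewrite csum_toE (linear_sum A) ip_suml.
  under eq_bigr do rewrite linearZ ipZl.
  under eq_fun do under eq_bigr do rewrite ip_suml mulr_suml.
  under eq_fun do rewrite exchange_big /=.
  apply: (@cvgC_sum _ N (fun n K => \sum_(k < K)
      L2inner (L2inner f (e n) *: e n) (c k) * L2inner (a k) g)
    (fun n => L2inner f (e n) * L2inner (A (e n)) g)) => n.
  under eq_fun do under eq_bigr do rewrite ipZl -mulrA.
  under eq_fun do rewrite -mulr_sumr.
  by apply: cvgCM; [exact: cvgC_cst|exact: he].
apply: cvgC_unique (_ : cvgC (fun N => L2inner (A (fourier_sum e N f)) g) _) _.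
  apply: (@cvgC_cabs _ _ _ (fun n => `|M| * L2norm (f - fourier_sum e n f) * L2norm g)).
    move=> n; rewrite -ipBl -linearB -opprB linearN ipNl -mulN1r cabsM.
    rewrite (_ : cabs (-1) = 1) ?mul1r; last first.
      by rewrite /cabs /cnorm2 /= oppr0 expr0n addr0 sqrrN expr1n sqrtr1.
    apply: le_trans (ip_CS _ _) _; rewrite ler_wpM2r ?L2norm_ge0//.
    by apply: le_trans (AM _) _; rewrite ler_wpM2r ?L2norm_ge0// ler_norm.
  rewrite -[X in _ --> X](mul0r (L2norm g)); apply: cvgM; last exact: cvg_cst.
  rewrite -[X in _ --> X](mulr0 `|M|); apply: cvgM; first exact: cvg_cst.
  exact: eB.2.
apply: (@csum_tannery _ _ _
  (fun k => (L2norm f * L2norm g) * (L2norm (a k) * L2norm (c k))) _ _ _ _ _ hN ht).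
- move=> N k; apply: le_trans (rank_one_dom _ _ _ _) _.
  by rewrite !ler_wpM2r ?mulr_ge0 ?L2norm_ge0// fourier_sum_le.
- exact: nsummableZ.
- by move=> k; apply: cvgCM; [exact: fourier_sum_cvg|exact: cvgC_cst].
Unshelve. all: by end_near. Qed.

End TraceClass.

(** * Dilations and the unitary representation U *)

Section Dilation.
Variable R : realType.
Local Notation C := R[i].
Local Notation mu := (@lebesgue_measure R).
Implicit Types (f : R -> R) (h k : R -> C).

(** The substitution r -> a r, for functions F and H already divided by r. *)
Lemma integral_dil_div (a : R) (H : R -> \bar R) (F : R -> \bar R) : 0 < a ->
  measurable_fun (@posR R) H -> (forall r : R, 0 < r -> (0 <= H r)%E) ->
  (forall r : R, 0 < r -> F r = (a%:E * H (a * r)%R)%E) ->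
  (\int[mu]_(r in @posR R) F r = \int[mu]_(r in @posR R) H r)%E.
Proof.
move=> a0 mH H0 FH; rewrite (integral_dil a0 mH); last first.
  by move=> r; rewrite posRE; exact: H0.
rewrite -ge0_integralZl_EFin//.
- by apply: eq_integral => r; rewrite inE posRE => /FH.
- exact: measurable_posR.
- by move=> r; rewrite posRE /dil => r0; rewrite H0// mulr_gt0.
- apply: (@measurable_comp _ _ _ _ _ _ (@posR R) H _ (dil a)) => //.
  + exact: measurable_posR.
  + by move=> _ [r r0 <-]; move: r0; rewrite -{1}(dil_posR a0).
  + exact: measurable_funTS (measurable_dil _).
- exact: ltW.
Qed.

Lemma dil_div a f r : 0 < a -> f (a * r) / r = a * (f (a * r) / (a * r)).
Proof. by move=> a0; rewrite invfM [RHS]mulrCA mulVKf// gt_eqF. Qed.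

(** Invariance of dr / r under dilations, extended from nonnegative to signed functions
    through positive and negative parts. *)
Lemma haar_dil a f : 0 < a -> measurable_fun (@posR R) f ->
  haar (fun r => f (a * r)) = haar f.
Proof.
move=> a0 mf; congr fine; rewrite integralE [in RHS]integralE.
have mF := measurable_divr mf.
have pE r : ((f (a * r) / r)%:E = a%:E * (f (a * r) / (a * r))%:E)%E.
  by rewrite -EFinM -dil_div.
congr (_ - _)%E; apply: (integral_dil_div a0).
- exact: measurable_funepos.
- by move=> r _; exact: funepos_ge0.
- by move=> r r0; rewrite !funeposE pE maxe_pMr ?mule0 ?lee_fin ?ltW.
- exact: measurable_funeneg.
- by move=> r _; exact: funeneg_ge0.
- by move=> r r0; rewrite !funenegE pE -muleN maxe_pMr ?mule0 ?lee_fin ?ltW.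
Qed.

Lemma measurable_divK (f : R -> R) : haarI f -> measurable_fun (@posR R) f.
Proof.
move=> If; have mf : measurable_fun (@posR R) (fun r => f r / r).
  by have /measurable_int/measurable_EFinP := If.
apply: eq_measurable_fun (measurable_funM mf (@measurable_id _ _ (@posR R))) => r.
by rewrite inE posRE => r0 /=; rewrite divfK ?gt_eqF.
Qed.

Lemma haarI_dil a f : 0 < a -> haarI f -> haarI (fun r => f (a * r)).
Proof.
move=> a0 If; have mf := measurable_divK If.
apply/integrableP; split.
  apply: (@measurable_divr _ (fun r => f (a * r))).
  exact: measurable_fun_dil.
have /integrableP[_] := If; rewrite (@integral_dil_div a
  (fun r => `|(f r / r)%:E|%E) (fun r => `|(f (a * r) / r)%:E|%E))//.
- by apply: measurableT_comp => //; exact: measurable_divr.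
- by move=> r r0; rewrite dil_div// EFinM abseM gee0_abs// lee_fin ltW.
Qed.

End Dilation.

Section Representation.
Variable R : realType.
Local Notation C := R[i].
Local Open Scope quotient_scope.
Implicit Types (g h : Aff R) (u v w : L2 R).

Lemma expiD (s t : R) : expi (s + t) = expi s * expi t.
Proof. by rewrite /expi cosD sinD; apply: complexP => /=; ring. Qed.

Lemma expi_conj (s : R) : expi s * (expi s)^*%C = 1.
Proof.
apply: complexP => /=; last by ring.
by rewrite mulrN opprK -!expr2 cos2Dsin2.
Qed.

Lemma U_mul g h u : U (g * h)%g u = U g (U h u).
Proof.
rewrite -[u]reprK (UE h) !UE; apply/L2_eqP; apply: aeW => r _ /=.
rewrite /Ufun /= mulrA -expiD; congr (expi _ * L2val (repr u) _); ring.
Qed.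

Lemma U_one u : U 1%g u = u.
Proof.
rewrite -[u]reprK !UE; apply/L2_eqP; apply: aeW => r _ /=.
rewrite /Ufun /= mulr0 mul0r mul1r /expi cos0 sin0.
by rewrite (_ : Complex 1 0 = 1 :> C)// mul1r.
Qed.

(** The modulus of the phase is 1 and dilations preserve dr / r. *)
Lemma U_unitary g u v : L2inner (U g u) (U g v) = L2inner u v.
Proof.
rewrite -[u]reprK -[v]reprK !UE !L2innerE !L2finnerE.
set f := repr u; set k := repr v.
have a0 := aff_gt0 g.
have [I1 I2] := sq_integrable_chaarI (L2funP f) (L2funP k).
have [m1 m2] := cmeasM (L2funP f).1 (cmeasJ (L2funP k).1).
rewrite (@eq_chaar _ _ (fun r => f ((val g).2 * r) * (k ((val g).2 * r))^*%C)).
  by congr Complex; apply: (haar_dil a0 (f := fun r => _)).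
move=> r _; rewrite /= /Ufun cJM mulrACA expi_conj mul1r //.
Qed.

Lemma U_adj g u v : L2inner (U g u) v = L2inner u (U g^-1%g v).
Proof. by rewrite -(U_unitary g^-1%g) -U_mul mulVg U_one. Qed.

Lemma U_norm g u : L2norm (U g u) = L2norm u.
Proof. by apply: L2norm_eq; rewrite U_unitary. Qed.

Lemma L2normD u v : L2norm (u + v) <= L2norm u + L2norm v.
Proof.
rewrite -(@ler_pXn2r _ 2)// ?nnegrE ?addr_ge0 ?L2norm_ge0//.
rewrite sqrrD !L2norm_sqr ipDl !ipDr !cReD (ipC u v) cReJ.
have := le_trans (Re_le_cabs _) (ip_CS u v).
have := ler_norm (Re (L2inner u v)); lra.
Qed.

Lemma L2normZ a u : L2norm (a *: u) = cabs a * L2norm u.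
Proof.
rewrite /L2norm ipZl ipZr mulrA -sqrtrM ?cnorm2_ge0//.
congr Num.sqrt; rewrite ip_self.
by case: a => x y; rewrite /cnorm2 /=; ring.
Qed.

(** The operator T = sum_j v_j U(g_j) attached to a finite family of points with
    weights, the image under U of a finitely supported measure. *)
Definition Ucomb (s : seq (C * Aff R)) u : L2 R := \sum_(p <- s) p.1 *: U p.2 u.

Lemma Ucomb_norm s u : L2norm (Ucomb s u) <= (\sum_(p <- s) cabs p.1) * L2norm u.
Proof.
rewrite /Ucomb; elim: s => [|p s IH].
  by rewrite !big_nil mul0r /L2norm ip0l sqrtr0.
rewrite !big_cons mulrDl (le_trans (L2normD _ _))// lerD//.
by rewrite L2normZ U_norm.
Qed.

Lemma nsummable_Ucomb s a c : nsummable a c ->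
  nsummable (fun k => Ucomb s (a k)) (fun k => Ucomb s (c k)).
Proof.
set m := \sum_(p <- s) cabs p.1.
move=> /(@nsummableZ _ _ _ (m * m)); apply: series_le_cvg => k.
- by rewrite mulr_ge0 ?L2norm_ge0.
- by rewrite !mulr_ge0 ?L2norm_ge0// sumr_ge0// => i _; exact: cabs_ge0.
- rewrite mulrACA ler_pM ?L2norm_ge0 ?Ucomb_norm//.
Qed.

End Representation.

(** * The trace of A U(g), and positivity of A implies positive type *)

Section TraceFormula.
Variables (R : realType) (A : {linear L2 R -> L2 R}) (a c : nat -> L2 R).
Local Notation C := R[i].
Hypothesis hA : trace_class A.
Hypothesis S : nsummable a c.
Hypothesis Aac : rank_one_series A a c.

(** Composing with U g moves the inverse of g to the right-hand vectors c k. *)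
Lemma trace_AU g :
  csum_to (fun k => L2inner (U g (a k)) (c k)) (trace (fun f => A (U g f))).
Proof.
have S' : nsummable a (fun k => U g^-1%g (c k)).
  by rewrite /nsummable; under eq_fun do rewrite U_norm.
have [t ht] := nsummable_csum S'.
have ht' : csum_to (fun k => L2inner (U g (a k)) (c k)) t.
  by under eq_fun do rewrite U_adj.
have H : has_trace (fun f => A (U g f)) t.
  move=> e eB; apply: (trace_rank_one eB S' _ ht) => n.
  by under eq_fun do rewrite -U_adj; exact: Aac.
have [_ [_ [e [_ eB _]]]] := hA.
rewrite /trace (_ : xget _ _ = t)//.
apply: xget_unique => //= t' ht2.
by apply: cvgC_unique (ht2 e eB) (H e eB).
Qed.

(** The quadratic form of positive type at the points and weights of s is the trace of
    T A T^* for T = Ucomb s, in the form sum_k <T a k, T c k>. *)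
Lemma trace_Ucomb (s : seq (C * Aff R)) :
  csum_to (fun k => L2inner (Ucomb s (a k)) (Ucomb s (c k)))
    (\sum_(p <- s) \sum_(q <- s)
       p.1^*%C * trace (fun f => A (U (p.2^-1 * q.2)%g f)) * q.1).
Proof.
rewrite csum_toE.
have E k : L2inner (Ucomb s (a k)) (Ucomb s (c k)) =
  \sum_(p <- s) \sum_(q <- s) p.1^*%C * L2inner (U (p.2^-1 * q.2)%g (a k)) (c k) * q.1.
  rewrite ip_sumr; apply: eq_bigr => p _; rewrite ip_suml; apply: eq_bigr => q _.
  by rewrite ipZl ipZr U_mul (U_adj p.2^-1%g) invgK; ring.
under eq_fun do under eq_bigr do rewrite E.
under eq_fun do rewrite exchange_big /=.
apply: (@cvgC_seq _ _ s (fun p K => \sum_(k < K) \sum_(q <- s)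
  p.1^*%C * L2inner (U (p.2^-1 * q.2)%g (a k)) (c k) * q.1)
  (fun p => \sum_(q <- s) p.1^*%C * trace (fun f => A (U (p.2^-1 * q.2)%g f)) * q.1)) => p.
under eq_fun do rewrite exchange_big /=.
apply: (@cvgC_seq _ _ s (fun q K => \sum_(k < K)
  p.1^*%C * L2inner (U (p.2^-1 * q.2)%g (a k)) (c k) * q.1)
  (fun q => p.1^*%C * trace (fun f => A (U (p.2^-1 * q.2)%g f)) * q.1)) => q.
under eq_fun do rewrite -mulr_suml -mulr_sumr.
by apply: cvgCM (cvgC_cst _); apply: cvgCM (cvgC_cst _) _; exact: trace_AU.
Qed.

Lemma cvgC_ge0 (z : nat -> C) t : (forall n, 0 <= z n) -> cvgC z t -> 0 <= t.
Proof.
move=> z0 [hR hI]; rewrite lecE /=; apply/andP; split.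
  have h : (fun n => Im (z n)) = fun=> 0.
    by apply/funext => n; have := z0 n; rewrite lecE => /andP[/eqP].
  by rewrite h in hI; apply/eqP; exact: cvg_unique hI (cvg_cst _).
apply: ler_cvg_to (cvg_cst 0) hR _; apply: nearW => n.
by have := z0 n; rewrite lecE => /andP[].
Qed.

(** The diagonal coefficients of T A T^* in an orthonormal basis are
    <A (T^* e n), T^* e n>, hence nonnegative. *)
Lemma positive_op_positive_type : positive_op A ->
  positive_type (fun g : Aff R => trace (fun f => A (U g f))).
Proof.
move=> Apos n g v; pose s := [seq (v i 0, g i) | i <- index_enum 'I_n].
have := trace_Ucomb s; set t' := (X in csum_to _ X); set t := (X in 0 <= X).
have -> : t' = t.
  rewrite /t' big_map; apply: eq_bigr => i _; rewrite big_map.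
  by apply: eq_bigr => j _; rewrite mxE.
move=> hs.
have [_ [_ [e [_ eB _]]]] := hA.
(* the adjoint of Ucomb s *)
pose Ts u : L2 R := \sum_(p <- s) p.1^*%C *: U p.2^-1%g u.
have adjl u w : L2inner (Ucomb s u) w = L2inner u (Ts w).
  rewrite ip_suml ip_sumr; apply: eq_bigr => p _.
  by rewrite ipZl ipZr conjcK U_adj.
have adjr u w : L2inner w (Ucomb s u) = L2inner (Ts w) u.
  by rewrite ipC adjl -ipC.
have h := @trace_rank_one _ e _ _
  (fun n => L2inner (A (Ts (e n))) (Ts (e n))) t eB (nsummable_Ucomb (s := s) S) _ hs.
apply: (@cvgC_ge0 (fun N => \sum_(n < N) L2inner (A (Ts (e n))) (Ts (e n)))).
  by move=> N; apply: sumr_ge0 => k _; exact: Apos.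
apply: h => k; under eq_fun do rewrite adjl adjr.
exact: Aac.
Qed.

Lemma positive_type_Ucomb :
  positive_type (fun g : Aff R => trace (fun f => A (U g f))) ->
  forall s t, csum_to (fun k => L2inner (Ucomb s (a k)) (Ucomb s (c k))) t ->
  0 <= t.
Proof.
move=> h s t ht; rewrite (cvgC_unique ht (trace_Ucomb s)).
pose x0 : C * Aff R := (0, 1%g).
have := h (size s) (fun i => (nth x0 s i).2) (\col_i (nth x0 s i).1).
set L := (X in 0 <= X -> _); set L' := (X in _ -> 0 <= X).
rewrite (_ : L = L')// /L /L' (big_nth x0) big_mkord; apply: eq_bigr => i _.
by rewrite (big_nth x0) big_mkord; apply: eq_bigr => j _; rewrite !mxE.
Qed.

End TraceFormula.

(** * Bounded Borel functions as limits of trigonometric polynomials *)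

Section MonotoneClass.
Variable R : realType.
Local Notation C := R[i].
Implicit Types (f g : R -> C).

Definition trigpoly (s : seq (C * R)) : R -> C :=
  fun r => \sum_(p <- s) p.1 * expi (2 * pi * p.2 * r).

(** The smallest class that contains the trigonometric polynomials and is closed under
    bounded pointwise limits of sequences, iterated any number of times. Being
    inductive, it transfers any property that passes to such limits, even one that is
    not stable under sums, such as the positivity of a quadratic expression. *)
Inductive trig_closure : (R -> C) -> Prop :=
| trig_closure_poly s : trig_closure (trigpoly s)
| trig_closure_lim (u : nat -> R -> C) f (M : R) :
    (forall n, trig_closure (u n)) -> (forall n r, cnorm2 (u n r) <= M) ->
    (forall r, cvgC (u ^~ r) (f r)) -> trig_closure f.

Lemma cnorm2_lim (z : nat -> C) t (M : R) : (forall n, cnorm2 (z n) <= M) ->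
  cvgC z t -> cnorm2 t <= M.
Proof.
move=> zM [a b]; apply: ler_cvg_to (cvgD (cvgM a a) (cvgM b b)) (cvg_cst M) _.
by apply: nearW => n; have := zM n; rewrite /cnorm2 !expr2.
Qed.

Lemma trig_closure_bounded f : trig_closure f -> exists M, forall r, cnorm2 (f r) <= M.
Proof.
elim=> [s|u g M _ _ uM ug]; last first.
  by exists M => r; apply: cnorm2_lim (ug r) => n; exact: uM.
exists ((\sum_(p <- s) cabs p.1) ^+ 2) => r.
have h : cabs (trigpoly s r) <= \sum_(p <- s) cabs p.1.
  apply: le_trans (cabs_sum _ _) _; apply: ler_sum => p _.
  by rewrite cabsM /cabs cnorm2_expi sqrtr1 mulr1.
rewrite -cabs_sqr ler_pXn2r// nnegrE ?cabs_ge0// sumr_ge0// => p _.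
exact: cabs_ge0.
Qed.

Lemma trig_closure_ext f g : (forall r, f r = g r) -> trig_closure f -> trig_closure g.
Proof. by move=> /funext ->. Qed.

(** The usual monotone class argument: fix one summand, first a polynomial and then
    any member, and use induction on the other one. *)
Lemma trig_closure_add f g : trig_closure f -> trig_closure g ->
  trig_closure (fun r => f r + g r).
Proof.
move=> Hf; elim: Hf g => {f} [s|u f M Hu IH uM uf] g Hg.
  elim: Hg => {g} [s'|u g M Hu IH uM ug].
    by apply: trig_closure_ext (trig_closure_poly (s ++ s')) => r; rewrite /trigpoly big_cat.
  have [M' hM'] := trig_closure_bounded (trig_closure_poly s).
  apply: (@trig_closure_lim (fun n r => trigpoly s r + u n r) _ (2 * M' + 2 * M)) => //.
    by move=> n r; apply: le_trans (cnorm2D _ _) _; rewrite lerD// ler_pM2l.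
  by move=> r; exact: cvgCD (cvgC_cst _) (ug r).
have [M' hM'] := trig_closure_bounded Hg.
apply: (@trig_closure_lim (fun n r => u n r + g r) _ (2 * M + 2 * M')).
- by move=> n; exact: IH.
- by move=> n r; apply: le_trans (cnorm2D _ _) _; rewrite lerD// ler_pM2l.
- by move=> r; exact: cvgCD (uf r) (cvgC_cst _).
Qed.

Lemma trig_closure_mul f g : trig_closure f -> trig_closure g ->
  trig_closure (fun r => f r * g r).
Proof.
move=> Hf; elim: Hf g => {f} [s|u f M Hu IH uM uf] g Hg.
  elim: Hg => {g} [s'|u g M Hu IH uM ug].
    apply: trig_closure_ext (trig_closure_poly
      [seq (p.1 * q.1, p.2 + q.2) | p <- s, q <- s']) => r.
    rewrite /trigpoly big_allpairs_dep mulr_suml; apply: eq_bigr => p _.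
    rewrite mulr_sumr; apply: eq_bigr => q _ /=.
    by rewrite mulrDr mulrDl expiD; ring.
  have [M' hM'] := trig_closure_bounded (trig_closure_poly s).
  apply: (@trig_closure_lim (fun n r => trigpoly s r * u n r) _ (M' * M)) => //.
    by move=> n r; rewrite cnorm2M ler_pM ?cnorm2_ge0.
  by move=> r; exact: cvgCM (cvgC_cst _) (ug r).
have [M' hM'] := trig_closure_bounded Hg.
apply: (@trig_closure_lim (fun n r => u n r * g r) _ (M * M')).
- by move=> n; exact: IH.
- by move=> n r; rewrite cnorm2M ler_pM ?cnorm2_ge0.
- by move=> r; exact: cvgCM (uf r) (cvgC_cst _).
Qed.

Lemma trig_closure_cst c : trig_closure (fun=> c).
Proof.
apply: trig_closure_ext (trig_closure_poly [:: (c, 0)]) => r.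
rewrite /trigpoly big_seq1 /= mulr0 mul0r /expi cos0 sin0.
by rewrite (_ : Complex 1 0 = 1 :> C)// mulr1.
Qed.

Lemma trig_closure_sum I (s : seq I) (F : I -> R -> C) :
  (forall i, trig_closure (F i)) -> trig_closure (fun r => \sum_(i <- s) F i r).
Proof.
move=> h; elim: s => [|i s IH].
  by apply: trig_closure_ext (trig_closure_cst 0) => r; rewrite big_nil.
by apply: trig_closure_ext (trig_closure_add (h i) IH) => r; rewrite big_cons.
Qed.

Definition rtrig (f : R -> R) : Prop := trig_closure (fun r => (f r)%:C%C).

Lemma rtrig_ext (f g : R -> R) : (forall r, f r = g r) -> rtrig f -> rtrig g.
Proof. by move=> /funext ->. Qed.

Lemma rtrigD (f g : R -> R) : rtrig f -> rtrig g -> rtrig (fun r => f r + g r).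
Proof.
move=> hf hg; apply: trig_closure_ext (trig_closure_add hf hg) => r.
by rewrite rmorphD.
Qed.

Lemma rtrigM (f g : R -> R) : rtrig f -> rtrig g -> rtrig (fun r => f r * g r).
Proof.
move=> hf hg; apply: trig_closure_ext (trig_closure_mul hf hg) => r.
by rewrite rmorphM.
Qed.

Lemma rtrig_cst (c : R) : rtrig (fun=> c).
Proof. exact: trig_closure_cst. Qed.

Lemma rtrigB (f g : R -> R) : rtrig f -> rtrig g -> rtrig (fun r => f r - g r).
Proof.
move=> hf hg; apply: rtrig_ext (rtrigD hf (rtrigM (rtrig_cst (-1)) hg)) => r.
by rewrite mulN1r.
Qed.

Lemma rtrigX (f : R -> R) n : rtrig f -> rtrig (fun r => f r ^+ n).
Proof.
move=> hf; elim: n => [|n IH]; first exact: rtrig_cst.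
by apply: rtrig_ext (rtrigM hf IH) => r; rewrite exprS.
Qed.

Lemma rtrig_lim (u : nat -> R -> R) (f : R -> R) M : (forall n, rtrig (u n)) ->
  (forall n r, `|u n r| <= M) -> (forall r, u n r @[n --> \oo] --> f r) -> rtrig f.
Proof.
move=> hu uM uf; apply: (@trig_closure_lim (fun n r => (u n r)%:C%C) _ (M ^+ 2)) => //.
  move=> n r; rewrite /cnorm2 /= expr0n addr0 -real_normK ?num_real//.
  by rewrite ler_pXn2r ?nnegrE// (le_trans _ (uM n r)).
by move=> r; split=> /=; [exact: uf|exact: cvg_cst].
Qed.

Lemma rtrig_sin (x t : R) : rtrig (fun r => sin (x * (r - t))).
Proof.
(* frequencies of trigonometric polynomials are counted in units of 2 pi *)
pose y := x / (2 * pi).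
have xE : 2 * pi * y = x.
  by rewrite /y mulrC divfK// mulf_neq0// ?gt_eqF ?pi_gt0.
pose s : seq (C * R) := [:: (expi (- (x * t)) / (2%:R * 'i%C), y);
  (- expi (x * t) / (2%:R * 'i%C), - y)].
apply: trig_closure_ext (trig_closure_poly s) => r.
rewrite /trigpoly !big_cons big_nil /= addr0 mulrN xE.
transitivity ((expi (- (x * t) + x * r) - expi (x * t + - x * r)) / (2%:R * 'i%C)).
  by rewrite !expiD; move: (_^-1) => k; ring.
have i0 : (2%:R * 'i%C : C) != 0.
  by rewrite mulf_neq0 ?pnatr_eq0// eq_complex /= oner_eq0 andbF.
apply: (mulIf i0); rewrite divfK//.
rewrite (_ : - (x * t) + x * r = x * (r - t)); last by ring.
rewrite (_ : x * t + - x * r = - (x * (r - t))); last by ring.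
by rewrite /expi sinN cosN; apply: complexP => /=; ring.
Qed.

(** Bernoulli's inequality turns powers into a sharp cut-off at 1/2: with
    N = m 2^m one has N g^m = m (2 g)^m, which tends to 0 when g < 1/2 and is at
    least m when g >= 1/2. The extra factor m decides the boundary case g = 1/2. *)
Lemma pow_half_cvg (g : R) : 0 <= g <= 1 ->
  (1 - g ^+ m) ^+ (m * 2 ^ m) @[m --> \oo] --> (((g < 1 / 2)%R : bool)%:R : R).
Proof.
move=> /andP[g0 g1].
have gm m : 0 <= g ^+ m <= 1 by rewrite exprn_ge0//= exprn_ile1.
have low (x : R) N : 0 <= x <= 1 -> 1 - N%:R * x <= (1 - x) ^+ N.
  move=> /andP[x0 x1]; elim: N => [|N IH]; first by rewrite mul0r subr0 expr0.
  rewrite exprS -natr1.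
  have : (1 - x) * (1 - N%:R * x) <= (1 - x) * (1 - x) ^+ N.
    by rewrite ler_wpM2l// subr_ge0.
  have : 0 <= N%:R * x ^+ 2 by rewrite mulr_ge0 ?sqr_ge0.
  rewrite expr2; nra.
have binomial (y : R) N : 0 <= y -> 1 + N%:R * y <= (1 + y) ^+ N.
  move=> y0; elim: N => [|N IH]; first by rewrite mul0r addr0 expr0.
  rewrite exprS -natr1.
  have : (1 + y) * (1 + N%:R * y) <= (1 + y) * (1 + y) ^+ N.
    by rewrite ler_wpM2l// addr_ge0.
  have : 0 <= N%:R * y ^+ 2 by rewrite mulr_ge0 ?sqr_ge0.
  rewrite expr2; nra.
have up (x : R) N : 0 <= x <= 1 -> (1 - x) ^+ N * (1 + N%:R * x) <= 1.
  move=> /andP[x0 x1]; apply: (@le_trans _ _ ((1 - x) ^+ N * (1 + x) ^+ N)).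
    by rewrite ler_wpM2l ?exprn_ge0 ?subr_ge0// binomial.
  rewrite -exprMn exprn_ile1//; last by nra.
  by rewrite mulr_ge0 ?subr_ge0// addr_ge0.
have N0 m : 0 <= (1 - g ^+ m) ^+ (m * 2 ^ m).
  by rewrite exprn_ge0// subr_ge0; have /andP[] := gm m.
have Ng m : (m * 2 ^ m)%N%:R * g ^+ m = m%:R * (2 * g) ^+ m.
  by rewrite natrM natrX exprMn mulrA.
case: ltP => g2.
  have [->|gn0] := eqVneq g 0.
    apply: cvg_near_cst; near=> m.
    have m0 : (0 < m)%N by near: m; exact: nbhs_infty_gt.
    by rewrite expr0n gtn_eqF//= subr0 expr1n.
  have gp : 0 < g by rewrite lt_neqAle eq_sym gn0.
  (* 2 g = z^2 with 1 / z = 1 + d, so that m z^m <= 1 / d leaves a factor z^m *)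
  pose z := Num.sqrt (2 * g).
  have z0 : 0 < z by rewrite sqrtr_gt0 mulr_gt0.
  have z2 : z ^+ 2 = 2 * g by rewrite sqr_sqrtr ?mulr_ge0.
  have z1 : z < 1.
    rewrite -(@ltr_pXn2r _ 2)// ?nnegrE ?ltW// z2 expr1n; lra.
  pose d := z^-1 - 1.
  have d0 : 0 < d by rewrite subr_gt0 invf_gt1.
  have zd : z = (1 + d)^-1 by rewrite /d addrC subrK invrK.
  have mz m : m%:R * (2 * g) ^+ m <= d^-1 * z ^+ m.
    rewrite -z2 exprAC expr2 mulrA ler_wpM2r ?exprn_ge0 ?(ltW z0)//.
    rewrite [in z ^+ m]zd exprVn ler_pdivrMr ?exprn_gt0 ?(addr_gt0 ltr01 d0)//.
    apply: (@le_trans _ _ (d^-1 * (1 + m%:R * d))).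
      rewrite mulrDr mulr1 [X in _ + X]mulrC mulfK ?gt_eqF//.
      by rewrite lerDr invr_ge0 (ltW d0).
    by rewrite ler_wpM2l ?binomial ?invr_ge0 ?(ltW d0).
  apply: (squeeze_cvgr (f := (fun m => 1 - d^-1 * z ^+ m)) (h := (fun=> 1))).
  - apply: nearW => m; apply/andP; split; last first.
      by rewrite exprn_ile1// ?subr_ge0 ?gerBl; have /andP[] := gm m.
    apply: le_trans (low _ (m * 2 ^ m)%N (gm m)).
    by rewrite Ng lerB.
  - rewrite -[X in _ --> X]subr0; apply: cvgB; first exact: cvg_cst.
    rewrite -[X in _ --> X](mulr0 d^-1); apply: cvgM; first exact: cvg_cst.
    by apply: cvg_expr; rewrite gtr0_norm.
  - exact: cvg_cst.
apply: (squeeze_cvgr (f := (fun=> 0)) (h := harmonic)); last first.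
- exact: cvg_harmonic.
- exact: cvg_cst.
apply: nearW => m; rewrite N0 /=.
have h := up _ (m * 2 ^ m)%N (gm m).
rewrite /harmonic /= -[leRHS]mul1r ler_pdivlMr ?ltr0Sn//.
apply: le_trans h; rewrite ler_wpM2l// Ng -natr1 addrC lerD2l.
by rewrite ler_peMr// exprn_ege1//; lra.
Unshelve. all: by end_near. Qed.

Definition rtrig_set (E : set R) : Prop := rtrig (\1_E).

(** Rescale g affinely to [0, 1], so that the cut-off at 1/2 becomes a cut-off at 0. *)
Lemma rtrig_set_lt (g : R -> R) (c : R) : 0 < c -> rtrig g -> (forall r, `|g r| <= c) ->
  rtrig_set [set r | g r < 0].
Proof.
move=> c0 hg gc.
(* h < 1/2 exactly where g < 0 *)
pose h r := (1 + c^-1 * g r) / 2.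
have h01 r : 0 <= h r <= 1.
  have : `|c^-1 * g r| <= 1.
    by rewrite normrM gtr0_norm ?invr_gt0// ler_pdivrMl// mulr1.
  by rewrite ler_norml /h => /andP[]; lra.
have hh : rtrig h.
  apply: rtrigM; last exact: rtrig_cst.
  by apply: rtrigD; [exact: rtrig_cst|apply: rtrigM => //; exact: rtrig_cst].
apply: (@rtrig_lim (fun m r => (1 - h r ^+ m) ^+ (m * 2 ^ m)) _ 1).
- by move=> m; apply: rtrigX; apply: rtrigB; [exact: rtrig_cst|exact: rtrigX].
- move=> m r; have /andP[h0 h1] := h01 r.
  have x1 : h r ^+ m <= 1 by rewrite exprn_ile1.
  by rewrite ger0_norm ?exprn_ge0 ?subr_ge0// exprn_ile1 ?subr_ge0// gerBl exprn_ge0.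
- move=> r; have := pow_half_cvg (h01 r).
  rewrite indicE (_ : (h r < 1 / 2) = (r \in [set r | g r < 0]))//.
  rewrite /h ltr_pM2r ?invr_gt0// gtrDl pmulr_rlt0 ?invr_gt0//.
  by apply/idP/idP => [|]; rewrite inE.
Qed.

(** The set where sin ((r - t) / n) < 0 is periodic, but its part near t fills up
    the half-line below t as n grows. *)
Lemma rtrig_set_halfline (t : R) : rtrig_set [set r | r < t].
Proof.
have hs n : rtrig_set [set r : R | sin (n.+1%:R^-1 * (r - t)) < 0].
  apply: (@rtrig_set_lt _ 1) => //; first exact: rtrig_sin.
  by move=> r; rewrite ler_norml sin_geN1 sin_le1.
apply: (@rtrig_lim (fun n => \1_[set r : R | sin (n.+1%:R^-1 * (r - t)) < 0]) _ 1) => //.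
  by move=> n r; rewrite indicE; case: (_ \in _); rewrite ?normr1 ?normr0.
move=> r; apply: cvg_near_cst; near=> n.
have hn : `|r - t| < n.+1%:R.
  near: n; have [N _ hN] := nbhs_infty_ger (`|r - t|).
  by exists N => // m /= Nm; apply: le_lt_trans (hN m Nm) _; rewrite ltr_nat.
set x := n.+1%:R^-1 * (r - t).
have x1 : `|x| < pi.
  rewrite normrM gtr0_norm ?invr_gt0// ltr_pdivrMl//.
  apply: lt_trans hn _; rewrite ltr_pMr//.
  by apply: lt_le_trans (pi_ge2 R); rewrite ltr1n.
congr (_%:R); congr nat_of_bool; apply/idP/idP; rewrite !inE /= => h.
  rewrite ltNge; apply/negP => tr; move: h; apply/negP; rewrite -leNgt -/x.
  have x0 : 0 <= x by rewrite mulr_ge0 ?subr_ge0 ?invr_ge0.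
  apply: sin_ge0_pi; rewrite x0 /=.
  by rewrite ger0_norm// in x1; exact: ltW.
have x0 : x < 0 by rewrite /x pmulr_rlt0 ?invr_gt0// subr_lt0.
rewrite -/x -oppr_gt0 -sinN; apply: sin_gt0_pi; rewrite oppr_gt0 x0 /=.
by rewrite ltr0_norm in x1.
Unshelve. all: by end_near. Qed.

Lemma rtrig_setC (E : set R) : rtrig_set E -> rtrig_set (~` E).
Proof.
move=> hE; apply: rtrig_ext (rtrigB (rtrig_cst 1) hE) => r.
rewrite !indicE in_setC; case: (r \in E); rewrite ?subrr ?subr0//.
Qed.

Lemma rtrig_setI (E F : set R) : rtrig_set E -> rtrig_set F -> rtrig_set (E `&` F).
Proof.
move=> hE hF; apply: rtrig_ext (rtrigM hE hF) => r.
by rewrite !indicE in_setI -natrM mulnb.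
Qed.

Lemma rtrig_setU (E F : set R) : rtrig_set E -> rtrig_set F -> rtrig_set (E `|` F).
Proof.
by move=> hE hF; rewrite -[_ `|` _]setCK setCU; apply/rtrig_setC/rtrig_setI; exact: rtrig_setC.
Qed.

Lemma rtrig_set0 : rtrig_set set0.
Proof. by apply: rtrig_ext (rtrig_cst 0) => r; rewrite indicE in_set0. Qed.

Lemma rtrig_bigcup (E : nat -> set R) : (forall n, rtrig_set (E n)) ->
  rtrig_set (\bigcup_n E n).
Proof.
move=> hE; have hn n : rtrig_set (\big[setU/set0]_(i < n) E i).
  by apply: big_ind => //; [exact: rtrig_set0|exact: rtrig_setU].
apply: (@rtrig_lim (fun n => \1_(\big[setU/set0]_(i < n) E i)) _ 1) => //.
  by move=> n r; rewrite indicE; case: (_ \in _); rewrite ?normr1 ?normr0.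
move=> r; apply: cvg_near_cst.
have [[k _ kr]|nr] := pselect ((\bigcup_n E n) r).
  near=> n; rewrite !indicE !mem_set//; first by exists k.
  rewrite -bigcup_mkord; exists k => //=; near: n; exact: nbhs_infty_gt.
apply: nearW => n; rewrite !indicE !memNset// => h; apply: nr.
by move: h; rewrite -bigcup_mkord => -[i _ ir]; exists i.
Unshelve. all: by end_near. Qed.

Lemma rtrig_measurable (E : set (measurableTypeR R)) : measurable E -> rtrig_set E.
Proof.
suff h : <<s (@ocitv R)>> `<=` rtrig_set by apply: h.
apply: smallest_sub; first split.
- exact: rtrig_set0.
- by move=> F hF; rewrite setTD; exact: rtrig_setC.
- exact: rtrig_bigcup.
move=> _ [[x y] _ <-].
have hle t : rtrig_set [set r | r <= t].
  rewrite (_ : [set r | r <= t] = ~` (\bigcup_n ~` [set r : R | r < t + n.+1%:R^-1])).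
    by apply/rtrig_setC/rtrig_bigcup => n; apply/rtrig_setC/rtrig_set_halfline.
  apply/seteqP; split=> r /= rt.
    by move=> [n _ /=]; apply; rewrite (le_lt_trans rt)// ltrDl invr_gt0.
  rewrite leNgt; apply/negP => tr; apply: rt.
  have rt0 : 0 < r - t by rewrite subr_gt0.
  have [N _ hN] := near_infty_natSinv_lt (PosNum rt0).
  exists N => //=; apply/negP; rewrite -leNgt -lerBrDl ltW//.
  exact: hN N (leqnn N).
rewrite (_ : `]x, y]%classic = ~` [set r | r <= x] `&` [set r | r <= y]).
  by apply: rtrig_setI; [apply: rtrig_setC|]; exact: hle.
apply/seteqP; split=> r /=; rewrite in_itv /=.
  by move=> /andP[xr ->]; split=> //; apply/negP; rewrite -ltNge.
by move=> [/negP]; rewrite -ltNge => -> ->.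
Qed.

(** The sum counts the integers between 1 and x, that is, it is the integer part
    of x. *)
Lemma count_floor N (x : R) : 0 <= x <= N%:R ->
  \sum_(j < N) ((j.+1%:R <= x)%R : bool)%:R <= x <=
  \sum_(j < N) ((j.+1%:R <= x)%R : bool)%:R + 1.
Proof.
have big M (y : R) : M%:R <= y -> \sum_(j < M) ((j.+1%:R <= y)%R : bool)%:R = M%:R :> R.
  move=> My; rewrite (eq_bigr (fun=> 1)) ?sumr_const ?card_ord// => j _.
  by rewrite (le_trans _ My)// ler_nat.
elim: N x => [|N IH] x /andP[x0 xN].
  by rewrite big_ord0 x0 add0r (le_trans xN).
rewrite big_ord_recr /=; have [xN'|Nx] := leP N.+1%:R x.
  have xE : x = N.+1%:R by apply/le_anti; rewrite xN xN'.
  by rewrite xE big ?ler_nat// !natr1 lexx /= ler_nat.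
rewrite addr0; have [xN'|/ltW Nx'] := leP x N%:R; first by apply: IH; rewrite x0.
by rewrite big// Nx' natr1 ltW.
Qed.

(** Rescaled to values in [0, 1], f is within 1 / n of the mean of the indicator
    functions of the n sets where f >= j / n. *)
Lemma rtrig_bounded (f : R -> R) (M : R) : measurable_fun [set: measurableTypeR R] f ->
  (forall r, `|f r| <= M) -> rtrig f.
Proof.
move=> mf fM; have [/eqP M0|Mn0] := boolP (M == 0).
  apply: rtrig_ext (rtrig_cst 0) => r; apply/esym/eqP.
  by rewrite -normr_le0 -M0.
have M0 : 0 < M by rewrite lt_neqAle eq_sym Mn0 (le_trans _ (fM 0)).
pose h r := (1 + M^-1 * f r) / 2.
have h01 r : 0 <= h r <= 1.
  have : `|M^-1 * f r| <= 1.
    by rewrite normrM gtr0_norm ?invr_gt0// ler_pdivrMl// mulr1.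
  by rewrite ler_norml /h => /andP[]; lra.
suff hh : rtrig h.
  apply: rtrig_ext (rtrigM (rtrig_cst M) (rtrigB (rtrigM (rtrig_cst 2) hh) (rtrig_cst 1))) => r.
  by rewrite /h; field; rewrite gt_eqF.
have mh : measurable_fun [set: measurableTypeR R] h.
  by apply: measurable_funM => //; apply: measurable_funD => //; exact: measurable_funM.
pose E n (j : nat) := [set r | j.+1%:R <= n.+1%:R * h r].
have hE n j : rtrig_set (E n j).
  apply: rtrig_measurable; rewrite -[E n j]setTI.
  rewrite (_ : E n j = (fun r => n.+1%:R * h r) @^-1` `[j.+1%:R, +oo[%classic).
    by apply: measurable_funM.
  by apply/seteqP; split=> r; rewrite /E /= in_itv /= andbT.
have b n r : n.+1%:R^-1 * \sum_(j < n.+1) \1_(E n j) r <= h r <=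
    n.+1%:R^-1 * \sum_(j < n.+1) \1_(E n j) r + n.+1%:R^-1.
  have := @count_floor n.+1 (n.+1%:R * h r).
  have /andP[h0 h1] := h01 r.
  rewrite mulr_ge0//= ler_piMr// => /(_ isT).
  rewrite (eq_bigr (fun j : 'I_n.+1 => \1_(E n j) r)); last first.
    move=> j _; rewrite indicE; congr (nat_of_bool _)%:R.
    by apply/idP/idP; rewrite inE.
  move=> /andP[s1 s2]; rewrite ler_pdivrMl// s1 /=.
  by rewrite -[X in _ + X]mulr1 -mulrDr ler_pdivlMl.
apply: (@rtrig_lim (fun n r => n.+1%:R^-1 * \sum_(j < n.+1) \1_(E n j) r) _ 1).
- move=> n; apply: rtrigM; first exact: rtrig_cst.
  have := @trig_closure_sum _ (index_enum 'I_n.+1) _ (fun j : 'I_n.+1 => hE n j).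
  by apply: trig_closure_ext => r; rewrite rmorph_sum.
- move=> n r; rewrite ger0_norm; last first.
    by rewrite mulr_ge0// sumr_ge0// => j _; rewrite indicE.
  have /andP[b1 _] := b n r; have /andP[_ h1] := h01 r.
  exact: le_trans b1 h1.
move=> r; apply: (squeeze_cvgr (f := (fun n => h r - n.+1%:R^-1)) (h := (fun=> h r))).
- by apply: nearW => n; have /andP[-> b2] := b n r; rewrite lerBlDr b2.
- rewrite -[X in _ --> X]subr0; apply: cvgB; first exact: cvg_cst.
  exact: cvg_harmonic.
- exact: cvg_cst.
Qed.

(** With the inductive definition of the class, this says that a property of functions
    that holds for trigonometric polynomials and passes to bounded pointwise limits
    holds for all bounded Borel functions. *)
Theorem bounded_borel_trig_closure f (M : R) :
  measurable_fun [set: measurableTypeR R] (Re \o f) ->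
  measurable_fun [set: measurableTypeR R] (Im \o f) ->
  (forall r, cabs (f r) <= M) -> trig_closure f.
Proof.
move=> mR mI fM.
have hR : rtrig (fun r => Re (f r)).
  by apply: (rtrig_bounded mR) => r; exact: le_trans (Re_le_cabs _) (fM r).
have hI : rtrig (fun r => Im (f r)).
  by apply: (rtrig_bounded mI) => r; exact: le_trans (Im_le_cabs _) (fM r).
apply: trig_closure_ext
  (trig_closure_add hR (trig_closure_mul (trig_closure_cst 'i%C) hI)) => r.
by rewrite -complexE.
Qed.

End MonotoneClass.

(** * Dominated convergence with respect to dr / r *)

Section HaarConvergence.
Variable R : realType.
Local Notation C := R[i].
Local Notation mu := (@lebesgue_measure R).
Implicit Types (f g : R -> R) (h k : R -> C).

Lemma haarE f : haarI f ->
  (\int[mu]_(r in @posR R) (f r / r)%:E = (haar f)%:E)%E.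
Proof.
move=> If; rewrite /haar /Rintegral fineK//.
by apply: (@integrable_fin_num _ _ _ mu _ (@measurable_posR R)) If.
Qed.

Lemma haar_dominated (u : nat -> R -> R) f g :
  (forall n, measurable_fun (@posR R) (u n)) ->
  (forall r, 0 < r -> u n r @[n --> \oo] --> f r) ->
  (forall n r, 0 < r -> `|u n r| <= g r) -> haarI g ->
  haar (u n) @[n --> \oo] --> haar f.
Proof.
move=> mu_ uf ug Ig.
have mf : measurable_fun (@posR R) f.
  by apply: measurable_fun_cvg mu_ _ => r; rewrite posRE; exact: uf.
have If : haarI f.
  apply: haarI_dom mf _ Ig => r r0.
  have h : `|u n r| @[n --> \oo] --> `|f r| by apply: cvg_norm; exact: uf.
  by apply: ler_cvg_to h (cvg_cst (g r)) _; apply: nearW => n; exact: ug.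
apply: fine_cvg; rewrite -haarE//.
apply: (@dominated_cvg _ _ _ mu _ (@measurable_posR R) _ _
  (fun r => (g r / r)%:E)) => //.
- by move=> n; exact: measurable_divr.
- move=> r; rewrite posRE => r0; apply/fine_cvgP; split; first exact: nearW.
  by apply: cvgM; [exact: uf|exact: cvg_cst].
- move=> n r; rewrite posRE => r0; rewrite abse_EFin lee_fin normrM.
  by rewrite (gtr0_norm (_ : 0 < r^-1)) ?invr_gt0// ler_pM2r ?invr_gt0// ug.
Qed.

Lemma chaar_dominated (u : nat -> R -> C) h g :
  (forall n, cmeas (u n)) -> (forall r, 0 < r -> cvgC (u ^~ r) (h r)) ->
  (forall n r, 0 < r -> cabs (u n r) <= g r) -> haarI g ->
  cvgC (fun n => chaar (u n)) (chaar h).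
Proof.
move=> mu_ uh ug Ig; split; apply: haar_dominated Ig.
- by move=> n; have [] := mu_ n.
- by move=> r /uh[].
- by move=> n r r0; apply: le_trans (Re_le_cabs _) (ug n r r0).
- by move=> n; have [] := mu_ n.
- by move=> r /uh[].
- by move=> n r r0; apply: le_trans (Im_le_cabs _) (ug n r r0).
Qed.

Lemma cmeas_lim (u : nat -> R -> C) h : (forall n, cmeas (u n)) ->
  (forall r, 0 < r -> cvgC (u ^~ r) (h r)) -> cmeas h.
Proof.
move=> mu_ uh; split.
  apply: (@measurable_fun_cvg _ _ _ _ (fun n r => Re (u n r))).
    by move=> n; have [] := mu_ n.
  by move=> r; rewrite posRE => /uh[].
apply: (@measurable_fun_cvg _ _ _ _ (fun n r => Im (u n r))).
  by move=> n; have [] := mu_ n.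
by move=> r; rewrite posRE => /uh[].
Qed.

Lemma cmeas_cst (c : C) : cmeas (fun _ : R => c).
Proof. by split; exact: measurable_cst. Qed.

Lemma cmeas_sum I (s : seq I) (F : I -> R -> C) : (forall i, cmeas (F i)) ->
  cmeas (fun r => \sum_(i <- s) F i r).
Proof.
move=> h; elim: s => [|i s IH].
  rewrite (_ : (fun _ => _) = fun=> 0); first exact: cmeas_cst.
  by apply/funext => r; rewrite big_nil.
rewrite (_ : (fun _ => _) = F i + (fun r => \sum_(j <- s) F j r)); first exact: cmeasD.
by apply/funext => r; rewrite big_cons.
Qed.

Lemma cmeas_dil (a : R) h : 0 < a -> cmeas h -> cmeas (fun r => h (a * r)).
Proof.
move=> a0 [m1 m2]; split; first exact: (measurable_fun_dil a0 m1).
exact: (measurable_fun_dil a0 m2).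
Qed.

Lemma trig_closure_cmeas h : trig_closure h -> cmeas h.
Proof.
elim=> [s|u f M _ IH _ uf].
  by apply: cmeas_sum => p; apply: cmeasM; [exact: cmeas_cst|exact: cmeas_expi].
by apply: cmeas_lim IH _ => r _; exact: uf.
Qed.

Definition L2fnorm h : R := Num.sqrt (haar (fun r => cnorm2 (h r))).

Lemma L2fnorm_ge0 h : 0 <= L2fnorm h. Proof. exact: sqrtr_ge0. Qed.

Lemma L2normE (h : L2fun R) : L2norm (\pi_(L2 R) h)%qT = L2fnorm h.
Proof. by rewrite /L2norm L2innerE finner_self. Qed.

Lemma finner_CS h k : sq_integrable h -> sq_integrable k ->
  cabs (L2finner h k) <= L2fnorm h * L2fnorm k.
Proof.
move=> sh sk; have := ip_CS (\pi_(L2 R) (mkL2 sh))%qT (\pi_(L2 R) (mkL2 sk))%qT.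
by rewrite L2innerE !L2normE.
Qed.

End HaarConvergence.

(** * Sums of dilations between two multipliers *)

Section MultiplierDilation.
Variable R : realType.
Local Notation C := R[i].
Variable ts : seq R.
Hypothesis ts0 : all (fun a => 0 < a) ts.
Implicit Types (q phi f g : R -> C).

(** The operator M_q (sum_(a in ts) D_a) M_phi, with M a multiplication operator and
    D_a the dilation f -> f (a r). When q and phi are trigonometric polynomials it is a
    combination of operators U g. *)
Definition mult_dil q phi f : R -> C :=
  fun r => q r * \sum_(a <- ts) phi (a * r) * f (a * r).

Lemma cnorm2_sum I (s : seq I) (F : I -> C) :
  cnorm2 (\sum_(i <- s) F i) <= 2 ^+ size s * \sum_(i <- s) cnorm2 (F i).
Proof.
elim: s => [|i s IH]; first by rewrite !big_nil mulr0 /cnorm2 /= expr0n addr0.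
rewrite !big_cons (le_trans (cnorm2D _ _))//= exprS.
have h1 : 1 <= 2 ^+ size s :> R by rewrite exprn_ege1// ler1n.
have := cnorm2_ge0 (F i).
have : 0 <= \sum_(j <- s) cnorm2 (F j) by apply: sumr_ge0 => j _; exact: cnorm2_ge0.
move: IH h1; move: (cnorm2 _) (\sum_(j <- s) cnorm2 _) (cnorm2 (F i)) (2 ^+ _).
by move=> x y z t; nra.
Qed.

Lemma mult_dil_bound q phi f (M : R) r : (forall r, cnorm2 (q r) <= M) ->
  (forall r, cnorm2 (phi r) <= M) ->
  cnorm2 (mult_dil q phi f r) <=
  M * (2 ^+ size ts * (M * \sum_(a <- ts) cnorm2 (f (a * r)))).
Proof.
move=> qM pM; rewrite cnorm2M ler_pM ?cnorm2_ge0//.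
apply: le_trans (cnorm2_sum _ _) _; rewrite ler_pM2l ?exprn_gt0//.
rewrite mulr_sumr; apply: ler_sum => a _; rewrite cnorm2M ler_wpM2r//.
exact: cnorm2_ge0.
Qed.

Lemma haar_dil_sum f : sq_integrable f ->
  haarI (fun r => \sum_(a <- ts) cnorm2 (f (a * r))) /\
  haar (fun r => \sum_(a <- ts) cnorm2 (f (a * r))) =
    (size ts)%:R * haar (fun r => cnorm2 (f r)).
Proof.
move=> sf; have I := sq_integrable_haarI sf.
have m : measurable_fun (@posR R) (fun r => cnorm2 (f r)).
  by case: sf => -[a b] _; apply: measurable_funD; exact: measurable_funX.
move: ts0; elim: ts => [_|a s IH /= /andP[a0 /IH{IH}[IH1 IH2]]].
  rewrite mul0r; split.
    by apply: eq_haarI (@haarI0 R) => r _; rewrite big_nil.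
  rewrite (@eq_haar _ _ (fun=> 0 * 0)); last by move=> r _; rewrite big_nil mul0r.
  by rewrite haarZ ?mul0r//; exact: haarI0.
have Ia := haarI_dil a0 I; split.
  by apply: eq_haarI (haarID Ia IH1) => r _; rewrite big_cons.
rewrite (@eq_haar _ _ (fun r => cnorm2 (f (a * r)) + \sum_(a <- s) cnorm2 (f (a * r)))).
  rewrite haarD// IH2 (haar_dil (f := fun r => cnorm2 (f r)) a0 m) /=.
  by rewrite -natr1 mulrDl mul1r addrC.
by move=> r _; rewrite big_cons.
Qed.

Lemma mult_dil_cmeas q phi f : cmeas q -> cmeas phi -> cmeas f -> cmeas (mult_dil q phi f).
Proof.
move=> mq mp mf; apply: cmeasM => //.
move: ts0; elim: ts => [_|a s IH /= /andP[a0 /IH{}IH]].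
  rewrite (_ : (fun _ => _) = fun=> 0); first exact: cmeas_cst.
  by apply/funext => r; rewrite big_nil.
rewrite (_ : (fun _ => _) =
  (fun r => phi (a * r) * f (a * r)) + (fun r => \sum_(a <- s) phi (a * r) * f (a * r))).
  apply: cmeasD => //; apply: (cmeas_dil (h := fun r => phi r * f r)) => //.
  exact: cmeasM.
by apply/funext => r; rewrite big_cons.
Qed.

(** Only the dependence on the number of points matters: this is uniform in the
    position of the dilations, which are chosen later. *)
Definition mult_dil_cst (M : R) : R := M * (2 ^+ size ts * (M * (size ts)%:R)).

Lemma mult_dil_sq_integrable q phi f (M : R) : cmeas q -> cmeas phi ->
  (forall r, cnorm2 (q r) <= M) -> (forall r, cnorm2 (phi r) <= M) ->
  sq_integrable f -> sq_integrable (mult_dil q phi f) /\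
  L2fnorm (mult_dil q phi f) <= Num.sqrt (mult_dil_cst M) * L2fnorm f.
Proof.
move=> mq mp qM pM sf; have [If Ef] := haar_dil_sum sf.
have M0 : 0 <= M by apply: le_trans (cnorm2_ge0 (q 0)) (qM 0).
have mT : cmeas (mult_dil q phi f) by apply: mult_dil_cmeas => //; have [] := sf.
have I := haarIZ M (haarIZ (2 ^+ size ts) (haarIZ M If)).
have bT r := mult_dil_bound f r qM pM.
have IT : haarI (fun r => cnorm2 (mult_dil q phi f r)).
  apply: haarI_dom I.
    by case: mT => a b; apply: measurable_funD; exact: measurable_funX.
  by move=> r _; rewrite ger0_norm ?cnorm2_ge0// bT.
split; first exact: sq_integrableP.
rewrite /L2fnorm -sqrtrM; last by rewrite /mult_dil_cst !mulr_ge0// exprn_ge0.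
rewrite ler_wsqrtr//; apply: le_trans (le_haar IT I _) _; first by move=> r _; exact: bT.
rewrite haarZ; last exact/haarIZ/haarIZ.
rewrite haarZ; last exact/haarIZ.
by rewrite haarZ// Ef /mult_dil_cst !mulrA.
Qed.

Lemma mult_dil_finner_bound q phi f g (M : R) : cmeas q -> cmeas phi ->
  (forall r, cnorm2 (q r) <= M) -> (forall r, cnorm2 (phi r) <= M) ->
  sq_integrable f -> sq_integrable g ->
  cabs (L2finner (mult_dil q phi f) (mult_dil q phi g)) <=
  mult_dil_cst M * (L2fnorm f * L2fnorm g).
Proof.
move=> mq mp qM pM sf sg.
have [s1 n1] := mult_dil_sq_integrable mq mp qM pM sf.
have [s2 n2] := mult_dil_sq_integrable mq mp qM pM sg.
have M0 : 0 <= M by apply: le_trans (cnorm2_ge0 (q 0)) (qM 0).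
have K0 : 0 <= mult_dil_cst M by rewrite /mult_dil_cst !mulr_ge0// exprn_ge0.
apply: le_trans (finner_CS s1 s2) _.
apply: le_trans (ler_pM (L2fnorm_ge0 _) (L2fnorm_ge0 _) n1 n2) _.
by rewrite mulrACA -expr2 sqr_sqrtr.
Qed.

(** Dominated convergence in r, both for the multiplier on the left and for the one on
    the right. *)
Lemma mult_dil_lim (qn pn : nat -> R -> C) q phi f g (M : R) :
  (forall n, cmeas (qn n)) -> (forall n, cmeas (pn n)) ->
  (forall n r, cnorm2 (qn n r) <= M) -> (forall n r, cnorm2 (pn n r) <= M) ->
  (forall r, cvgC (qn ^~ r) (q r)) -> (forall r, cvgC (pn ^~ r) (phi r)) ->
  sq_integrable f -> sq_integrable g ->
  cvgC (fun n => L2finner (mult_dil (qn n) (pn n) f) (mult_dil (qn n) (pn n) g))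
       (L2finner (mult_dil q phi f) (mult_dil q phi g)).
Proof.
move=> mq mp qM pM hq hp sf sg.
have T h r : cvgC (fun n => mult_dil (qn n) (pn n) h r) (mult_dil q phi h r).
  apply: cvgCM (hq r) _.
  apply: (@cvgC_seq _ _ ts (fun a n => pn n (a * r) * h (a * r))
    (fun a => phi (a * r) * h (a * r))) => a.
  by apply: cvgCM (hp _) (cvgC_cst _).
(* the dominating function of mult_dil_bound *)
pose G h r := M * (2 ^+ size ts * (M * \sum_(a <- ts) cnorm2 (h (a * r)))).
have IG h : sq_integrable h -> haarI (G h).
  by move=> /haar_dil_sum[Ih _]; do 3! apply: haarIZ.
apply: (@chaar_dominated _
  (fun n r => mult_dil (qn n) (pn n) f r * (mult_dil (qn n) (pn n) g r)^*%C) _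
  (fun r => G f r + G g r)).
- have mT n h : sq_integrable h -> cmeas (mult_dil (qn n) (pn n) h).
    by move=> [mh _]; exact: mult_dil_cmeas.
  by move=> n; apply: cmeasM; [|apply: cmeasJ]; exact: mT.
- by move=> r _; apply: cvgCM (T f r) _; exact: cvgCJ (T g r).
- move=> n r _; rewrite cabsM cabsJ.
  apply: (@le_trans _ _ (cnorm2 (mult_dil (qn n) (pn n) f r) +
    cnorm2 (mult_dil (qn n) (pn n) g r))).
    rewrite -!cabs_sqr; move: (cabs_ge0 (mult_dil (qn n) (pn n) f r)).
    move: (cabs_ge0 (mult_dil (qn n) (pn n) g r)).
    by move: (cabs _) (cabs _) => x y; nra.
  by apply: lerD; exact: mult_dil_bound.
- by apply: haarID; exact: IG.
Qed.

End MultiplierDilation.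

(** * Positivity for bounded Borel multipliers *)

Section Extension.
Variables (R : realType) (a c : nat -> L2 R).
Local Notation C := R[i].
Local Open Scope quotient_scope.
Hypothesis S : nsummable a c.
Hypothesis Upos : forall s t,
  csum_to (fun k => L2inner (Ucomb s (a k)) (Ucomb s (c k))) t -> 0 <= t.

(** A representative of [Ucomb s] without exceptional sets. *)
Lemma Ucomb_repr (s : seq (C * Aff R)) (f : L2fun R) :
  exists2 F : L2fun R, Ucomb s (\pi_(L2 R) f) = \pi_(L2 R) F &
    forall r, F r = \sum_(p <- s) p.1 * Ufun p.2 f r.
Proof.
elim: s => [|p s [F hF EF]].
  exists 0; last by move=> r; rewrite big_nil.
  rewrite /Ucomb big_nil; apply: (addIr (\pi_(L2 R) (0 : L2fun R))).
  by rewrite -pi_L2D addr0 add0r.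
exists (p.1 *: mkL2 (Ufun_sq_integrable p.2 (L2funP f)) + F).
  rewrite /Ucomb big_cons -/(Ucomb s _) hF UE pi_L2D pi_L2scale //.
by move=> r; rewrite big_cons -EF.
Qed.

(** A total function of b, so that it can be used in comprehensions over lists of
    reals; its value for b <= 0 is junk. *)
Definition aff_of (x b : R) : Aff R := insubd (aff_one R) (x, b).

Lemma aff_ofE x b : 0 < b -> val (aff_of x b) = (x, b).
Proof. by move=> b0; rewrite /aff_of insubdK. Qed.

Definition mult_dil_comb (ts : seq R) (s1 s2 : seq (C * R)) : seq (C * Aff R) :=
  [seq (p.1 * z.2.1, aff_of (p.2 + z.1 * z.2.2) z.1)
    | p <- s1, z <- [seq (b, q) | b <- ts, q <- s2]].

Lemma mult_dil_combE ts s1 s2 (f : R -> C) r : all (fun b => 0 < b) ts ->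
  mult_dil ts (trigpoly s1) (trigpoly s2) f r =
  \sum_(p <- mult_dil_comb ts s1 s2) p.1 * Ufun p.2 f r.
Proof.
move=> ts0; rewrite /mult_dil_comb big_allpairs_dep /mult_dil [trigpoly s1 r]/trigpoly mulr_suml.
apply: eq_bigr => p _; rewrite big_allpairs_dep mulr_sumr.
rewrite big_seq [RHS]big_seq; apply: eq_bigr => b /(allP ts0) b0.
rewrite /trigpoly mulr_suml mulr_sumr; apply: eq_bigr => q _ /=.
rewrite /Ufun aff_ofE//=.
rewrite (_ : 2 * trigo.pi * (p.2 + b * q.2) * r =
  2 * trigo.pi * p.2 * r + 2 * trigo.pi * q.2 * (b * r)); last by ring.
by rewrite expiD; ring.
Qed.

(** Positivity of the trace of T A T^* for T = mult_dil ts q phi. *)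
Definition mult_dil_pos ts (q phi : R -> C) : Prop := forall t,
  csum_to (fun k => L2finner (mult_dil ts q phi (repr (a k))) (mult_dil ts q phi (repr (c k)))) t ->
  0 <= t.

Lemma L2norm_repr (u : L2 R) : L2fnorm (repr u) = L2norm u.
Proof. by rewrite -L2normE reprK. Qed.

Lemma mult_dil_pos_trig ts s1 s2 : all (fun b => 0 < b) ts ->
  mult_dil_pos ts (trigpoly s1) (trigpoly s2).
Proof.
move=> ts0 t ht; apply: (Upos (s := mult_dil_comb ts s1 s2)).
rewrite (_ : (fun _ => _) = (fun k => L2finner
  (mult_dil ts (trigpoly s1) (trigpoly s2) (repr (a k)))
  (mult_dil ts (trigpoly s1) (trigpoly s2) (repr (c k)))))//.
apply/funext => k.
have [F hF EF] := Ucomb_repr (mult_dil_comb ts s1 s2) (repr (a k)).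
have [G hG EG] := Ucomb_repr (mult_dil_comb ts s1 s2) (repr (c k)).
rewrite -[in LHS](reprK (a k)) -[in LHS](reprK (c k)) hF hG L2innerE !L2finnerE.
by apply: eq_chaar => r _; rewrite EF EG -!mult_dil_combE.
Qed.

Lemma mult_dil_pos_lim ts (qn pn : nat -> R -> C) q phi (M : R) :
  all (fun b => 0 < b) ts ->
  (forall n, cmeas (qn n)) -> (forall n, cmeas (pn n)) ->
  (forall n r, cnorm2 (qn n r) <= M) -> (forall n r, cnorm2 (pn n r) <= M) ->
  (forall r, cvgC (qn ^~ r) (q r)) -> (forall r, cvgC (pn ^~ r) (phi r)) ->
  (forall n, mult_dil_pos ts (qn n) (pn n)) -> mult_dil_pos ts q phi.
Proof.
move=> ts0 mq mp qM pM hq hp H t ht.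
have B n k : cabs (L2finner (mult_dil ts (qn n) (pn n) (repr (a k)))
      (mult_dil ts (qn n) (pn n) (repr (c k))))
    <= mult_dil_cst ts M * (L2norm (a k) * L2norm (c k)).
  rewrite -!L2norm_repr; apply: mult_dil_finner_bound => //; exact: L2funP.
have ex n : exists t, csum_to (fun k => L2finner (mult_dil ts (qn n) (pn n) (repr (a k)))
    (mult_dil ts (qn n) (pn n) (repr (c k)))) t.
  by apply: csum_dominated (B n) _; exact: nsummableZ.
have [s hs] := choice ex.
apply: (@cvgC_ge0 _ s); first by move=> n; exact: H (hs n).
have hk := @csum_tannery R _ _ _ s t B (nsummableZ (x := _) S) _ hs ht.
apply: hk => k.
by apply: mult_dil_lim => //; exact: L2funP.
Qed.

(** Two inductions on the closure of trigonometric polynomials, one for each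
    multiplier; in the limit the traces converge by Tannery's theorem. *)
Lemma mult_dil_pos_bounded ts q phi : all (fun b => 0 < b) ts ->
  trig_closure q -> trig_closure phi -> mult_dil_pos ts q phi.
Proof.
move=> ts0 + hp; elim: hp q => {phi} [s2|pn phi M hpn IH pM hp] q hq.
  elim: hq => {q} [s1|qn q M hqn IH qM hq]; first exact: mult_dil_pos_trig.
  have [M' hM'] := trig_closure_bounded (trig_closure_poly s2).
  apply: (@mult_dil_pos_lim ts qn (fun=> trigpoly s2) _ _ (Num.max M M')) => //.
  - by move=> n; exact: trig_closure_cmeas.
  - by move=> n; apply: trig_closure_cmeas; exact: trig_closure_poly.
  - by move=> n r; rewrite le_max qM.
  - by move=> n r; rewrite le_max hM' orbT.
  - by move=> r; exact: cvgC_cst.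
have [M' hM'] := trig_closure_bounded hq.
apply: (@mult_dil_pos_lim ts (fun=> q) pn _ _ (Num.max M M')) => //.
- by move=> n; exact: trig_closure_cmeas.
- by move=> n; exact: trig_closure_cmeas.
- by move=> n r; rewrite le_max hM' orbT.
- by move=> n r; rewrite le_max pM.
- by move=> r; exact: cvgC_cst.
- by move=> n; exact: IH.
Qed.

End Extension.

(** * Fubini for correlations with dilations *)

Section HaarFubini.
Variable R : realType.
Local Notation C := R[i].
Local Notation mu := (@lebesgue_measure R).

Lemma integral_posR (f g : R -> \bar R) : (forall r, 0 < r -> f r = g r) ->
  (forall r, r <= 0 -> f r = 0%E) ->
  (\int[mu]_r f r = \int[mu]_(r in @posR R) g r)%E.
Proof.
move=> fg f0; rewrite [RHS]integral_mkcond; apply: eq_integral => r _.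
rewrite patchE; case: ifPn; rewrite ?inE ?notin_setE posRE => h.
  by rewrite fg.
by rewrite f0// leNgt; exact/negP.
Qed.

Lemma haarI_norm (f : R -> R) : haarI f -> haarI (fun r => `|f r|).
Proof.
move=> If; have mf := measurable_divK If.
have mn : measurable_fun (@posR R) (fun r => `|f r|) by exact: measurableT_comp.
have /integrableP[_ h] := If; apply: (haarI_ge0 mn) => //.
apply: le_lt_trans h; rewrite le_eqVlt; apply/orP; left; apply/eqP.
apply: eq_integral => r; rewrite inE posRE => r0.
by rewrite abse_EFin normrM (gtr0_norm (_ : 0 < r^-1)) ?invr_gt0.
Qed.

(** The integral of a -> int x (a r) z r against da / a is the product of the
    integrals of x and z,
    because da / a is invariant under a -> a r. The last hypothesis excludes the
    exceptional values of a at which the inner integral is not defined. *)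
Lemma haar_fubini (x z : R -> R) : haarI x -> haarI z ->
  (forall a, 0 < a -> haarI (fun r => x (a * r) * z r)) ->
  haarI (fun a => haar (fun r => x (a * r) * z r)) /\
  haar (fun a => haar (fun r => x (a * r) * z r)) = haar x * haar z.
Proof.
move=> Ix Iz Ixz.
(* everything is extended by 0, to have a product measure on the whole plane *)
pose x' := x \_ (@posR R); pose z' := z \_ (@posR R).
pose v := (fun r : R => r^-1) \_ (@posR R).
have restr (h : R -> R) : measurable_fun (@posR R) h ->
    measurable_fun [set: measurableTypeR R] (h \_ (@posR R)).
  move=> mh.
  have mP := @measurable_restrictT _ _ (measurableTypeR R) _ _ h (@measurable_posR R).
  exact: (mP.1 mh).
have mx : measurable_fun [set: measurableTypeR R] x' := restr _ (measurable_divK Ix).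
have mz : measurable_fun [set: measurableTypeR R] z' := restr _ (measurable_divK Iz).
have mv : measurable_fun [set: measurableTypeR R] v := restr _ (@measurable_inv_pos R).
pose f (p : measurableTypeR R * measurableTypeR R) : R :=
  x' (p.1 * p.2) * z' p.2 * v p.1 * v p.2.
have mf : measurable_fun setT f.
  have m1 : measurable_fun setT (fun p : measurableTypeR R * measurableTypeR R => p.1 * p.2).
    by apply: measurable_funM; [exact: measurable_fst|exact: measurable_snd].
  apply: measurable_funM; last exact: measurableT_comp mv measurable_snd.
  apply: measurable_funM; last exact: measurableT_comp mv measurable_fst.
  apply: measurable_funM; last exact: measurableT_comp mz measurable_snd.
  exact: measurableT_comp mx m1.
have resE (h : R -> R) r : 0 < r -> (h \_ (@posR R)) r = h r.
  by move=> r0; rewrite patchE mem_set// posRE.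
have res0 (h : R -> R) r : r <= 0 -> (h \_ (@posR R)) r = 0.
  by move=> r0; rewrite patchE memNset// posRE; apply/negP; rewrite -leNgt.
have fE a r : 0 < a -> 0 < r -> f (a, r) = x (a * r) * z r / a / r.
  by move=> a0 r0; rewrite /f /x' /z' /v !resE// mulr_gt0.
have f0l a r : a <= 0 -> f (a, r) = 0.
  by move=> a0; rewrite /f /v /= (res0 _ a)// mulr0 mul0r.
have f0r a r : r <= 0 -> f (a, r) = 0.
  by move=> a0; rewrite /f /v /= (res0 _ r)// mulr0.
have abs_inner r : 0 < r ->
    (\int[mu]_a `|(f (a, r))%:E| = (haar (fun s => `|x s|) * `|z r| / r)%:E)%E.
  move=> r0; have h := haarI_dil r0 (haarI_norm Ix).
  have hm := measurable_divK (haarI_norm Ix).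
  rewrite (@integral_posR _ (fun a => ((`|z r| / r * `|x (r * a)|) / a)%:E)).
  - rewrite (haarE (f := fun a => `|z r| / r * `|x (r * a)|)); last exact: haarIZ.
    rewrite haarZ// (haar_dil (f := fun s => `|x s|) r0 hm).
    by rewrite [in LHS]mulrC mulrA.
  - move=> a a0; rewrite fE// abse_EFin !normrM.
    rewrite (gtr0_norm (_ : 0 < r^-1)) ?invr_gt0// (gtr0_norm (_ : 0 < a^-1)) ?invr_gt0//.
    by congr (_%:E); rewrite (mulrC r a); ring.
  - by move=> a a0; rewrite f0l// abse_EFin normr0.
have I : (mu \x mu)%E.-integrable setT (EFin \o f).
  apply/integrable21ltyP; first exact/measurable_EFinP.
  rewrite (@integral_posR _ (fun r => (haar (fun s => `|x s|) * `|z r| / r)%:E)).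
  - rewrite (haarE (f := fun r => haar (fun s => `|x s|) * `|z r|)) ?ltry//.
    by apply: haarIZ; exact: haarI_norm.
  - by move=> r r0; exact: abs_inner.
  - move=> r r0; apply: integral0_eq => a _.
    by rewrite /= f0r// normr0.
have inner_a a : 0 < a ->
    (\int[mu]_r (f (a, r))%:E = (haar (fun r => x (a * r) * z r) / a)%:E)%E.
  move=> a0; rewrite (@integral_posR _ (fun r => ((a^-1 * (x (a * r) * z r)) / r)%:E)).
  - rewrite (haarE (f := fun r => a^-1 * (x (a * r) * z r))); last by apply: haarIZ; exact: Ixz.
    by rewrite haarZ; [rewrite mulrC|exact: Ixz].
  - by move=> r r0; rewrite fE//; congr (_%:E); ring.
  - by move=> r r0; rewrite f0r.
have inner_r r : 0 < r -> (\int[mu]_a (f (a, r))%:E = (haar x * z r / r)%:E)%E.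
  move=> r0; have h := haarI_dil r0 Ix; have hm := measurable_divK Ix.
  rewrite (@integral_posR _ (fun a => ((z r / r * x (r * a)) / a)%:E)).
  - rewrite (haarE (f := fun a => z r / r * x (r * a))); last exact: haarIZ.
    rewrite haarZ// (haar_dil r0 hm).
    by rewrite [in LHS]mulrC mulrA.
  - move=> a a0; rewrite fE//.
    by congr (_%:E); rewrite (mulrC r a); ring.
  - by move=> a a0; rewrite f0l.
have IJ : haarI (fun a => haar (fun r => x (a * r) * z r)).
  have := @integrableS _ _ _ mu _ _ _ measurableT (@measurable_posR R)
    (@subsetT _ _) (integrable_fubini_F I).
  apply: eq_integrable; first exact: measurable_posR.
  by move=> a; rewrite inE posRE => a0; rewrite /fubini_F inner_a.
split=> //; apply: EFin_inj; rewrite -haarE//.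
have := Fubini I => /=.
rewrite (@integral_posR _ (fun a => (haar (fun r => x (a * r) * z r) / a)%:E)); last 2 first.
- by move=> a a0; exact: inner_a.
- by move=> a a0; apply: integral0_eq => r _; rewrite f0l.
move=> ->; rewrite (@integral_posR _ (fun r => (haar x * z r / r)%:E)).
- by rewrite (haarE (f := fun r => haar x * z r)) ?haarZ//; exact: haarIZ.
- by move=> r r0; exact: inner_r.
- by move=> r r0; apply: integral0_eq => a _; rewrite f0r.
Qed.

Lemma chaar_fubini (x z : R -> C) : chaarI x -> chaarI z ->
  sq_integrable x -> sq_integrable z ->
  chaarI (fun a => chaar (fun r => x (a * r) * z r)) /\
  chaar (fun a => chaar (fun r => x (a * r) * z r)) = chaar x * chaar z.
Proof.
move=> [xR xI] [zR zI] sx sz.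
have Ixz (p q : C -> R) : (forall c, `|p c| <= cabs c) -> (forall c, `|q c| <= cabs c) ->
    measurable_fun (@posR R) (p \o x) -> measurable_fun (@posR R) (q \o z) ->
    forall a, 0 < a -> haarI (fun r => p (x (a * r)) * q (z r)).
  move=> hp hq mp mq a a0.
  apply: haarI_dom (haarID (haarI_dil a0 (sq_integrable_haarI sx)) (sq_integrable_haarI sz)).
    by apply: measurable_funM => //; exact: (measurable_fun_dil a0 mp).
  move=> r _; rewrite normrM.
  apply: (@le_trans _ _ (cabs (x (a * r)) * cabs (z r))); first by rewrite ler_pM.
  rewrite -!cabs_sqr; move: (cabs_ge0 (x (a * r))) (cabs_ge0 (z r)).
  by move: (cabs _) (cabs _) => s t; nra.
have hRe := @Re_le_cabs R; have hIm := @Im_le_cabs R.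
have [[mxR mxI] _] := sx; have [[mzR mzI] _] := sz.
have iRR := Ixz _ _ hRe hRe mxR mzR; have iII := Ixz _ _ hIm hIm mxI mzI.
have iRI := Ixz _ _ hRe hIm mxR mzI; have iIR := Ixz _ _ hIm hRe mxI mzR.
have [RR RRe] := haar_fubini xR zR iRR; have [II IIe] := haar_fubini xI zI iII.
have [RI RIe] := haar_fubini xR zI iRI; have [IR IRe] := haar_fubini xI zR iIR.
have e1 a : 0 < a -> haar (fun r => Re (x (a * r) * z r)) =
    haar (fun r => Re (x (a * r)) * Re (z r)) +
    (-1) * haar (fun r => Im (x (a * r)) * Im (z r)).
  move=> a0; rewrite -haarZ; last exact: iII.
  rewrite -haarD; [|exact: iRR|apply: haarIZ; exact: iII].
  by apply: eq_haar => r _; rewrite cReM mulN1r.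
have e2 a : 0 < a -> haar (fun r => Im (x (a * r) * z r)) =
    haar (fun r => Re (x (a * r)) * Im (z r)) +
    haar (fun r => Im (x (a * r)) * Re (z r)).
  move=> a0; rewrite -haarD; [|exact: iRI|exact: iIR].
  by apply: eq_haar => r _; rewrite cImM.
split.
  split => /=.
    by apply: eq_haarI (haarID RR (haarIZ (-1) II)) => a a0; rewrite e1.
  by apply: eq_haarI (haarID RI IR) => a a0; rewrite e2.
apply: complexP; rewrite ?cReM ?cImM /=.
  rewrite (eq_haar e1) haarD//; last exact: haarIZ.
  by rewrite haarZ// RRe IIe mulN1r.
by rewrite (eq_haar e2) haarD// RIe IRe.
Qed.

End HaarFubini.

(** * Rank-one operators as averages over dilations *)

Section AveragingArgument.
Variables (R : realType).
Local Notation C := R[i].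
Local Notation mu := (@lebesgue_measure R).
Local Open Scope quotient_scope.

Lemma sq_integrable_dil (a : R) (f : R -> C) : 0 < a -> sq_integrable f ->
  sq_integrable (fun r => f (a * r)).
Proof.
move=> a0 sf; apply: sq_integrableP; first by apply: cmeas_dil => //; have [] := sf.
exact: (haarI_dil a0 (sq_integrable_haarI sf)).
Qed.

Section Window.
Variables (x y : R).
Hypotheses (x0 : 0 < x) (xy : x < y).

Let meas_indic : measurable_fun (@posR R) (\1_`[x, y] : R -> R).
Proof. by apply: measurable_indic; exact: measurable_itv. Qed.

Let integral_window (c : R) : 0 <= c ->
  (\int[mu]_(r in @posR R) (c * \1_`[x, y] r)%:E = (c * (y - x))%:E)%E.
Proof.
move=> c0; under eq_integral do rewrite EFinM.
rewrite ge0_integralZl_EFin//; last 2 first.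
- exact: measurable_posR.
- exact/measurable_EFinP.
rewrite (@integral_indic _ _ _ mu); last 2 first.
- exact: measurable_posR.
- exact: measurable_itv.
rewrite setIidl; last first.
  move=> r /=; rewrite in_itv /= posRE => /andP[xr _]; exact: lt_le_trans xr.
by rewrite [X in (_ * X)%E](lebesgue_measure_itv `[x, y]) /= lte_fin xy -EFinB -EFinM.
Qed.

Lemma haarI_window : haarI (\1_`[x, y] : R -> R).
Proof.
apply: haarI_ge0 => //.
apply: (@le_lt_trans _ _ (\int[mu]_(r in @posR R) (x^-1 * \1_`[x, y] r)%:E)%E).
  apply: ge0_le_integral => //.
  - exact: measurable_posR.
  - by move=> r; rewrite posRE => r0; rewrite lee_fin divr_ge0 ?indicE// ltW.
  - exact: measurable_divr.
  - by apply/measurable_EFinP; exact: measurable_funM.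
  - move=> r; rewrite posRE => r0; rewrite lee_fin [leRHS]mulrC indicE.
    case: (boolP (_ \in _)) => [|_]; last by rewrite !mul0r.
    by rewrite inE /= in_itv /= => /andP[xr _]; rewrite !mul1r lef_pV2.
by rewrite integral_window ?ltry// invr_ge0 ltW.
Qed.

Lemma haar_window_gt0 : 0 < haar (\1_`[x, y] : R -> R).
Proof.
have y0 : 0 < y := lt_trans x0 xy.
apply: (@lt_le_trans _ _ (y^-1 * (y - x))); first by rewrite mulr_gt0 ?invr_gt0 ?subr_gt0.
rewrite -lee_fin -haarE; last exact: haarI_window.
rewrite -integral_window; last by rewrite invr_ge0 ltW.
apply: ge0_le_integral => //.
- exact: measurable_posR.
- by move=> r; rewrite posRE => r0; rewrite lee_fin mulr_ge0 ?indicE// invr_ge0 ltW.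
- by apply/measurable_EFinP; exact: measurable_funM.
- exact: measurable_divr.
- move=> r; rewrite posRE => r0; rewrite lee_fin mulrC indicE.
  case: (boolP (_ \in _)) => [|_]; last by rewrite !mul0r.
  by rewrite inE /= in_itv /= => /andP[_ ry]; rewrite !mul1r lef_pV2.
Qed.

End Window.

Section Kernel.
Variables (a c : nat -> L2 R) (psi : L2fun R) (w M : R).
Hypothesis w1 : 1 < w.
Hypothesis psiM : forall r, cnorm2 (psi r) <= M.
Hypothesis psi0 : forall r, ~~ (w^-1 <= r <= w) -> psi r = 0.

Let w0 : 0 < w. Proof. exact: lt_trans w1. Qed.

(** For r in [1, 2], the points b with b r in [w^-1, w] all lie in [window_lo, w]. *)
Definition window_lo : R := w^-1 / 2.
Let lo0 : 0 < window_lo. Proof. by rewrite divr_gt0 ?invr_gt0. Qed.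
Let low : window_lo < w.
Proof.
apply: (@lt_trans _ _ w^-1); first by rewrite ltr_pdivrMr// ltr_pMr ?invr_gt0// ltr1n.
by apply: lt_trans w1; rewrite invf_lt1.
Qed.

Definition window : pred R := fun b => window_lo <= b <= w.
Definition window_mass : R := haar (\1_`[window_lo, w] : R -> R).
Let window_mass_gt0 : 0 < window_mass. Proof. exact: haar_window_gt0. Qed.

(** The function chi of the rank-one operators chi (x) psi. *)
Definition unit_window : R -> C := fun r => (\1_`[1, 2] r)%:C%C.

Let M0 : 0 <= M. Proof. by apply: le_trans (cnorm2_ge0 (psi 0)) (psiM 0). Qed.

Lemma unit_window_bound r : cnorm2 (unit_window r) <= 1.
Proof.
by rewrite /cnorm2 /= expr0n addr0 indicE; case: (_ \in _); rewrite ?expr1n ?expr0n.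
Qed.

Lemma unit_window_cmeas : cmeas unit_window.
Proof.
split; last exact: measurable_cst.
by apply: measurable_indic; exact: measurable_itv.
Qed.

Lemma unit_window_chaarI : chaarI unit_window.
Proof. by split; [apply: haarI_window; rewrite ?ltr1n|exact: haarI0]. Qed.

Lemma unit_window_sq : sq_integrable unit_window.
Proof.
apply: sq_integrableP; first exact: unit_window_cmeas.
apply: eq_haarI (unit_window_chaarI.1) => r _.
rewrite /cnorm2 /= expr0n addr0 indicE.
by case: (_ \in _); rewrite ?expr1n ?expr0n.
Qed.

Lemma unit_windowJ r : (unit_window r)^*%C = unit_window r.
Proof. by apply: complexP => //=; rewrite oppr0. Qed.

Lemma unit_window_idem r : unit_window r * unit_window r = unit_window r.
Proof.
by apply: complexP; rewrite /unit_window /= indicE; case: (_ \in _) => /=; ring.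
Qed.

Definition unit_mass : R := haar (\1_`[1, 2] : R -> R).

Lemma chaar_unit_window : chaar unit_window = unit_mass%:C%C.
Proof.
apply: complexP => //=; rewrite (@eq_haar _ _ (fun=> 0 * 0)) ?haarZ ?mul0r//.
exact: haarI0.
Qed.

(** The adjoint multiplier conj psi applied to f; its integral is <f, psi>, see
    [chaar_cut]. *)
Definition cut (f : R -> C) : R -> C := fun r => (psi r)^*%C * f r.

Lemma cut_sq f : sq_integrable f -> sq_integrable (cut f).
Proof.
move=> sf; apply: (sq_integrable_dom (c := M)) (sf) _.
  apply: cmeasM; last by have [] := sf.
  by apply: cmeasJ; have [] := L2funP psi.
by move=> r _; rewrite cnorm2M cnorm2J ler_wpM2r ?cnorm2_ge0.
Qed.

Lemma cut_chaarI f : sq_integrable f -> chaarI (cut f).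
Proof.
move=> sf; apply: eq_chaarI (sq_integrable_chaarI sf (L2funP psi)) => r _.
by rewrite mulrC.
Qed.

Lemma chaar_cut f : chaar (cut f) = L2finner f psi.
Proof. by apply: eq_chaar => r _; rewrite mulrC. Qed.

Lemma cut_window f b r : unit_window r != 0 -> ~~ window b -> cut f (b * r) = 0.
Proof.
move=> r0 bw; rewrite /cut psi0 ?rmorph0 ?cJ0 ?mul0r//; apply: contra bw => /andP[h1 h2].
have : r \in `[1, 2].
  by move: r0; rewrite /unit_window indicE mem_setE; case: (_ \in _); rewrite ?eqxx.
rewrite in_itv /= => /andP[r1 r2].
have rp : 0 < r by exact: lt_le_trans r1.
have bp : 0 < b by rewrite -(pmulr_lgt0 _ rp) (lt_le_trans _ h1)// invr_gt0.
apply/andP; split.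
  rewrite /window_lo ler_pdivrMr//; apply: le_trans h1 _.
  by rewrite ler_wpM2l// ltW.
by apply: le_trans h2; rewrite ler_peMr// ltW.
Qed.

Lemma window_gt0 b : window b -> 0 < b.
Proof. by move=> /andP[h _]; exact: lt_le_trans h. Qed.

Lemma ucut_sq f b : 0 < b -> sq_integrable f ->
  sq_integrable (fun r => unit_window r * cut f (b * r)).
Proof.
move=> b0 sf; have sd := sq_integrable_dil b0 (cut_sq sf).
apply: (sq_integrable_dom (c := 1)) (sd) _.
  by apply: cmeasM unit_window_cmeas _; have [] := sd.
by move=> r _; rewrite cnorm2M ler_wpM2r ?cnorm2_ge0// unit_window_bound.
Qed.

(** For T_s = M_chi D_s M_(conj psi), the integrand of <T_s f, T_b g>; chi
    occurs once because chi^2 = chi. *)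
Definition corr_fun (f g : R -> C) (s b r : R) : C :=
  cut f (s * r) * (unit_window r * (cut g (b * r))^*%C).

Definition corr (f g : R -> C) (s b : R) : C := chaar (corr_fun f g s b).

Lemma corr_fun_out f g s b r : ~~ window s || ~~ window b -> corr_fun f g s b r = 0.
Proof.
move=> sb; rewrite /corr_fun.
have [->|r0] := eqVneq (unit_window r) 0; first by rewrite mul0r mulr0.
by case/orP: sb => h; rewrite (cut_window _ r0 h) ?mul0r// cJ0 !mulr0.
Qed.

Lemma corr_out f g s b : ~~ window s || ~~ window b -> corr f g s b = 0.
Proof.
by move=> sb; rewrite /corr -[RHS](@chaar0 R); apply: eq_chaar => r _; exact: corr_fun_out.
Qed.

Lemma corr_funI f g s b : sq_integrable f -> sq_integrable g ->
  chaarI (corr_fun f g s b).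
Proof.
move=> sf sg; have [/andP[ws wb]|] := boolP (window s && window b); last first.
  rewrite negb_and => sb; apply: eq_chaarI (@chaarI0 R) => r _.
  by rewrite corr_fun_out.
apply: eq_chaarI (sq_integrable_chaarI
  (sq_integrable_dil (window_gt0 ws) (cut_sq sf)) (ucut_sq (window_gt0 wb) sg)) => r _.
by rewrite /corr_fun cJM unit_windowJ.
Qed.

Lemma corr_swap f g s b : sq_integrable f -> sq_integrable g ->
  corr f g s b = (corr g f b s)^*%C.
Proof.
move=> sf sg; rewrite /corr -chaarJ; last exact: corr_funI.
apply: eq_chaar => r _; rewrite /corr_fun [in RHS]cJM [X in _ = _ * X]cJM.
by rewrite conjcK unit_windowJ; ring.
Qed.

Definition unit_corr (g : R -> C) (b : R) : C :=
  chaar (fun r => unit_window r * (cut g (b * r))^*%C).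

(** Averaging over one dilation parameter replaces D_s by integration against psi. *)
Lemma corr_avg f g b : 0 < b -> sq_integrable f -> sq_integrable g ->
  chaarI (fun s => corr f g s b) /\
  chaar (fun s => corr f g s b) = L2finner f psi * unit_corr g b.
Proof.
move=> b0 sf sg.
have e r : (unit_window r * cut g (b * r))^*%C = unit_window r * (cut g (b * r))^*%C.
  by rewrite cJM unit_windowJ.
have sz : sq_integrable (fun r => unit_window r * (cut g (b * r))^*%C).
  have su := ucut_sq b0 sg; apply: (sq_integrable_dom (c := 1)) (su) _.
    apply: cmeasM unit_window_cmeas _; apply: cmeasJ.
    by have [] := sq_integrable_dil b0 (cut_sq sg).
  by move=> r _; rewrite -e cnorm2J mul1r.
have Iz : chaarI (fun r => unit_window r * (cut g (b * r))^*%C).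
  exact: sq_integrable_chaarI unit_window_sq (sq_integrable_dil b0 (cut_sq sg)).
by have := chaar_fubini (cut_chaarI sf) Iz (cut_sq sf) sz; rewrite chaar_cut.
Qed.

Lemma unit_corr_avg g : sq_integrable g ->
  chaarI (unit_corr g) /\
  chaar (unit_corr g) = (L2finner g psi)^*%C * unit_mass%:C%C.
Proof.
move=> sg.
have [I E] := chaar_fubini (cut_chaarI sg) unit_window_chaarI (cut_sq sg) unit_window_sq.
have e b : 0 < b -> unit_corr g b = (chaar (fun r => cut g (b * r) * unit_window r))^*%C.
  move=> b0; rewrite -chaarJ.
    by apply: eq_chaar => r _; rewrite [in RHS]cJM unit_windowJ mulrC.
  apply: eq_chaarI (sq_integrable_chaarI (sq_integrable_dil b0 (cut_sq sg)) unit_window_sq) => r _.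
  by rewrite unit_windowJ.
split.
  by apply: eq_chaarI (chaarIJ I) => b b0; rewrite e.
rewrite (eq_chaar e) chaarJ// E chaar_cut chaar_unit_window cJM; congr (_ * _).
by apply: complexP => //=; rewrite oppr0.
Qed.

Lemma unit_corr_out g b : ~~ window b -> unit_corr g b = 0.
Proof.
move=> h; rewrite -[RHS](@chaar0 R); apply: eq_chaar => r _.
have [->|r0] := eqVneq (unit_window r) 0; first by rewrite mul0r.
by rewrite (cut_window _ r0 h) cJ0 mulr0.
Qed.

Lemma mult_dil_corr ts f g : sq_integrable f -> sq_integrable g ->
  L2finner (mult_dil ts unit_window (fun r => (psi r)^*%C) f)
           (mult_dil ts unit_window (fun r => (psi r)^*%C) g) =
  \sum_(s <- ts) \sum_(b <- ts) corr f g s b.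
Proof.
move=> sf sg; have I s b := corr_funI s b sf sg.
rewrite L2finnerE (@eq_chaar _ _ (fun r => \sum_(s <- ts) \sum_(b <- ts) corr_fun f g s b r)).
  rewrite chaar_sum; last by move=> s; exact: chaarI_sum.
  by apply: eq_bigr => s _; rewrite chaar_sum.
move=> r _; rewrite /mult_dil cJM unit_windowJ mulrACA unit_window_idem mulr_suml mulr_sumr.
apply: eq_bigr => s _.
rewrite (_ : (\sum_(b <- ts) _)^*%C = \sum_(b <- ts) (cut g (b * r))^*%C); last first.
  by apply: (big_morph (fun z : C => z^*%C)); [exact: cJD|exact: cJ0].
rewrite !mulr_sumr; apply: eq_bigr => b _.
by rewrite /corr_fun /cut; ring.
Qed.

Section Averaging.
Variables (zeta : C) (K : nat).

Let al k := repr (a k).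
Let ga k := repr (c k).

(** The kernel (s, b) -> sum_(k < K) <T_s a k, T_b c k>, rotated by zeta: its real
    part for zeta = 1, i and -i decides whether the form is real and nonnegative. *)
Definition trunc_kernel (s b : R) : R :=
  Re (zeta * \sum_(k < K) corr (al k) (ga k) s b).

Let ksym (s b : R) : C := zeta * (\sum_(k < K) corr (al k) (ga k) s b
  + \sum_(k < K) corr (al k) (ga k) b s).

Let trunc_kernelE s b : trunc_kernel s b + trunc_kernel b s = Re (ksym s b).
Proof. by rewrite /trunc_kernel /ksym mulrDr cReD. Qed.

Let mean (b : R) : C := zeta * (\sum_(k < K) (L2finner (al k) psi * unit_corr (ga k) b
   + (L2finner (ga k) psi * unit_corr (al k) b)^*%C)).

Let ksym_avg b : window b -> chaarI (ksym^~ b) /\ chaar (ksym^~ b) = mean b.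
Proof.
move=> wb; have b0 := window_gt0 wb.
have h k := corr_avg b0 (L2funP (al k)) (L2funP (ga k)).
have h' k := corr_avg b0 (L2funP (ga k)) (L2funP (al k)).
have e k s : corr (al k) (ga k) b s = (corr (ga k) (al k) s b)^*%C.
  by apply: corr_swap; exact: L2funP.
have I1 : chaarI (fun s => \sum_(k < K) corr (al k) (ga k) s b).
  by apply: chaarI_sum => k; exact: (h k).1.
have I2k k : chaarI (fun s => corr (al k) (ga k) b s).
  by apply: eq_chaarI (chaarIJ (h' k).1) => s _; rewrite -e.
have I2 : chaarI (fun s => \sum_(k < K) corr (al k) (ga k) b s) by exact: chaarI_sum.
have I12 := chaarID I1 I2; split; first exact: chaarIZ.
rewrite chaarZ// chaarD// /mean !chaar_sum//; last by move=> k; exact: (h k).1.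
congr (_ * _); rewrite [RHS]big_split.
congr (_ + _); apply: eq_bigr => k _; first by rewrite (h k).2.
by rewrite -(h' k).2 -chaarJ; [apply: eq_chaar => s _; rewrite -e|exact: (h' k).1].
Qed.

Let mean_avg : chaarI mean /\
  chaar mean = 2%:R * unit_mass%:C%C *
    (zeta * \sum_(k < K) L2finner (al k) psi * (L2finner (ga k) psi)^*%C).
Proof.
have h k := unit_corr_avg (L2funP (ga k)); have h' k := unit_corr_avg (L2funP (al k)).
have Ik k : chaarI (fun b => L2finner (al k) psi * unit_corr (ga k) b
   + (L2finner (ga k) psi * unit_corr (al k) b)^*%C).
  apply: chaarID; first by apply: chaarIZ; exact: (h k).1.
  by apply: chaarIJ; apply: chaarIZ; exact: (h' k).1.
have I : chaarI (fun b => \sum_(k < K) (L2finner (al k) psi * unit_corr (ga k) b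
   + (L2finner (ga k) psi * unit_corr (al k) b)^*%C)) by exact: chaarI_sum.
split; first exact: chaarIZ.
rewrite /mean chaarZ// chaar_sum// [RHS]mulrCA; congr (_ * _); rewrite [RHS]mulr_sumr.
apply: eq_bigr => k _.
have i1 : chaarI (fun b => L2finner (al k) psi * unit_corr (ga k) b).
  by apply: chaarIZ; exact: (h k).1.
have i2 : chaarI (fun b => L2finner (ga k) psi * unit_corr (al k) b).
  by apply: chaarIZ; exact: (h' k).1.
rewrite chaarD//; last exact: chaarIJ.
rewrite chaarJ// !chaarZ; [|exact: (h' k).1|exact: (h k).1].
rewrite (h k).2 (h' k).2 !cJM conjcK.
rewrite (_ : (unit_mass%:C)^*%C = unit_mass%:C%C); last by apply: complexP => //=; rewrite oppr0.
by ring.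
Qed.

Let mean_out b : ~~ window b -> mean b = 0.
Proof.
move=> wb; rewrite /mean big1 ?mulr0// => k _.
by rewrite !unit_corr_out// !mulr0 cJ0 addr0.
Qed.

(* functions on (0, oo) supported in the window, with their mean value *)
Let inF (f : R -> R) : Prop := haarI f /\ forall b, 0 < b -> ~~ window b -> f b = 0.
Let avg (f : R -> R) : R := haar f / window_mass.

(** The double mean of the kernel over the window is, up to a positive factor, the
    truncation of zeta <A psi, psi>. Sampling n points thus compares this number, with
    a weight of order n^2, with the double sum over the points and a diagonal of
    order n. *)
Lemma greedy_window n : exists ts : seq R, [/\ size ts = n, all window ts &
  \sum_(s <- ts) \sum_(b <- ts) trunc_kernel s b <=
  'C(n, 2)%:R * (2 * unit_mass / window_mass ^+ 2 *
    Re (zeta * \sum_(k < K) L2finner (al k) psi * (L2finner (ga k) psi)^*%C))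
  + n%:R + \sum_(s <- ts) trunc_kernel s s].
Proof.
have FD f g : inF f -> inF g -> inF (f \+ g) /\ avg (f \+ g) = avg f + avg g.
  move=> [f1 f2] [g1 g2]; split; first split; first exact: haarID.
    by move=> b b0 wb /=; rewrite f2// g2// addr0.
  by rewrite /avg (haarD f1 g1) mulrDl.
have FZ (x : R) f : inF f -> inF (x \*o f) /\ avg (x \*o f) = x * avg f.
  move=> [f1 f2]; split; first split; first exact: haarIZ.
    by move=> b b0 wb /=; rewrite f2// mulr0.
  by rewrite /avg (haarZ x f1) mulrA.
have Fpt f : inF f -> exists2 b, window b & f b <= avg f + 1.
  move=> [f1 f2]; apply: contrapT => H.
  have hb b : window b -> avg f + 1 < f b.
    by move=> wb; rewrite ltNge; apply/negP => fb; apply: H; exists b.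
  have IW := haarI_window lo0 low.
  have : haar (fun r => (avg f + 1) * \1_`[window_lo, w] r) <= haar f.
    apply: le_haar (haarIZ _ IW) f1 _ => r r0; rewrite indicE.
    have -> : (r \in `[window_lo, w]%classic) = window r.
      by apply/idP/idP; rewrite inE /= in_itv.
    by case: (boolP (window r)) => [/hb/ltW|/(f2 r r0) ->]; rewrite ?mulr1 ?mulr0.
  rewrite haarZ// -/window_mass mulrDl mul1r /avg divfK ?gt_eqF//.
  by rewrite leNgt ltrDl window_mass_gt0.
have Fk b : window b -> inF (fun s => trunc_kernel s b + trunc_kernel b s).
  move=> wb; split.
    by apply: eq_haarI ((ksym_avg wb).1.1) => s _; rewrite trunc_kernelE.
  move=> s s0 ws; rewrite trunc_kernelE /ksym !big1 ?addr0 ?mulr0// => k _; apply: corr_out;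
    by rewrite ws ?orbT.
have avgE b : 0 < b ->
    avg (fun s => trunc_kernel s b + trunc_kernel b s) = window_mass^-1 * Re (mean b).
  move=> b0; rewrite /avg mulrC; congr (_ * _).
  rewrite (@eq_haar _ _ (fun s => Re (ksym s b))); last first.
    by move=> s _; rewrite trunc_kernelE.
  have [wb|wb] := boolP (window b).
    by have [_ <-] := ksym_avg wb.
  rewrite (@eq_haar _ _ (fun=> 0 * 0)); last first.
    move=> s _; rewrite /ksym !big1 ?addr0 ?mulr0// => k _; apply: corr_out; rewrite wb ?orbT//.
  rewrite haarZ ?mul0r; last exact: haarI0.
  by rewrite mean_out.
have Fmean : inF (fun b => window_mass^-1 * Re (mean b)).
  split; first by apply: haarIZ; exact: mean_avg.1.1.
  by move=> b b0 wb; rewrite mean_out// mulr0.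
have Favg : inF (fun b => avg (fun s => trunc_kernel s b + trunc_kernel b s)).
  split; first by apply: eq_haarI Fmean.1 => b b0; rewrite avgE.
  by move=> b b0 wb; rewrite avgE// (Fmean.2 b b0 wb).
have mE : avg (fun b => avg (fun s => trunc_kernel s b + trunc_kernel b s)) =
    2 * unit_mass / window_mass ^+ 2 *
    Re (zeta * \sum_(k < K) L2finner (al k) psi * (L2finner (ga k) psi)^*%C).
  rewrite [LHS]/avg (eq_haar avgE) haarZ; last exact: mean_avg.1.1.
  have -> : haar (fun b => Re (mean b)) = Re (chaar mean) by [].
  have reE (x : R) (Z : C) : Re (2%:R * x%:C%C * Z) = 2 * x * Re Z.
    rewrite (_ : 2%:R * x%:C%C = (2%:R * x)%:C%C); last by rewrite rmorphM rmorph_nat.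
    by case: Z => z1 z2 /=; ring.
  by rewrite mean_avg.2 reE; field; rewrite gt_eqF.
have F0 : inF (fun=> 0) by split=> //; exact: haarI0.
have avg0 : avg (fun=> 0) = 0.
  rewrite /avg (@eq_haar _ _ (fun=> 0 * 0)); last by move=> r _; rewrite mul0r.
  by rewrite haarZ ?mul0r//; exact: haarI0.
have [ts [st Dt ht]] := greedy FD FZ Fpt Fk Favg mE n F0.
exists ts; split=> //; rewrite pairsumE; move: ht.
by rewrite big1// avg0 mulr0 !addr0 lerD2r.
Qed.

End Averaging.

End Kernel.

End AveragingArgument.

(** * Positive type implies positivity of A *)

Section Conclusion.
Variable R : realType.
Local Notation C := R[i].
Local Notation mu := (@lebesgue_measure R).
Local Open Scope quotient_scope.

(** Divide by n^2 and let n grow. *)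
Lemma quadratic_ge0 (y E : R) : (forall n, 0 <= 'C(n, 2)%:R * y + n%:R * E) -> 0 <= y.
Proof.
move=> h; rewrite leNgt; apply/negP => y0.
have hn n : n%:R * - y <= 2 * E.
  have := h n.+1; have := bin_ffact n.+1 2; rewrite ffactnS ffactn1 /= => e.
  have {}e : 'C(n.+1, 2)%:R * 2 = n.+1%:R * n%:R :> R by rewrite -!natrM e.
  have -> : 'C(n.+1, 2)%:R = n.+1%:R * (n%:R / 2) :> R.
    by apply: (mulIf (_ : 2 != 0)) => //; rewrite e mulrA divfK.
  rewrite -mulrA -mulrDr pmulr_rge0// => {}h; lra.
have Ny : 0 < - y by rewrite oppr_gt0.
have := hn (Num.truncn (2 * E / - y)).+1; apply/negP; rewrite -ltNge.
by rewrite -ltr_pdivrMr// truncnS_gt.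
Qed.

Section CompactSupport.
Variables (a c : nat -> L2 R) (psi : L2fun R) (w M : R).
Hypothesis S : nsummable a c.
Hypothesis Upos : forall s t,
  csum_to (fun k => L2inner (Ucomb s (a k)) (Ucomb s (c k))) t -> 0 <= t.
Hypothesis w1 : 1 < w.
Hypothesis psiM : forall r, cnorm2 (psi r) <= M.
Hypothesis psi0 : forall r, ~~ (w^-1 <= r <= w) -> psi r = 0.
Hypothesis mR : measurable_fun [set: measurableTypeR R] (fun r => Re (psi r)).
Hypothesis mI : measurable_fun [set: measurableTypeR R] (fun r => Im (psi r)).

Let phi : R -> C := fun r => (psi r)^*%C.
Let M' : R := Num.max 1 M.

Let uM r : cnorm2 (unit_window r : C) <= M'.
Proof. by rewrite le_max unit_window_bound. Qed.

Let pM r : cnorm2 (phi r) <= M'.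
Proof. by rewrite cnorm2J le_max psiM orbT. Qed.

Let phi_closure : trig_closure phi.
Proof.
apply: (@bounded_borel_trig_closure _ _ (Num.sqrt M)).
- by rewrite (_ : _ \o _ = fun r => Re (psi r))//; apply/funext => r /=; rewrite cReJ.
- rewrite (_ : _ \o _ = \- (fun r => Im (psi r))); first exact: measurable_funN.
  by apply/funext => r /=; rewrite cImJ.
- by move=> r; rewrite /cabs ler_wsqrtr// cnorm2J psiM.
Qed.

Let unit_closure : trig_closure (@unit_window R).
Proof.
apply: (@bounded_borel_trig_closure _ _ 1).
- by apply: measurable_indic; exact: measurable_itv.
- exact: measurable_cst.
- by move=> r; rewrite -[leRHS]sqrtr1 /cabs ler_wsqrtr// unit_window_bound.
Qed.

Let N k := L2norm (a k) * L2norm (c k).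
Let mm := limn (series N).

Let N_cvg : series N @ \oo --> mm. Proof. exact: S. Qed.

Let N_ge0 k : 0 <= N k. Proof. by rewrite mulr_ge0 ?L2norm_ge0. Qed.

Let N_le K : \sum_(k < K) N k <= mm.
Proof.
have nd : nondecreasing_seq (series N).
  by apply: nondecreasing_series => n _ _; exact: N_ge0.
by have := nondecreasing_cvgn_le nd S K; rewrite {1}/series /= big_mkord.
Qed.

Let cst n : R := M' * (2 ^+ n * (M' * n%:R)).

Let mult_dil_le ts k : all (fun b => 0 < b) ts ->
  cabs (L2finner (mult_dil ts (@unit_window R) phi (repr (a k)))
                 (mult_dil ts (@unit_window R) phi (repr (c k)))) <= cst (size ts) * N k.
Proof.
move=> ts0; rewrite /N -!L2norm_repr; apply: mult_dil_finner_bound => //; try exact: L2funP.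
  exact: unit_window_cmeas.
by apply: cmeasJ; have [] := L2funP psi.
Qed.

(** For the points of [greedy_window], the double sum of the kernel is the truncation at
    K of zeta times the trace of T A T^*, T = sum_s T_s, which has a nonnegative real
    part. The truncation error depends on n but not on the points, so it disappears as
    K grows with n fixed; afterwards n grows. *)
Lemma compact_support_ge0 (zeta t : C) : 0 <= Re zeta ->
  csum_to (fun k => L2inner (\pi_(L2 R) psi) (c k) * L2inner (a k) (\pi_(L2 R) psi)) t ->
  0 <= Re (zeta * t).
Proof.
move=> z0 ht.
pose V K := \sum_(k < K) L2finner (repr (a k)) psi * (L2finner (repr (c k)) psi)^*%C.
have VE K : V K = \sum_(k < K) L2inner (\pi_(L2 R) psi) (c k) * L2inner (a k) (\pi_(L2 R) psi).
  apply: eq_bigr => k _.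
  by rewrite (ipC (c k)) -[in RHS](reprK (a k)) -[in RHS](reprK (c k)) !L2innerE mulrC.
have hV : cvgC V t by move/funext: VE => ->.
(* the factor that relates the double mean of the kernel to zeta <A psi, psi> *)
pose kappa : R := 2 * unit_mass R / window_mass w ^+ 2.
have w0 : 0 < w := lt_trans ltr01 w1.
have kappa0 : 0 < kappa.
  rewrite /kappa divr_gt0//; first by rewrite mulr_gt0// haar_window_gt0// ltr1n.
  rewrite exprn_gt0// haar_window_gt0//; first by rewrite divr_gt0 ?invr_gt0.
  rewrite /window_lo; apply: (@lt_trans _ _ w^-1).
    by rewrite ltr_pdivrMr// ltr_pMr ?invr_gt0// ltr1n.
  by apply: lt_trans w1; rewrite invf_lt1.
(* bounds each of the n diagonal terms, uniformly in K *)
pose D := cabs zeta * (cst 1 * mm).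
suff H n : 0 <= 'C(n, 2)%:R * (kappa * Re (zeta * t)) + n%:R * (1 + D).
  by have := quadratic_ge0 H; rewrite pmulr_rge0.
have HK K : - (cabs zeta * cst n * mm - \sum_(k < K) (cabs zeta * cst n * N k)) <=
    'C(n, 2)%:R * (kappa * Re (zeta * V K)) + n%:R * (1 + D).
  have [ts [sts wts hts]] := greedy_window a c w1 psiM psi0 zeta K n.
  have ts0 : all (fun b => 0 < b) ts.
    by apply: sub_all wts => b; exact: window_gt0.
  have bd k : cabs (zeta * L2finner (mult_dil ts (@unit_window R) phi (repr (a k)))
      (mult_dil ts (@unit_window R) phi (repr (c k)))) <= cabs zeta * cst n * N k.
    rewrite cabsM -mulrA ler_wpM2l ?cabs_ge0//.
    by apply: le_trans (mult_dil_le k ts0) _; rewrite sts.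
  have cN : series (fun k => cabs zeta * cst n * N k) @ \oo --> cabs zeta * cst n * mm.
    rewrite series_ord; under eq_fun do rewrite -mulr_sumr.
    apply: cvgM; first exact: cvg_cst.
    by rewrite -series_ord.
  have [t' ht'] : exists t', csum_to (fun k => L2finner
      (mult_dil ts (@unit_window R) phi (repr (a k)))
      (mult_dil ts (@unit_window R) phi (repr (c k)))) t'.
    by apply: csum_dominated (fun k => mult_dil_le k ts0) _; exact: nsummableZ.
  have t'0 : 0 <= t' by apply: mult_dil_pos_bounded ht'.
  have zt : csum_to (fun k => zeta * L2finner (mult_dil ts (@unit_window R) phi (repr (a k)))
      (mult_dil ts (@unit_window R) phi (repr (c k)))) (zeta * t').
    rewrite csum_toE; under eq_fun do rewrite -mulr_sumr.
    by apply: cvgCM ht'; exact: cvgC_cst.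
  have := csum_tail K bd cN zt.
  have zt0 : 0 <= Re (zeta * t').
    move: t'0; rewrite lecE /= => /andP[/eqP i0 r0].
    by rewrite cReM i0 mulr0 subr0 mulr_ge0.
  have -> : Re (\sum_(k < K) zeta * L2finner (mult_dil ts (@unit_window R) phi (repr (a k)))
      (mult_dil ts (@unit_window R) phi (repr (c k)))) =
      \sum_(s <- ts) \sum_(b <- ts) trunc_kernel a c psi zeta K s b.
    rewrite -mulr_sumr /trunc_kernel.
    under [RHS]eq_bigr do rewrite -cRe_sum -mulr_sumr.
    rewrite -cRe_sum -mulr_sumr; congr (Re (_ * _)).
    under eq_bigr => k _ do rewrite (mult_dil_corr w1 psiM psi0 ts (L2funP _) (L2funP _)).
    rewrite exchange_big; apply: eq_bigr => s _ /=.
    by rewrite exchange_big.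
  have diag : \sum_(s <- ts) trunc_kernel a c psi zeta K s s <= n%:R * D.
    have -> : n%:R * D = \sum_(s <- ts) D.
      by rewrite big_const_seq count_predT sts iter_addr_0 mulr_natl.
    rewrite big_seq [leRHS]big_seq; apply: ler_sum => s sts'.
    have s0 : all (fun b => 0 < b) [:: s] by rewrite /= (allP ts0).
    apply: le_trans (ler_norm _) _; apply: le_trans (Re_le_cabs _) _.
    rewrite cabsM /D ler_wpM2l ?cabs_ge0//; apply: le_trans (cabs_sum _ _) _.
    apply: (@le_trans _ _ (\sum_(k < K) cst 1 * N k)).
      apply: ler_sum => k _; apply: le_trans (mult_dil_le k s0).
      by rewrite (mult_dil_corr w1 psiM psi0 _ (L2funP _) (L2funP _)) !big_seq1.
    rewrite -mulr_sumr ler_wpM2l// /cst !mulr_ge0// ?exprn_ge0//;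
      by apply: le_trans (cnorm2_ge0 _) (uM 0).
  move: hts diag zt0; rewrite -/kappa -/(V K); lra.
have l1 : (- (cabs zeta * cst n * mm - \sum_(k < K) (cabs zeta * cst n * N k))) @[K --> \oo]
    --> (0 : R).
  have z : 0 = - (cabs zeta * cst n * mm - cabs zeta * cst n * mm) by rewrite subrr oppr0.
  rewrite [X in _ --> X]z; apply: cvgN; apply: cvgB; first exact: cvg_cst.
  under eq_fun do rewrite -mulr_sumr.
  apply: cvgM; first exact: cvg_cst.
  by rewrite -series_ord.
have l2 : ('C(n, 2)%:R * (kappa * Re (zeta * V K)) + n%:R * (1 + D)) @[K --> \oo]
    --> 'C(n, 2)%:R * (kappa * Re (zeta * t)) + n%:R * (1 + D).
  apply: cvgD; last exact: cvg_cst.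
  apply: cvgM; first exact: cvg_cst.
  apply: cvgM; first exact: cvg_cst.
  by have [] := cvgCM (cvgC_cst zeta) hV.
by apply: ler_cvg_to l1 l2 _; exact: nearW.
Qed.

End CompactSupport.

Section Truncation.
Variable u : L2 R.
Let f : L2fun R := repr u.

(** Where f is bounded by n and r stays away from 0 and infinity; the shift n + 2 makes
    the bound exceed 1. *)
Definition trunc_set n : set R :=
  `[n.+2%:R^-1, n.+2%:R]%classic `&`
  (@posR R `&` (fun r => cnorm2 (f r)) @^-1` `]-oo, n%:R]%classic).

Lemma measurable_trunc_set n : measurable (trunc_set n : set (measurableTypeR R)).
Proof.
apply: measurableI; first exact: measurable_itv.
have m : measurable_fun (@posR R) (fun r => cnorm2 (f r)).
  by have [[a b] _] := L2funP f; apply: measurable_funD; exact: measurable_funX.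
by apply: m => //; exact: measurable_posR.
Qed.

Definition trunc n : R -> C := fun r => (\1_(trunc_set n) r)%:C%C * f r.
Definition trunc_rest n : R -> C := fun r => (1 - \1_(trunc_set n) r)%:C%C * f r.

Let cmeas_real (h : R -> R) : measurable_fun [set: measurableTypeR R] h ->
  cmeas (fun r => (h r)%:C%C).
Proof. by move=> mh; split; [exact: measurable_funTS mh|exact: measurable_cst]. Qed.

Let meas_indic n : measurable_fun [set: measurableTypeR R] (\1_(trunc_set n) : R -> R).
Proof. by apply: measurable_indic; exact: measurable_trunc_set. Qed.

Lemma trunc_sq n : sq_integrable (trunc n).
Proof.
apply: (sq_integrable_dom (c := 1)) (L2funP f) _.
  by apply: cmeasM; [exact: cmeas_real|have [] := L2funP f].
move=> r _; rewrite cnorm2M ler_wpM2r ?cnorm2_ge0// /cnorm2 /= expr0n addr0 indicE.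
by case: (_ \in _); rewrite ?expr1n ?expr0n.
Qed.

Lemma trunc_rest_le n r : cnorm2 (trunc_rest n r) <= cnorm2 (f r).
Proof.
rewrite cnorm2M -[leRHS]mul1r ler_wpM2r ?cnorm2_ge0// /cnorm2 /= expr0n addr0 indicE.
by case: (_ \in _); rewrite ?subrr ?subr0 ?expr1n ?expr0n.
Qed.

Lemma trunc_rest_sq n : sq_integrable (trunc_rest n).
Proof.
apply: (sq_integrable_dom (c := 1)) (L2funP f) _.
  apply: cmeasM; last by have [] := L2funP f.
  by apply: (cmeas_real (h := fun r => 1 - \1_(trunc_set n) r)); exact: measurable_funB.
by move=> r _; rewrite mul1r trunc_rest_le.
Qed.

Lemma trunc_decomp n :
  u = \pi_(L2 R) (mkL2 (trunc_sq n)) + \pi_(L2 R) (mkL2 (trunc_rest_sq n)).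
Proof.
rewrite -pi_L2D -[LHS]reprK; apply/L2_eqP; apply: aeW => r _ /=.
by rewrite !fctE /trunc /trunc_rest -mulrDl -rmorphD addrC subrK mul1r.
Qed.

(** Dominated convergence, since every r > 0 eventually belongs to the sets. *)
Lemma trunc_rest_cvg0 :
  L2norm (\pi_(L2 R) (mkL2 (trunc_rest_sq n))) @[n --> \oo] --> (0 : R).
Proof.
rewrite (_ : (fun n => L2norm _) =
  (fun n => Num.sqrt (haar (fun r => cnorm2 (trunc_rest n r))))); last first.
  by apply/funext => n; rewrite L2normE.
suff h : haar (fun r => cnorm2 (trunc_rest n r)) @[n --> \oo] --> (0 : R).
  rewrite -[X in _ --> X]sqrtr0; apply: continuous_cvg h.
  exact: sqrt_continuous.
have h0 : haar (fun=> 0 : R) = 0.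
  by rewrite (@eq_haar _ _ (fun=> 0 * 0)) ?haarZ ?mul0r//; exact: haarI0.
rewrite -[X in _ --> X]h0.
apply: (haar_dominated (g := fun r => cnorm2 (f r))).
- move=> n; have [[m1 m2] _] := trunc_rest_sq n.
  by apply: measurable_funD; exact: measurable_funX.
- move=> r r0; apply: cvg_near_cst; near=> n.
  rewrite /trunc_rest /= indicE mem_set ?subrr ?mul0r; first by rewrite /cnorm2 /= expr0n addr0.
  split.
    rewrite /= in_itv /=; apply/andP; split.
      rewrite -[leRHS]invrK lef_pV2 ?posrE ?invr_gt0//.
      apply: (@le_trans _ _ n%:R); last by rewrite ler_nat -addn2 leq_addr.
      by near: n; exact: nbhs_infty_ger.
    apply: (@le_trans _ _ n%:R); last by rewrite ler_nat -addn2 leq_addr.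
    by near: n; exact: nbhs_infty_ger.
  split; first by rewrite posRE.
  by rewrite /= in_itv /=; near: n; exact: nbhs_infty_ger.
- by move=> n r _; rewrite ger0_norm ?cnorm2_ge0// trunc_rest_le.
- exact/sq_integrable_haarI/L2funP.
Unshelve. all: by end_near. Qed.

Lemma trunc_bound n r : cnorm2 (trunc n r) <= n%:R.
Proof.
rewrite /trunc indicE; case: (boolP (r \in _)) => [|_]; last first.
  by rewrite mul0r /cnorm2 /= expr0n addr0.
by rewrite inE => -[_ [_ /=]]; rewrite in_itv /= mul1r.
Qed.

Lemma trunc_supp n r : ~~ (n.+2%:R^-1 <= r <= n.+2%:R) -> trunc n r = 0.
Proof.
move=> h; rewrite /trunc indicE memNset ?mul0r//.
by move=> [/= h' _]; move: h; rewrite in_itv /= in h'; rewrite h'.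
Qed.

Lemma trunc_measurable n (p : C -> R) :
  measurable_fun (@posR R) (fun r => p (f r)) ->
  measurable_fun [set: measurableTypeR R] (fun r => \1_(trunc_set n) r * p (f r)).
Proof.
move=> mp; rewrite (_ : (fun _ => _) = (fun r => p (f r)) \_ (trunc_set n)).
  apply: ((@measurable_restrictT _ _ (measurableTypeR R) _ _ _ (measurable_trunc_set n)).1).
  apply: measurable_funS mp; first exact: measurable_posR.
  by move=> r [_ []].
by apply/funext => r; rewrite patchE indicE; case: (_ \in _); rewrite ?mul1r ?mul0r.
Qed.

End Truncation.

(** A complex number z with Re (zeta z) >= 0 for zeta = 1, i, -i is a nonnegative
    real; the general case follows by truncation, A being bounded. *)
Lemma positive_type_positive_op (A : {linear L2 R -> L2 R}) (a c : nat -> L2 R) :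
  bounded_op A -> nsummable a c -> rank_one_series A a c ->
  (forall s t, csum_to (fun k => L2inner (Ucomb s (a k)) (Ucomb s (c k))) t -> 0 <= t) ->
  positive_op A.
Proof.
move=> [M AM] S Aac Upos u.
pose v n := \pi_(L2 R) (mkL2 (trunc_sq u n)).
pose d n := \pi_(L2 R) (mkL2 (trunc_rest_sq u n)).
have vE n : v n = u - d n by rewrite [in RHS](trunc_decomp u n) addrK.
apply: (@cvgC_ge0 _ (fun n => L2inner (A (v n)) (v n))).
  move=> n.
  have Re_ge0 zeta : 0 <= Re zeta -> 0 <= Re (zeta * L2inner (A (v n)) (v n)).
    move=> z0; apply: (compact_support_ge0 S Upos (w := n.+2%:R) (M := n%:R)
      (psi := mkL2 (trunc_sq u n))) z0 (Aac _ _).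
    - by rewrite ltr1n.
    - exact: trunc_bound.
    - exact: trunc_supp.
    - have [[m1 m2] _] := L2funP (repr u).
      have := trunc_measurable n m1; apply: eq_measurable_fun => r _ /=.
      by rewrite /trunc cReM /= mul0r subr0.
    - have [[m1 m2] _] := L2funP (repr u).
      have := trunc_measurable n m2; apply: eq_measurable_fun => r _ /=.
      by rewrite /trunc cImM /= mul0r addr0.
  have h1 := Re_ge0 1 ler01; rewrite mul1r in h1.
  have h2 : 0 <= - Im (L2inner (A (v n)) (v n)).
    by have := Re_ge0 'i%C (lexx 0); rewrite cReM /= mul0r mul1r sub0r.
  have h3 : 0 <= Im (L2inner (A (v n)) (v n)).
    by have := Re_ge0 (- 'i%C) _; rewrite cReM /= oppr0 mul0r sub0r mulN1r opprK; apply.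
  rewrite lecE /= h1 andbT; apply/eqP/le_anti; rewrite h3 andbT.
  by rewrite -oppr_ge0.
apply: (@cvgC_cabs _ _ _ (fun n => (`|M| * L2norm u) * L2norm (d n) +
  (`|M| * L2norm (d n)) * L2norm u + (`|M| * L2norm (d n)) * L2norm (d n))).
  move=> n; rewrite vE linearB !ipBl !ipBr.
  rewrite (_ : _ - _ = \sum_(z <- [:: - L2inner (A u) (d n); - L2inner (A (d n)) u;
     L2inner (A (d n)) (d n)]) z); last by rewrite !big_cons big_nil; ring.
  apply: le_trans (cabs_sum _ _) _; rewrite !big_cons big_nil addr0 addrA.
  have cN z : cabs (- z) = cabs z.
    by case: z => z1 z2; rewrite /cabs /cnorm2 /= !sqrrN.
  have B x y : cabs (L2inner (A x) y) <= `|M| * L2norm x * L2norm y.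
    apply: le_trans (ip_CS _ _) _; rewrite ler_wpM2r ?L2norm_ge0//.
    by apply: le_trans (AM _) _; rewrite ler_wpM2r ?L2norm_ge0// ler_norm.
  by rewrite !cN !lerD.
have d0 : L2norm (d n) @[n --> \oo] --> (0 : R) by exact: trunc_rest_cvg0.
have z : 0 = (`|M| * L2norm u) * 0 + (`|M| * 0) * L2norm u + (`|M| * 0) * 0 :> R by ring.
rewrite [X in _ --> X]z.
apply: cvgD; first apply: cvgD.
- by apply: cvgM (d0); exact: cvg_cst.
- by apply: cvgM; [apply: cvgM (d0); exact: cvg_cst|exact: cvg_cst].
- by apply: cvgM (d0); apply: cvgM (d0); exact: cvg_cst.
Qed.

End Conclusion.

Theorem theorem5p10 (R : realType) (A : {linear L2 R -> L2 R})
    (hA : trace_class A) :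
  positive_op A <-> positive_type (fun g : Aff R => trace (fun f => A (U g f))).
Proof.
have [a [c [S Aac]]] := trace_class_rank_one hA.
split; first exact: positive_op_positive_type hA S Aac.
move=> /(positive_type_Ucomb hA S Aac) Upos.
exact: positive_type_positive_op hA.1 S Aac Upos.
Qed.
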